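(* The optimization problem of finding a pair of vertices of a polytope at maximum shortest-path distance on the 1-skeleton of the polytope is APX-hard.
   Context: The polytope is given as input by an explicit system of linear inequalities $\{x\in\mathbb R^d: Ax\le b\}$ with rational data (hardness holds already for fractional matching polytopes $\{x\in\mathbb R^E: \sum_{e\ni v}x_e\le 1\ \forall v\in V,\ x\ge 0\}$ of simple graphs $G=(V,E)$). The 1-skeleton of a polytope is the graph whose nodes are its vertices and whose edges are its 1-dimensional faces; a feasible solution is a pair of vertices, and its value is their shortest-path distance in the 1-skeleton, to be maximized. APX-hard means that every problem in APX reduces to it via an approximation-preserving (e.g. L-) reduction; in particular, unless P=NP, it admits no polynomial-time approximation scheme. *)

(* Defs.v *)
From HB Require Import structures.
From mathcomp Require Import all_boot all_order all_algebra.
From mathcomp Require Import boolp classical_sets reals.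

Set Implicit Arguments.
Unset Strict Implicit.
Unset Printing Implicit Defensive.

Import Order.TTheory GRing.Theory Num.Theory.
Local Open Scope ring_scope.

(** * Deterministic multi-tape Turing machines *)

Definition bits := seq bool.

(* [None] is the blank, [Some (inl b)] an input/output bit, and
   [Some (inr s)] a work symbol. *)
Definition cell (S : finType) : finType := option (bool + S)%type.

Inductive move := MoveL | MoveR | MoveN.

(* The cells left of the head (nearest first), the scanned cell, and the cells
   right of the head (nearest first); all further cells are blank. *)
Record tape (S : finType) := Tape {
  tape_left : seq (cell S);
  tape_head : cell S;
  tape_right : seq (cell S) }.

Definition tape_write (S : finType) (c : cell S) (t : tape S) : tape S :=
  Tape (tape_left t) c (tape_right t).

Definition tape_move (S : finType) (m : move) (t : tape S) : tape S :=
  match m with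
  | MoveL => Tape (behead (tape_left t)) (head None (tape_left t))
                  (tape_head t :: tape_right t)
  | MoveR => Tape (tape_head t :: tape_left t) (head None (tape_right t))
                  (behead (tape_right t))
  | MoveN => t
  end.

Definition tape_init (S : finType) (w : bits) : tape S :=
  let cs : seq (cell S) := [seq Some (inl b) | b <- w] in
  Tape [::] (head None cs) (behead cs).

Fixpoint leading_bits (S : finType) (cs : seq (cell S)) : bits :=
  if cs is Some (inl b) :: cs' then b :: leading_bits cs' else [::].

Definition tape_output (S : finType) (t : tape S) : bits :=
  leading_bits (tape_head t :: tape_right t).

(* [tm_tapes.+1] tapes; a [None] transition means that the machine halts. *)
Record tm := TM {
  tm_tapes : nat;
  tm_state : finType;
  tm_symbol : finType;
  tm_start : tm_state;
  tm_trans : tm_state -> {ffun 'I_tm_tapes.+1 -> cell tm_symbol} ->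
    option (tm_state * ('I_tm_tapes.+1 -> cell tm_symbol * move)) }.

Record config (M : tm) := Config {
  cfg_state : tm_state M;
  cfg_tape : 'I_(tm_tapes M).+1 -> tape (tm_symbol M) }.

Definition tm_step (M : tm) (c : config M) : option (config M) :=
  if tm_trans (cfg_state c) [ffun i => tape_head (cfg_tape c i)] is Some (q, a)
  then Some (Config q
         (fun i => tape_move (a i).2 (tape_write (a i).1 (cfg_tape c i))))
  else None.

Definition tm_run (M : tm) (t : nat) (c : config M) : config M :=
  iter t (fun c => odflt c (tm_step c)) c.

(* The j-th input string is written on the j-th tape. *)
Definition tm_init (M : tm) (ws : seq bits) : config M :=
  Config (tm_start M) (fun i => tape_init _ (nth [::] ws i)).

(* The output is read on the first tape, from the head to the right. *)
Definition tm_computes_in (M : tm) (t : nat) (ws : seq bits) (out : bits) : Prop :=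
  let c := tm_run t (tm_init M ws) in
  tm_step c = None /\ tape_output (cfg_tape c ord0) = out.

Definition poly_bound (k n : nat) : nat := (k * n ^ k + k)%N.

Definition tm_computes_poly (M : tm) (k : nat) (ws : seq bits) (out : bits) : Prop :=
  tm_computes_in M (poly_bound k (sumn [seq size w | w <- ws])) ws out.

(** * Binary encodings *)

Fixpoint enc_pos (p : BinNums.positive) : bits :=
  match p with
  | BinNums.xH => [:: true]
  | BinNums.xO p => false :: enc_pos p
  | BinNums.xI p => true :: enc_pos p
  end.

Definition enc_nat (n : nat) : bits :=
  if bin_of_nat n is BinNums.Npos p then enc_pos p else [::].

Definition enc_int (z : int) : bits :=
  match z with Posz n => false :: enc_nat n | Negz n => true :: enc_nat n end.

(* Self-delimiting form of a string: each bit b becomes 1b, and 0 ends it. *)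
Fixpoint delimit (w : bits) : bits :=
  if w is b :: w' then [:: true, b & delimit w'] else [:: false].

Definition enc_seq (T : Type) (enc : T -> bits) (s : seq T) : bits :=
  flatten [seq delimit (enc x) | x <- s].

Definition enc_rat (q : rat) : bits := enc_seq enc_int [:: numq q; denq q].

Definition enc_mx (m n : nat) (A : 'M[rat]_(m, n)) : bits :=
  enc_seq (enc_seq enc_rat) [seq [seq A i j | j <- enum 'I_n] | i <- enum 'I_m].

Lemma enc_pos_nil p : enc_pos p <> [::].
Proof. by case: p. Qed.

Lemma enc_pos_inj : injective enc_pos.
Proof.
elim=> [p IH|p IH|] [q|q|] //= [].
- by move/IH ->.
- by move/enc_pos_nil.
- by move/IH ->.
- by move/esym/enc_pos_nil.
Qed.

Lemma enc_nat_inj : injective enc_nat.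
Proof.
move=> m n; rewrite /enc_nat => e; apply: (can_inj bin_of_natK).
case: (bin_of_nat m) (bin_of_nat n) e => [|p] [|q] //.
- by move/esym/enc_pos_nil.
- by move/enc_pos_nil.
- by move/enc_pos_inj ->.
Qed.

Lemma enc_int_inj : injective enc_int.
Proof. by move=> [m|m] [n|n] // [] /enc_nat_inj ->. Qed.

Lemma delimit_cat_inj u v s t :
  delimit u ++ s = delimit v ++ t -> u = v /\ s = t.
Proof.
elim: u v => [|a u IH] [|b v] //= []; first by move=> ->.
by move=> -> /IH[-> ->].
Qed.

Lemma enc_seq_inj (T : Type) (enc : T -> bits) :
  injective enc -> injective (enc_seq enc).
Proof.
move=> enc_inj; elim=> [|x s IH] [|y t] //=; rewrite /enc_seq /=.
- by case: (enc y).
- by case: (enc x).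
- by move/delimit_cat_inj => [/enc_inj -> /IH ->].
Qed.

Lemma enc_rat_inj : injective enc_rat.
Proof.
move=> p q /(enc_seq_inj enc_int_inj) [en ed].
by rewrite -[p]divq_num_den -[q]divq_num_den en ed.
Qed.

Lemma enc_mx_inj m n : injective (@enc_mx m n).
Proof.
move=> A B /(enc_seq_inj (enc_seq_inj enc_rat_inj)) /eq_in_map eAB.
apply/matrixP => i j.
have /eq_in_map -> // : [seq A i j | j <- enum 'I_n] = [seq B i j | j <- enum 'I_n].
  by apply: eAB; rewrite mem_enum.
by rewrite mem_enum.
Qed.

(** * Optimization problems *)

Inductive goal := Minimize | Maximize.

(* [sol x] is the type of feasible solutions of the instance [x]. *)
Record opt_problem := OptProblem {
  opt_goal : goal;
  inst : Type;
  sol : inst -> Type;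
  value : forall x : inst, sol x -> nat;
  enc_inst : inst -> bits;
  enc_sol : forall x : inst, sol x -> bits;
  enc_inst_inj : injective enc_inst;
  enc_sol_inj : forall x : inst, injective (enc_sol (x := x)) }.

Definition is_opt (A : opt_problem) (x : inst A) (n : nat) : Prop :=
  (exists y : sol x, value y = n) /\
  (forall y : sol x, match opt_goal A with
                     | Minimize => (n <= value y)%N
                     | Maximize => (value y <= n)%N
                     end).

(* The performance ratio max(value y / opt, opt / value y) is at most r,
   with 0 / 0 read as 1 and n / 0 as infinity for n > 0. *)
Definition ratio_le (A : opt_problem) (r : rat) (x : inst A) (y : sol x) : Prop :=
  exists2 n, is_opt x n &
    n%:R <= r * (value y)%:R /\ (value y)%:R <= r * n%:R.

(* Instances are recognizable in polynomial time, solutions have polynomial size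
   and are recognizable in polynomial time, and values are computable in
   polynomial time. *)
Definition NPO (A : opt_problem) : Prop :=
  [/\ exists M k, forall w : bits,
        tm_computes_poly M k [:: w] [:: `[< exists x : inst A, w = enc_inst x >]],
      exists k, forall (x : inst A) (y : sol x),
        (size (enc_sol y) <= poly_bound k (size (enc_inst x)))%N,
      exists M k, forall (x : inst A) (w : bits),
        tm_computes_poly M k [:: enc_inst x; w]
          [:: `[< exists y : sol x, w = enc_sol y >]] &
      exists M k, forall (x : inst A) (y : sol x),
        tm_computes_poly M k [:: enc_inst x; enc_sol y] (enc_nat (value y))].

Definition APX (A : opt_problem) : Prop :=
  NPO A /\
  exists (r : rat) (M : tm) (k : nat), 1 < r /\
    forall x : inst A, inhabited (sol x) ->
      exists2 y : sol x, ratio_le r y &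
        tm_computes_poly M k [:: enc_inst x] (enc_sol y).

(* Approximation-preserving (AP-) reduction in the sense of Crescenzi, Kann,
   Silvestri and Trevisan: f and g also receive the ratio r, and run in time
   polynomial for each fixed r. *)
Definition AP_reducible (A B : opt_problem) : Prop :=
  exists (alpha : rat) (f : rat -> inst A -> inst B)
         (g : forall (r : rat) (x : inst A), sol (f r x) -> sol x),
  [/\ 1 <= alpha,
      exists M, forall r, 1 < r -> exists k, forall x : inst A,
        tm_computes_poly M k [:: enc_inst x; enc_rat r] (enc_inst (f r x)),
      exists M, forall r, 1 < r -> exists k, forall (x : inst A) (y : sol (f r x)),
        tm_computes_poly M k [:: enc_inst x; enc_sol y; enc_rat r]
          (enc_sol (g r x y)),
      forall r x, 1 < r -> inhabited (sol x) -> inhabited (sol (f r x)) &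
      forall r x (y : sol (f r x)), 1 < r ->
        ratio_le r y -> ratio_le (1 + alpha * (r - 1)) (g r x y)].

Definition APX_hard (B : opt_problem) : Prop :=
  forall A : opt_problem, APX A -> AP_reducible A B.

(** * Polytopes and their 1-skeleton *)

Local Open Scope classical_set_scope.

Section Polytopes.
Variables (R : realType) (d : nat).
Implicit Types (P F : set 'cV[R]_d) (u v : 'cV[R]_d).

Definition polyhedron (m : nat) (A : 'M[R]_(m, d)) (b : 'cV[R]_m) : set 'cV[R]_d :=
  [set x | forall i, (A *m x) i 0 <= b i 0].

Definition bounded P : Prop :=
  exists C : R, forall x, P x -> forall i, `|x i 0| <= C.

Definition is_face P F : Prop :=
  exists (c : 'rV[R]_d) (delta : R),
    (forall x, P x -> (c *m x) 0 0 <= delta) /\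
    F = P `&` [set x | (c *m x) 0 0 = delta].

(* p and the points p + (row i V)^T form an affine basis, contained in F, of
   the affine hull of F. *)
Definition affine_dim F (k : nat) : Prop :=
  exists (p : 'cV[R]_d) (V : 'M[R]_(k, d)),
    [/\ row_free V, F p, forall i, F (p + (row i V)^T) &
        forall x, F x -> ((x - p)^T <= V)%MS].

Definition is_vertex P v : Prop := is_face P [set v].

Definition adjacent P u v : Prop :=
  [/\ is_vertex P u, is_vertex P v, u <> v &
      exists F, [/\ is_face P F, affine_dim F 1, F u & F v]].

Fixpoint walk P (n : nat) u v : Prop :=
  if n is n'.+1 then exists w, adjacent P u w /\ walk P n' w v else u = v.

(* The default 0 is never used for vertices of a polytope, as the 1-skeleton of
   a polytope is connected. *)
Definition skeleton_dist P u v : nat :=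
  xget 0%N [set n | walk P n u v /\ forall m, walk P m u v -> (n <= m)%N].

End Polytopes.

Definition rat_polyhedron (R : realType) (m d : nat) (A : 'M[rat]_(m, d))
    (b : 'cV[rat]_m) : set 'cV[R]_d :=
  polyhedron (map_mx ratr A) (map_mx ratr b).
Arguments rat_polyhedron R {m d} A b.

Record polytope (R : realType) := Polytope {
  pt_ineqs : nat;
  pt_dim : nat;
  pt_A : 'M[rat]_(pt_ineqs, pt_dim);
  pt_b : 'cV[rat]_pt_ineqs;
  pt_bounded : bounded (rat_polyhedron R pt_A pt_b) }.

Definition pt_set (R : realType) (P : polytope R) : set 'cV[R]_(pt_dim P) :=
  rat_polyhedron R (pt_A P) (pt_b P).
Arguments pt_set {R} P.

Definition enc_polytope (R : realType) (P : polytope R) : bits :=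
  enc_seq id [:: enc_nat (pt_ineqs P); enc_nat (pt_dim P);
                 enc_mx (pt_A P); enc_mx (pt_b P)].

Lemma enc_polytope_inj (R : realType) : injective (@enc_polytope R).
Proof.
move=> [m d A b hP] [m' d' A' b' hP'] /(enc_seq_inj (@inj_id bits)) /= [].
move=> /enc_nat_inj em /enc_nat_inj ed; subst m' d'.
move=> /enc_mx_inj eA /enc_mx_inj eb; subst A' b'.
by rewrite (Prop_irrelevance hP hP').
Qed.

(* The vertices of a polytope given by rational data are rational, so every pair
   of vertices is of this form. *)
Record vertex_pair (R : realType) (P : polytope R) := VertexPair {
  vp_fst : 'cV[rat]_(pt_dim P);
  vp_snd : 'cV[rat]_(pt_dim P);
  vp_fstP : is_vertex (pt_set P) (map_mx ratr vp_fst);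
  vp_sndP : is_vertex (pt_set P) (map_mx ratr vp_snd) }.

Definition vp_dist (R : realType) (P : polytope R) (y : vertex_pair P) : nat :=
  skeleton_dist (pt_set P) (map_mx ratr (vp_fst y)) (map_mx ratr (vp_snd y)).

Definition enc_vertex_pair (R : realType) (P : polytope R) (y : vertex_pair P) : bits :=
  enc_seq (@enc_mx _ _) [:: vp_fst y; vp_snd y].

Lemma enc_vertex_pair_inj (R : realType) (P : polytope R) :
  injective (@enc_vertex_pair R P).
Proof.
move=> [u v hu hv] [u' v' hu' hv'] /(enc_seq_inj (@enc_mx_inj _ _)) /= [eu ev].
subst u' v'; by rewrite (Prop_irrelevance hu hu') (Prop_irrelevance hv hv').
Qed.

Definition polytope_diameter (R : realType) : opt_problem :=
  OptProblem Maximize (@vp_dist R) (@enc_polytope_inj R) (@enc_vertex_pair_inj R).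

(* Main.v *)
Require Import Defs.
From HB Require Import structures.
From mathcomp Require Import all_boot all_order all_algebra.
From mathcomp Require Import boolp classical_sets reals.
From mathcomp Require Import zify ring lra.

(** For a CNF formula [phi] let [Q phi] be the polytope in the variables [lam], [z]
    and [x_v] given by [0 <= x_v <= lam], [|z| + lam <= 1] and [|z| <= S_c] for every
    clause [c], where [S_c] is the sum of the literals of [c] and a negated variable
    counts [lam - x_v].  A vertex is good if [lam = 1] and every [S_c] is positive;
    good vertices are the satisfying assignments.  At a vertex with [lam = 1] and
    [S_c = 0] the coordinate [z] is blocked, so that it is adjacent to the apex [0];
    a good vertex is at distance exactly 2 from the apex.  With four dummy variables,
    two good vertices that differ in all of them are at distance 4.  Hence the diameter
    of [Q phi] is 4 if [phi] is satisfiable and 2 otherwise, and a pair of vertices at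
    distance more than 2 exhibits a satisfying assignment.

    Let [A] be in APX, and let [v0] be the value of the solution of [x] found by the
    approximation algorithm of [A].  The reduction maps [x] to the product of the
    polytopes [Q phi_l], where [phi_l] says that [x] has a solution whose value is
    better than the [l]-th of finitely many equally spaced thresholds covering the
    range of the optimum determined by [v0]; distances in a product add up.  The
    solution recovered from a pair of vertices is the best one among the solution of
    value [v0] and those read off from the good blocks.  A pair of vertices of ratio [r]
    misses at most a fraction [2 (r - 1)] of the thresholds, and the number of missed
    thresholds between the value of the recovered solution and the optimum bounds their
    difference.

    The formula [phi_l] is the tableau of a stack program that runs the verifier and
    the evaluator of [A]; both maps of the reduction are stack programs as well, and
    stack programs are compiled to Turing machines. *)

Set Implicit Arguments.
Unset Strict Implicit.
Unset Printing Implicit Defensive.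

Import Order.TTheory GRing.Theory Num.Theory.

Local Open Scope ring_scope.

(** * Faces of polyhedra *)

Lemma exists_seq_argmin (R : realDomainType) (T : eqType) (g : T -> R) (s : seq T) :
  s != [::] -> exists2 a, a \in s & {in s, forall b, g a <= g b}.
Proof.
elim: s => // a s IH _; have [->|/IH[c cs cle]] := eqVneq s [::].
  by exists a; rewrite ?mem_head // => b; rewrite inE => /eqP ->.
have [le|lt] := lerP (g a) (g c); [exists a | exists c]; rewrite ?mem_head ?inE ?cs ?orbT //.
  by move=> b /predU1P[-> //|/cle]; apply: le_trans.
by move=> b /predU1P[->|/cle //]; apply: ltW.
Qed.

Lemma exists_pos_lower_bound (R : realDomainType) (T : eqType) (g : T -> R) (s : seq T) :
  {in s, forall a, 0 < g a} -> exists2 e, 0 < e & {in s, forall a, e <= g a}.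
Proof.
move=> g_gt0; have [->|/(exists_seq_argmin g)[a sa ale]] := eqVneq s [::]; first by exists 1.
by exists (g a); first exact: g_gt0.
Qed.

Lemma mulmx_comb (R : comPzRingType) m d (c : 'M[R]_(m, d)) (x y : 'cV[R]_d) a e i :
  (c *m (a *: y + e *: x)) i 0 = a * (c *m y) i 0 + e * (c *m x) i 0.
Proof. by rewrite mulmxDr -!scalemxAr mxE [X in X + _]mxE [X in _ + X]mxE. Qed.

Section Faces.
Variables (R : realType) (d m : nat) (A : 'M[R]_(m, d)) (b : 'cV[R]_m).
Local Notation P := (polyhedron A b).
Implicit Types (u v x y : 'cV[R]_d) (F : set 'cV[R]_d).

(* [x] lies in the smallest face of [P] through [p]: the segment from [x] to [p]
   extends inside [P] beyond [p]. *)
Definition beyond p x := exists y e, [/\ P y, 0 < e & (1 + e) *: p = y + e *: x].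

Lemma beyond_supporting (c : 'rV[R]_d) delta p x :
  (forall y, P y -> (c *m y) 0 0 <= delta) -> (c *m p) 0 0 = delta -> P x -> beyond p x ->
  (c *m x) 0 0 = delta.
Proof.
move=> cP cp Px [y [e [Py e0 pE]]]; apply/eqP; rewrite eq_le cP //=.
move/(congr1 (fun q => (c *m (1 *: q)) 0 0)): pE.
rewrite !scale1r -[(1 + e) *: p]addr0 -(scale0r 0) mulmx_comb cp mul0r addr0.
by rewrite -[y]scale1r mulmx_comb mul1r; have := cP _ Py; nra.
Qed.

Lemma face_beyond F p x : is_face P F -> F p -> P x -> beyond p x -> F x.
Proof.
move=> [c [delta [cP ->]]] [_ /= cp] Px px; split=> //=.
exact: beyond_supporting cP cp Px px.
Qed.

Lemma beyond_tight p x : P p -> P x ->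
  (forall i, (A *m p) i 0 = b i 0 -> (A *m x) i 0 = b i 0) -> beyond p x.
Proof.
move=> Pp Px tight; pose gap i := b i 0 - (A *m p) i 0.
pose g i := if gap i == 0 then 1 else gap i / (1 + `|(A *m p) i 0 - (A *m x) i 0|).
have [i _|e e0 e_le] := @exists_pos_lower_bound R _ g (enum 'I_m).
  rewrite /g; case: eqVneq => // gap_neq0; apply: divr_gt0; last first.
    by apply: (lt_le_trans ltr01); rewrite lerDl.
  by rewrite lt_def gap_neq0 subr_ge0 Pp.
exists ((1 + e) *: p - e *: x), e; split=> // [i|]; last by rewrite subrK.
rewrite -scaleNr mulmx_comb; have := e_le i; rewrite mem_enum => /(_ isT); rewrite /g.
case: eqVneq => [/eqP|_]; first by rewrite subr_eq0 eq_sym => /eqP pi _; rewrite tight // pi; lra.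
have a0 : 0 <= `|(A *m p) i 0 - (A *m x) i 0| by [].
have a1 := ler_norm ((A *m p) i 0 - (A *m x) i 0).
by rewrite ler_pdivlMr /gap; [nra | lra].
Qed.

Lemma is_face_beyond p : P p -> is_face P (fun x => P x /\ beyond p x).
Proof.
move=> Pp; pose I := [pred i | (A *m p) i 0 == b i 0].
pose c := \sum_(i | I i) row i A; pose delta := \sum_(i | I i) b i 0.
have cE x : (c *m x) 0 0 = \sum_(i | I i) (A *m x) i 0.
  by rewrite mulmx_suml summxE; apply: eq_bigr => i _; rewrite -row_mul mxE.
have cP x : P x -> (c *m x) 0 0 <= delta by move=> Px; rewrite cE ler_sum.
have cp : (c *m p) 0 0 = delta by rewrite cE; apply: eq_bigr => i /eqP.
exists c, delta; split=> //; apply/seteqP; split=> x /= [Px xp]; split=> //.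
  exact: beyond_supporting cP cp Px xp.
apply: beyond_tight => // i /eqP pi; apply/eqP; rewrite eq_sym -subr_eq0; apply/eqP.
have sum0 : \sum_(i | I i) (b i 0 - (A *m x) i 0) = 0 by rewrite sumrB -cE xp subrr.
by apply: (psumr_eq0P _ sum0) => // j _; rewrite subr_ge0.
Qed.

Lemma vertex_in v : is_vertex P v -> P v.
Proof. by move=> [c [delta [_ vE]]]; have : [set v]%classic v by []; rewrite vE => -[]. Qed.

Lemma is_vertexP v : is_vertex P v <-> P v /\ (forall x, P x -> beyond v x -> x = v).
Proof.
split=> [vV|[Pv vmin]].
  by split=> [|x Px bx]; [exact: vertex_in | exact: face_beyond vV (erefl v) Px bx].
rewrite /is_vertex.
suff -> : [set v]%classic = (fun x => P x /\ beyond v x) by exact: is_face_beyond.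
apply/seteqP; split=> x /=; last by move=> [Px /vmin]; exact.
move=> ->; split=> //; exists v, 1; split=> //.
by rewrite scalerDl scale1r.
Qed.

Lemma mulmx_midpoint k (c : 'M[R]_(k, d)) u v i :
  (c *m (2^-1 *: (u + v))) i 0 = 2^-1 * ((c *m u) i 0 + (c *m v) i 0).
Proof. by rewrite -scalemxAr mulmxDr !mxE. Qed.

Lemma polyhedron_midpoint u v : P u -> P v -> P (2^-1 *: (u + v)).
Proof. by move=> Pu Pv i; rewrite mulmx_midpoint; have := Pu i; have := Pv i; lra. Qed.

Lemma face_midpoint F u v : is_face P F -> F u -> F v -> F (2^-1 *: (u + v)).
Proof.
move=> [c [delta [_ ->]]] [Pu /= cu] [Pv /= cv].
by split=> /=; [exact: polyhedron_midpoint | rewrite mulmx_midpoint cu cv; lra].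
Qed.

Lemma beyond_midpoint u v : P v -> beyond (2^-1 *: (u + v)) u.
Proof.
move=> Pv; have half2 : (1 + 1 : R) * 2^-1 = 1 by lra.
by exists v, 1; split; rewrite // scalerA half2 !scale1r addrC.
Qed.

Lemma affine_dim1_line F u v x : affine_dim F 1 -> F u -> F v -> F x -> u <> v ->
  exists s, x = u + s *: (v - u).
Proof.
move=> [p [V [_ Fp _ FV]]] Fu Fv Fx uv.
have sub_uV w : F w -> ((w - u)^T <= V)%MS.
  move=> Fw; have -> : (w - u)^T = (w - p)^T - (u - p)^T.
    by rewrite -linearB /= opprB addrA subrK.
  by rewrite addmx_sub ?eqmx_opp ?FV.
have /sub_rVP[a va] := sub_uV _ Fv; have /sub_rVP[c xc] := sub_uV _ Fx.
have a0 : a != 0.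
  apply/eqP => a0; apply: uv; move: va; rewrite a0 scale0r => /(congr1 trmx).
  by rewrite trmxK trmx0 => /eqP; rewrite subr_eq0 => /eqP.
exists (c / a); apply/eqP; rewrite addrC -subr_eq; apply/eqP/trmx_inj.
by rewrite linearZ /= va xc scalerA mulfVK.
Qed.

Lemma line_affine_dim1 F u v : F u -> F v -> u <> v ->
  (forall x, F x -> exists s, x = u + s *: (v - u)) -> affine_dim F 1.
Proof.
move=> Fu Fv uv line; exists u, ((v - u)^T); split=> //.
- suff nz : (v - u)^T != 0 by rewrite /row_free rank_rV nz.
  apply/eqP => /(congr1 trmx).
  by rewrite trmxK trmx0 => /eqP; rewrite subr_eq0 => /eqP /esym /uv.
- by move=> i; rewrite (ord1 i) row_id trmxK addrC subrK.
- by move=> x /line[s ->]; rewrite addrC addKr linearZ /=; exact: scalemx_sub.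
Qed.

Lemma adjacentP u v : adjacent P u v <->
  [/\ is_vertex P u, is_vertex P v, u <> v &
     forall x, P x -> beyond (2^-1 *: (u + v)) x -> exists s, x = u + s *: (v - u)].
Proof.
split=> [[uV vV uv [F [Ff F1 Fu Fv]]]|[uV vV uv line]]; split=> //.
  move=> x Px bx; apply: (affine_dim1_line F1 Fu Fv _ uv).
  exact: face_beyond Ff (face_midpoint Ff Fu Fv) Px bx.
have Pu := vertex_in uV; have Pv := vertex_in vV.
have bu := @beyond_midpoint u v Pv.
have bv : beyond (2^-1 *: (u + v)) v by rewrite addrC; exact: beyond_midpoint.
exists (fun x => P x /\ beyond (2^-1 *: (u + v)) x); split=> //.
  exact: is_face_beyond (polyhedron_midpoint Pu Pv).
by apply: (line_affine_dim1 _ _ uv) => // x [] /line.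
Qed.

End Faces.

Section Extremal.
Variables (R : realType) (W : Type).
Implicit Types (Q : (W -> R) -> Prop) (u v w x y : W -> R).

Definition midpoint u v : W -> R := fun i => 2^-1 * (u i + v i).

Definition extremal Q v := Q v /\ forall x y e, Q x -> Q y -> 0 < e ->
  (forall i, (1 + e) * v i = y i + e * x i) -> x = v.

Definition edge Q u v := [/\ extremal Q u, extremal Q v, u <> v &
  forall x y e, Q x -> Q y -> 0 < e ->
    (forall i, (1 + e) * midpoint u v i = y i + e * x i) ->
    exists s, forall i, x i = u i + s * (v i - u i)].

Lemma extremal_shift Q v w : extremal Q v ->
  Q (fun i => v i + w i) -> Q (fun i => v i - w i) -> forall i, w i = 0.
Proof.
move=> [_ vmin] Qp Qm i.
have := vmin _ _ 1 Qp Qm ltr01 (fun i => _).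
move=> /(_ _)/(congr1 (fun g => g i)) => E.
suff : v i + w i = v i by lra.
by apply: E => j; lra.
Qed.

Lemma edge_shift Q u v w : edge Q u v ->
  Q (fun i => midpoint u v i + w i) -> Q (fun i => midpoint u v i - w i) ->
  exists s, forall i, w i = s * (v i - u i).
Proof.
move=> [_ _ _ line] Qp Qm; have [|s xs] := line _ _ 1 Qp Qm ltr01; first by move=> j; lra.
by exists (s - 2^-1) => i; have := xs i; rewrite /midpoint; lra.
Qed.

Lemma edge_sym Q u v : edge Q u v -> edge Q v u.
Proof.
move=> [uV vV uv line]; split=> // [/esym //|x y e Qx Qy e0 E].
have [i|s xs] := line x y e Qx Qy e0; first by rewrite -E /midpoint [u i + _]addrC.
by exists (1 - s) => i; rewrite xs; lra.
Qed.

End Extremal.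

Section Bump.
Variables (R : realType) (W : eqType) (Q : (W -> R) -> Prop).
Implicit Types (f u v : W -> R) (w : W) (e : R).

Definition bump f w e : W -> R := fun i => f i + (if i == w then e else 0).

Lemma bumpN f w e : bump f w (- e) = fun i => f i - (if i == w then e else 0).
Proof. by apply: funext => i; rewrite /bump; case: ifP; rewrite ?oppr0. Qed.

Lemma extremal_endpoint v w a b : extremal Q v -> a <= v w <= b ->
  (forall e, a <= v w + e <= b -> Q (bump v w e)) -> v w = a \/ v w = b.
Proof.
move=> vV /andP[av vb] Qbump.
have [?|va] := eqVneq (v w) a; [by left | have [?|vb'] := eqVneq (v w) b; first by right].
pose e := Num.min (v w - a) (b - v w).
have e0 : 0 < e by rewrite lt_min !subr_gt0 !lt_neqAle av vb vb' eq_sym va.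
have [ea eb] : e <= v w - a /\ e <= b - v w by rewrite !ge_min !lexx orbT.
have Qp : Q (bump v w e) by apply: Qbump; lra.
have Qm : Q (bump v w (- e)) by apply: Qbump; lra.
rewrite bumpN in Qm.
by have := extremal_shift vV Qp Qm w; rewrite eqxx; lra.
Qed.

Lemma edge_bump u v w e : edge Q u v -> e != 0 ->
  Q (bump (midpoint u v) w e) -> Q (bump (midpoint u v) w (- e)) ->
  forall i, i != w -> u i = v i.
Proof.
move=> uv e0 Qp; rewrite bumpN => Qm i iw; have [s vs] := edge_shift uv Qp Qm.
have s0 : s != 0 by apply: contraNneq e0 => s0; have := vs w; rewrite eqxx s0 mul0r => ->.
have /esym/eqP := vs i; rewrite (negbTE iw) mulf_eq0 (negbTE s0) subr_eq0.
by move=> /eqP.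
Qed.

End Bump.

Section Coordinates.
Variables (R : realType) (T : finType) (m : nat) (A : 'M[R]_(m, #|T|)) (b : 'cV[R]_m).
Local Notation P := (polyhedron A b).

Definition coords (x : 'cV[R]_#|T|) : T -> R := fun t => x (enum_rank t) 0.
Definition vec (f : T -> R) : 'cV[R]_#|T| := \col_j f (enum_val j).

Lemma coordsK : cancel coords vec.
Proof. by move=> x; apply/matrixP => i j; rewrite mxE /coords enum_valK (ord1 j). Qed.

Lemma vecK : cancel vec coords.
Proof. by move=> f; apply: funext => t; rewrite /coords mxE enum_rankK. Qed.

Lemma coords_comb (p x y : 'cV[R]_#|T|) e :
  (1 + e) *: p = y + e *: x <->
  forall t, (1 + e) * coords p t = coords y t + e * coords x t.
Proof.
split=> [E t|E].
  by move/(congr1 (fun z : 'cV_ _ => z (enum_rank t) 0)): E; rewrite !mxE.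
apply/matrixP => i j; rewrite (ord1 j); have := E (enum_val i).
by rewrite /coords enum_valK !mxE.
Qed.

Lemma is_vertex_coords v :
  is_vertex P v <-> extremal (fun f => P (vec f)) (coords v).
Proof.
split=> [/is_vertexP[Pv vmin]|[]].
  split; first by rewrite coordsK.
  move=> x y e Px Py e0 E; rewrite -[x]vecK; congr coords; apply: vmin => //.
  by exists (vec y), e; split=> //; apply/coords_comb => t; rewrite !vecK.
rewrite coordsK => Pv vmin; apply/is_vertexP; split=> // x Px [y [e [Py e0 /coords_comb E]]].
by apply: (can_inj coordsK); apply: (vmin _ (coords y) e); rewrite ?coordsK.
Qed.

Lemma adjacent_coords u v :
  adjacent P u v <-> edge (fun f => P (vec f)) (coords u) (coords v).
Proof.
split=> [/adjacentP[/is_vertex_coords uV /is_vertex_coords vV uv line]|[uV vV uv line]].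
  split=> //; first by move/(can_inj coordsK).
  move=> x y e Px Py e0 E; have [|s xs] := line _ Px.
    exists (vec y), e; split=> //; apply/coords_comb => t; rewrite !vecK -E /midpoint /coords.
    by rewrite !mxE.
  by exists s => t; rewrite -[x]vecK xs /coords !mxE.
apply/adjacentP; split; try exact/is_vertex_coords; first by move=> E; apply: uv; rewrite E.
move=> x Px [y [e [Py e0 /coords_comb E]]].
have [||//|t|s xs] := line (coords x) (coords y) e; rewrite ?coordsK //.
  by rewrite -E /midpoint /coords !mxE.
exists s; apply/matrixP => i j; rewrite (ord1 j); have := xs (enum_val i).
by rewrite /coords enum_valK !mxE.
Qed.

End Coordinates.

Section Products.
Variables (R : realType) (I : eqType) (W : Type) (Q : I -> (W -> R) -> Prop).
Implicit Types (f u v : I * W -> R) (l : I) (p : W -> R).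

Definition slice f l : W -> R := fun w => f (l, w).
Definition set_slice u l p : I * W -> R := fun iw => if iw.1 == l then p iw.2 else u iw.
Definition product f := forall l, Q l (slice f l).

Lemma slice_set_slice u l p l' :
  slice (set_slice u l p) l' = if l' == l then p else slice u l'.
Proof. by apply: funext => w; rewrite /slice /set_slice /=; case: eqP. Qed.

Lemma slice_inj u v : slice u = slice v -> u = v.
Proof. by move=> uv; apply: funext => -[l w]; exact: (congr1 (fun g => g l w) uv). Qed.

Lemma product_set_slice u l p : product u -> Q l p -> product (set_slice u l p).
Proof. by move=> Qu Qp l'; rewrite slice_set_slice; case: eqP => [->|]. Qed.

Lemma extremal_product u : extremal product u <-> forall l, extremal (Q l) (slice u l).
Proof.
split=> [[Qu umin] l|umin].
  split=> // x y e Qx Qy e0 E; suff <- : set_slice u l x = u by rewrite slice_set_slice eqxx.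
  apply: (umin _ (set_slice u l y) e) => //; try exact: product_set_slice.
  by move=> [l' w]; rewrite /set_slice /=; case: eqP => [->|_]; [exact: E | lra].
split=> [l|x y e Qx Qy e0 E]; first by have [] := umin l.
apply: slice_inj; apply: funext => l; have [_ lmin] := umin l.
by apply: lmin (Qx l) (Qy l) e0 _ => w; exact: E.
Qed.

Lemma edge_set_slice u l p : (forall l, extremal (Q l) (slice u l)) ->
  edge (Q l) (slice u l) p -> edge product u (set_slice u l p).
Proof.
move=> uV [ul pV up line]; split.
- exact/extremal_product.
- by apply/extremal_product => l'; rewrite slice_set_slice; case: eqP => [->|].
- by move=> E; apply: up; rewrite [in LHS]E slice_set_slice eqxx.
- move=> x y e Qx Qy e0 E.
  have [|s xs] := line _ _ e (Qx l) (Qy l) e0.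
    by move=> w; rewrite /slice -E /midpoint /set_slice /= eqxx.
  exists s => -[l' w]; rewrite /set_slice /=; case: eqP => [->|/eqP l'l]; first exact: xs.
  have [_ lmin] := uV l'.
  suff xl : slice x l' = slice u l' by have /(congr1 (fun g => g w)) := xl; rewrite /slice; lra.
  apply: lmin (Qx l') (Qy l') e0 _ => w'; rewrite /slice -E /midpoint /set_slice /=.
  by rewrite (negbTE l'l); lra.
Qed.

(* Swapping the [l]-th slices of two adjacent vertices keeps their midpoint. *)
Lemma edge_product_slice_eq u v l : edge product u v -> slice u l <> slice v l ->
  forall l', l' != l -> slice u l' = slice v l'.
Proof.
move=> [[Qu _] [Qv _] uv line] ul l' l'l; apply: funext => w'.
have [|||[k w]|s xs] := line (set_slice u l (slice v l)) (set_slice v l (slice u l)) 1.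
- exact: product_set_slice.
- exact: product_set_slice.
- exact: ltr01.
- by rewrite /midpoint /set_slice /slice /=; case: eqP => [->|_]; lra.
have s1 : s = 1.
  have [w uvw] : exists w, u (l, w) <> v (l, w).
    by apply/existsNP => E; apply: ul; apply: funext.
  have := xs (l, w); rewrite /set_slice /slice /= eqxx => E.
  have : (1 - s) * (v (l, w) - u (l, w)) = 0 by lra.
  by move/eqP; rewrite mulf_eq0 !subr_eq0 => /orP[/eqP //|/eqP /esym].
by have := xs (l', w'); rewrite /set_slice /= (negbTE l'l) s1 /slice; lra.
Qed.

Lemma edge_product u v : edge product u v -> exists l,
  edge (Q l) (slice u l) (slice v l) /\ forall l', l' != l -> slice u l' = slice v l'.
Proof.
move=> uve; have [uV vV uv line] := uve.
have [l ul] : exists l, slice u l <> slice v l.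
  by apply/existsNP => E; apply: uv; apply: slice_inj; apply: funext.
have same := edge_product_slice_eq uve ul.
have [[Qu _] [Qv _]] := (uV, vV).
move/extremal_product: uV => uV; move/extremal_product: vV => vV.
exists l; split=> //; split=> // x y e Qx Qy e0 E.
have [||//|[k w]|s xs] := line (set_slice u l x) (set_slice u l y) e.
- exact: product_set_slice.
- exact: product_set_slice.
- rewrite /midpoint /set_slice /=; case: eqP => [->|/eqP /same k_same]; first exact: E.
  by have /(congr1 (fun g => g w)) := k_same; rewrite /slice => <-; lra.
by exists s => w; have := xs (l, w); rewrite /set_slice /= eqxx.
Qed.

End Products.

(** * The polytope of a formula *)

Record frame (W : eqType) := Frame {
  frame_lam : W;
  frame_z : W;
  frame_dummy : 'I_4 -> W;
  frame_uniq : uniq [:: frame_lam, frame_z & codom frame_dummy] }.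

Definition reserved (W : eqType) (F : frame W) : seq W :=
  [:: frame_lam F, frame_z F & codom (frame_dummy F)].

(* A literal [(true, w)] is negative. *)
Record cnf (W : eqType) (F : frame W) := Cnf {
  cnf_clauses :> seq (seq (bool * W));
  cnf_neq_nil : cnf_clauses != [::];
  cnf_vars : {in cnf_clauses, forall c, {in c, forall k, k.2 \notin reserved F}} }.

Canonical cnf_predType (W : eqType) (F : frame W) :=
  PredType (pred_of_seq : cnf F -> pred (seq (bool * W))).

Section CnfPolytope.
Variables (R : realType) (W : eqType) (F : frame W) (phi : cnf F).
Local Notation lam := (frame_lam F).
Local Notation z := (frame_z F).
Local Notation dummy := (frame_dummy F).
Implicit Types (f g p q u v x y : W -> R) (c : seq (bool * W)) (a : W -> bool).

Lemma lam_z : lam != z.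
Proof. by have /andP[] := frame_uniq F; rewrite inE negb_or => /andP[]. Qed.

Lemma dummy_lam j : dummy j != lam.
Proof.
have /andP[] := frame_uniq F; rewrite inE negb_or => /andP[_ lamD] _.
by apply: contraNneq lamD => <-; exact: codom_f.
Qed.

Lemma dummy_z j : dummy j != z.
Proof.
have /andP[_ /andP[zD _]] := frame_uniq F.
by apply: contraNneq zD => <-; exact: codom_f.
Qed.

Lemma dummy_inj : injective dummy.
Proof. by apply/injectiveP; have /and3P[] := frame_uniq F. Qed.

Lemma cnf_exists_clause : exists c, c \in phi.
Proof. by case: phi => -[|c s] // *; exists c; exact: mem_head. Qed.

Lemma cnf_var_lam_z c (k : bool * W) : c \in phi -> k \in c -> (k.2 != lam) && (k.2 != z).
Proof.
move=> cphi kc; have := cnf_vars cphi kc.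
by rewrite /reserved !inE !negb_or => /and3P[-> ->].
Qed.

Lemma cnf_var_dummy c (k : bool * W) j : c \in phi -> k \in c -> k.2 != dummy j.
Proof.
move=> cphi kc; apply: contraNneq (cnf_vars cphi kc) => ->.
by rewrite /reserved !inE codom_f !orbT.
Qed.

Definition literal_value f (k : bool * W) : R := if k.1 then f lam - f k.2 else f k.2.
Definition clause_sum f c : R := \sum_(k <- c) literal_value f k.

Definition cnf_polytope f : Prop :=
  [/\ forall w, w != lam -> w != z -> 0 <= f w <= f lam,
      f z + f lam <= 1, - f z + f lam <= 1 &
      {in phi, forall c, f z <= clause_sum f c /\ - f z <= clause_sum f c}].

Definition apex : W -> R := fun _ => 0.

Definition good f : Prop := f lam = 1 /\ {in phi, forall c, 0 < clause_sum f c}.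

Lemma eq_clause_sum f g c : (forall w, w != z -> f w = g w) ->
  c \in phi -> clause_sum f c = clause_sum g c.
Proof.
move=> fg cphi; apply: eq_big_seq => k /(cnf_var_lam_z cphi) /andP[_ kz].
by rewrite /literal_value !fg // lam_z.
Qed.

Lemma clause_sum_comb (a e : R) f g c :
  clause_sum (fun w => a * f w + e * g w) c = a * clause_sum f c + e * clause_sum g c.
Proof.
rewrite /clause_sum !mulr_sumr -big_split; apply: eq_bigr => k _ /=.
by rewrite /literal_value; case: ifP => _; ring.
Qed.

Lemma clause_sumZ (a : R) f c : clause_sum (fun w => a * f w) c = a * clause_sum f c.
Proof.
rewrite /clause_sum mulr_sumr; apply: eq_bigr => k _; rewrite /literal_value.
by case: ifP => // _; rewrite mulrBr.
Qed.

Lemma clause_sum_ge0 f c : (forall w, w != lam -> w != z -> 0 <= f w <= f lam) ->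
  c \in phi -> 0 <= clause_sum f c.
Proof.
move=> f01 cphi; rewrite /clause_sum big_seq; apply: sumr_ge0 => k kc.
have /andP[k_lam k_z] := cnf_var_lam_z cphi kc; have := f01 _ k_lam k_z.
by rewrite /literal_value; case: ifP => _; lra.
Qed.

Lemma cnf_polytope_lam_le1 f : cnf_polytope f -> f lam <= 1.
Proof. by move=> [_ z_le Nz_le _]; lra. Qed.

Lemma cnf_polytope_lam_ge0 f : cnf_polytope f -> 0 <= f lam.
Proof. by move=> [box _ _ _]; have := box _ (dummy_lam ord0) (dummy_z ord0); lra. Qed.

Lemma cnf_polytope_apex : cnf_polytope apex.
Proof.
split=> [w _ _|||c cphi]; rewrite /apex ?oppr0 ?addr0 ?lexx ?ler01 //.
by split; apply: clause_sum_ge0 => // w _ _; rewrite lexx.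
Qed.

Lemma cnf_polytope_lam0 f : cnf_polytope f -> f lam = 0 -> f = apex.
Proof.
move=> [box z_le Nz_le clauses] f0.
have fw0 w : w != z -> f w = 0.
  by move=> wz; have [->//|wl] := eqVneq w lam; have := box _ wl wz; rewrite f0; lra.
apply: funext => w; have [->|/fw0 //] := eqVneq w z.
have [c cphi] := cnf_exists_clause.
have [] := clauses _ cphi; rewrite (@eq_clause_sum f apex) // /clause_sum big1 => [|k _].
  by rewrite /apex; lra.
by rewrite /literal_value /apex subrr if_same.
Qed.

Lemma cnf_polytopeZ f (a : R) : cnf_polytope f -> 0 <= a ->
  a * (f z + f lam) <= 1 -> a * (- f z + f lam) <= 1 -> cnf_polytope (fun w => a * f w).
Proof.
move=> [box z_le Nz_le clauses] a0 az_le aNz_le; split; try lra.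
  by move=> w wl wz; have := box _ wl wz; nra.
by move=> c cphi; rewrite clause_sumZ; have := clauses _ cphi; nra.
Qed.

Lemma cnf_polytope_midpoint p q : cnf_polytope p -> cnf_polytope q -> cnf_polytope (midpoint p q).
Proof.
move=> [p_box p_le pN_le p_clauses] [q_box q_le qN_le q_clauses]; rewrite /midpoint; split; try lra.
  by move=> w wl wz; have := p_box _ wl wz; have := q_box _ wl wz; lra.
move=> c cphi.
have -> : (fun i => 2^-1 * (p i + q i)) = (fun i => 2^-1 * p i + 2^-1 * q i).
  by apply: funext => i; rewrite mulrDr.
by rewrite clause_sum_comb; have := p_clauses _ cphi; have := q_clauses _ cphi; lra.
Qed.

Lemma extremal_apex : extremal cnf_polytope apex.
Proof.
split; first exact: cnf_polytope_apex.
move=> x y e Qx Qy e0 E; apply: cnf_polytope_lam0 => //.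
by have := E lam; rewrite /apex; have := cnf_polytope_lam_ge0 Qx;
  have := cnf_polytope_lam_ge0 Qy; nra.
Qed.

(** * Vertices with [lam < 1] *)

(* Scaling towards and away from the apex stays in the polytope unless
   [|f z| + f lam = 1]. *)
Lemma extremal_norm f : extremal cnf_polytope f -> f lam != 0 -> `|f z| + f lam = 1.
Proof.
move=> [Qf fmin] f0; have [_ z_le Nz_le _] := Qf.
have l0 : 0 < f lam by rewrite lt_def f0 cnf_polytope_lam_ge0.
have [//|norm_neq1] := eqVneq (`|f z| + f lam) 1.
have norm_lt1 : `|f z| + f lam < 1.
  by rewrite lt_neqAle norm_neq1; case: (ger0P (f z)) => _; lra.
pose e := (1 - (`|f z| + f lam)) / 2.
have e0 : 0 < e by rewrite /e; lra.
have norm_ge := ler_norm (f z); have norm_geN := ler_norm (- f z); rewrite normrN in norm_geN.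
have norm_ge0 : 0 <= `|f z| by [].
have Qp : cnf_polytope (fun w => (1 + e) * f w) by apply: cnf_polytopeZ => //; rewrite /e; nra.
have Qm : cnf_polytope (fun w => (1 - e) * f w) by apply: cnf_polytopeZ => //; rewrite /e; nra.
have /(congr1 (fun g => g lam)) : (fun w => (1 + e) * f w) = f.
  by apply: (fmin _ _ 1 Qp Qm ltr01) => i; lra.
nra.
Qed.

(* If [|f z| + f lam = 1] with [f z != 0], then a small multiple of any point can be added
   to [f], up to normalization. *)
Lemma cnf_polytope_mix f (sg t : R) : cnf_polytope f -> `|sg| = 1 -> sg * f z = `|f z| ->
  `|f z| + f lam = 1 -> 0 < t -> t <= `|f z| / 2 -> forall x, cnf_polytope x ->
  let nrm := 1 + t * (sg * x z + x lam) in
  0 < nrm /\ cnf_polytope (fun w => nrm^-1 * (f w + t * x w)).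
Proof.
move=> Qf sg1 sgz nz t0 tle x Qx nrm.
have xle1 := cnf_polytope_lam_le1 Qx; have xge0 := cnf_polytope_lam_ge0 Qx.
have fge0 := cnf_polytope_lam_ge0 Qf.
have [f_box f_le fN_le f_clauses] := Qf; have [x_box x_le xN_le x_clauses] := Qx.
have : `|sg * x z| <= 1 - x lam by rewrite normrM sg1 mul1r ler_norml; lra.
rewrite ler_norml => /andP[xz_ge xz_le].
have nrm0 : 0 < nrm by rewrite /nrm; nra.
split=> //; have nrm_inv0 : 0 < nrm^-1 by rewrite invr_gt0.
pose mz := f z + t * x z.
have sgm0 : 0 <= sg * mz by rewrite /mz mulrDr sgz; nra.
have norm_le : `|mz| <= sg * mz by rewrite -[X in X <= _]mul1r -sg1 -normrM ger0_norm.
have norm_ge := ler_norm mz; have norm_geN := ler_norm (- mz); rewrite normrN in norm_geN.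
have nE : nrm = sg * mz + (f lam + t * x lam) by rewrite /nrm /mz; lra.
split.
- move=> w wl wz; have := f_box _ wl wz; have := x_box _ wl wz => x_w f_w.
  by rewrite pmulr_rge0 // ler_pM2l //; apply/andP; split; nra.
- by rewrite -mulrDr mulrC ler_pdivrMr // mul1r -/mz nE; lra.
- by rewrite -mulrN -mulrDr mulrC ler_pdivrMr // mul1r -/mz nE; lra.
- move=> c cphi; rewrite -mulrN clause_sumZ !ler_pM2l //.
  have -> : (fun w => f w + t * x w) = (fun w => 1 * f w + t * x w).
    by apply: funext => w; rewrite mul1r.
  by rewrite clause_sum_comb; have := f_clauses _ cphi; have := x_clauses _ cphi; nra.
Qed.

Lemma extremal_edge_apex f : extremal cnf_polytope f -> f lam != 0 -> f lam < 1 ->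
  edge cnf_polytope f apex.
Proof.
move=> fV f0 f1; have [Qf fmin] := fV; split=> //; first exact: extremal_apex.
  by move/(congr1 (fun g => g lam)) => /eqP; rewrite (negbTE f0).
have nz := extremal_norm fV f0.
have znz : 0 < `|f z| by lra.
move=> x y e Qx Qy e0 E.
pose sg : R := Num.sg (f z).
have sgz : sg * f z = `|f z| by rewrite /sg -normrEsg.
have sg1 : `|sg| = 1 by rewrite /sg normr_sg -normr_gt0 znz.
pose t : R := `|f z| / 2.
have t0 : 0 < t by rewrite /t; lra.
have [nx0 Qx'] := cnf_polytope_mix Qf sg1 sgz nz t0 (lexx _) Qx.
have [ny0 Qy'] := cnf_polytope_mix Qf sg1 sgz nz t0 (lexx _) Qy.
move: nx0 Qx' ny0 Qy'; set nx := 1 + _; set ny := 1 + _ => nx0 Qx' ny0 Qy'.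
have mid w : y w + e * x w = (1 + e) * (f w / 2) by rewrite -E /midpoint /apex; lra.
have nn : ny + e * nx = (1 + e) * (1 + t / 2).
  have -> : ny + e * nx = 1 + e + t * (sg * (y z + e * x z) + (y lam + e * x lam)).
    by rewrite /nx /ny; ring.
  by rewrite !mid (_ : f lam = 1 - sg * f z); [field | rewrite sgz; lra].
have xf : (fun w => nx^-1 * (f w + t * x w)) = f.
  apply: (fmin _ _ (e * nx / ny) Qx' Qy'); first by rewrite divr_gt0 ?mulr_gt0.
  move=> w.
  have -> : ny^-1 * (f w + t * y w) + e * nx / ny * (nx^-1 * (f w + t * x w)) =
            ny^-1 * ((1 + e) * f w + t * (y w + e * x w)).
    by field; rewrite !gt_eqF.
  have -> : 1 + e * nx / ny = ny^-1 * (ny + e * nx) by field; rewrite gt_eqF.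
  by rewrite mid nn; field; rewrite gt_eqF.
exists (1 - (nx - 1) / t) => w.
have /= xw := congr1 (fun g => g w) xf.
have fx : f w + t * x w = nx * f w by rewrite -[in RHS]xw mulrA mulfV ?gt_eqF // mul1r.
have -> : x w = (nx * f w - f w) / t by rewrite -fx; field; rewrite gt_eqF.
by rewrite /apex; field; rewrite gt_eqF.
Qed.

(** * Vertices with [lam = 1] *)

Lemma extremal_lam1 f : extremal cnf_polytope f -> f lam = 1 ->
  f z = 0 /\ forall w, w != z -> f w = 0 \/ f w = 1.
Proof.
move=> fV f1; have [[box z_le Nz_le _] _] := fV.
have fz : f z = 0 by lra.
split=> // w wz; have [->|wl] := eqVneq w lam; first by right.
apply: (extremal_endpoint fV) => [|e]; first by rewrite -f1 box.
move=> fwe; have bl : bump f w e lam = 1 by rewrite /bump eq_sym (negbTE wl) addr0.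
have bz : bump f w e z = 0 by rewrite /bump eq_sym (negbTE wz) addr0.
have bump01 i : i != lam -> i != z -> 0 <= bump f w e i <= bump f w e lam.
  move=> il iz; rewrite bl /bump; case: eqP => [-> //|_].
  by rewrite addr0 -f1 box.
split=> [//|||c cphi]; rewrite ?bz ?oppr0 ?add0r ?bl //.
by split; apply: clause_sum_ge0.
Qed.

(* Constraints that are tight at an assignment [f] are tight on the whole minimal face of [f]. *)
Lemma segment_proportional f (a e : R) x y :
  (forall w, w != z -> f w = 0 \/ f w = 1) -> f lam = 1 ->
  cnf_polytope x -> cnf_polytope y -> 0 < e ->
  (forall w, w != z -> a * f w = y w + e * x w) ->
  forall w, w != z -> x w = x lam * f w.
Proof.
move=> f01 f1 [x_box _ _ _] [y_box _ _ _] e0 E w wz.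
have [->|wl] := eqVneq w lam; first by rewrite f1 mulr1.
have := x_box _ wl wz; have := y_box _ wl wz; have := E _ wz; have := E _ lam_z; rewrite f1.
by case: (f01 _ wz) => ->; nra.
Qed.

Lemma clause_sum_proportional f x c : (forall w, w != z -> x w = x lam * f w) ->
  c \in phi -> clause_sum x c = x lam * clause_sum f c.
Proof. by move=> E cphi; rewrite -clause_sumZ; apply: eq_clause_sum. Qed.

Lemma unsatisfied_edge_apex f c : extremal cnf_polytope f -> f lam = 1 -> c \in phi ->
  clause_sum f c <= 0 -> edge cnf_polytope f apex.
Proof.
move=> fV f1 cphi c0; have [fz f01] := extremal_lam1 fV f1; split=> //.
- exact: extremal_apex.
- by move/(congr1 (fun g => g lam)); rewrite f1 /apex => /eqP; rewrite oner_eq0.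
move=> x y e Qx Qy e0 E.
have xE : forall w, w != z -> x w = x lam * f w.
  apply: (@segment_proportional f ((1 + e) / 2) e _ y) => // w _.
  by rewrite -E /midpoint /apex; lra.
have [_ _ _ clauses] := Qx.
have xz : x z = 0.
  have := clauses _ cphi; rewrite (clause_sum_proportional xE cphi).
  by have := cnf_polytope_lam_ge0 Qx; nra.
exists (1 - x lam) => w; rewrite /apex.
by have [->|wz] := eqVneq w z; [rewrite xz fz; lra | rewrite xE //; lra].
Qed.

(* The other endpoint of the edge along which [z] increases from a good vertex [f] with
   least clause sum [s]. *)
Definition roof f (s : R) : W -> R :=
  fun w => if w == z then s / (1 + s) else f w / (1 + s).

Section Roof.
Variables (f : W -> R) (c : seq (bool * W)) (s : R).
Local Notation g := (roof f s).
Hypotheses (fV : extremal cnf_polytope f) (f1 : f lam = 1) (cphi : c \in phi).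
Hypotheses (s0 : 0 < s) (sE : clause_sum f c = s).
Hypothesis s_min : {in phi, forall c', s <= clause_sum f c'}.

Let fz : f z = 0. Proof. exact: (extremal_lam1 fV f1).1. Qed.
Let f01 w : w != z -> f w = 0 \/ f w = 1. Proof. exact: (extremal_lam1 fV f1).2. Qed.
Let s1 : 0 < 1 + s. Proof. exact: addr_gt0 ltr01 s0. Qed.

Lemma roof_z : g z = s / (1 + s).
Proof. by rewrite /roof eqxx. Qed.

Lemma roof_neq_z w : w != z -> g w = f w / (1 + s).
Proof. by rewrite /roof => /negbTE ->. Qed.

Lemma roof_lam : g lam = (1 + s)^-1.
Proof. by rewrite roof_neq_z ?lam_z // f1 mul1r. Qed.

Lemma roof_z_lam : g z + g lam = 1.
Proof. by rewrite roof_z roof_lam; field; rewrite gt_eqF. Qed.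

Lemma cnf_polytope_roof : cnf_polytope g.
Proof.
have [[box _ _ _] _] := fV; have i0 : 0 < (1 + s)^-1 by rewrite invr_gt0.
split; rewrite ?roof_z_lam //.
- move=> w wl wz; rewrite roof_neq_z // roof_lam; have := box _ wl wz; rewrite f1.
  move=> /andP[w_ge0 w_le1].
  by rewrite divr_ge0 ?(ltW s1) //= ler_pdivrMr // mulVf ?gt_eqF.
- have := roof_z_lam; have : 0 < g z by rewrite roof_z divr_gt0.
  by lra.
- move=> c' c'phi; rewrite (@eq_clause_sum _ (fun w => (1 + s)^-1 * f w)) //; last first.
    by move=> w wz; rewrite roof_neq_z // mulrC.
  by rewrite clause_sumZ roof_z mulrC -mulrN !ler_pM2l //; have := s_min c'phi; have := s0; lra.
Qed.

Lemma roof_top_tight x y (e : R) : cnf_polytope x -> cnf_polytope y -> 0 < e ->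
  (1 + e) = y z + y lam + e * (x z + x lam) -> x z + x lam = 1.
Proof. by move=> [_ ? _ _] [_ ? _ _] e0; nra. Qed.

Lemma extremal_roof : extremal cnf_polytope g.
Proof.
split; first exact: cnf_polytope_roof.
move=> x y e Qx Qy e0 E.
have xE : forall w, w != z -> x w = x lam * f w.
  by apply: (@segment_proportional f ((1 + e) / (1 + s)) e _ y) => // w wz;
    rewrite -E roof_neq_z //; ring.
have yE : forall w, w != z -> y w = y lam * f w.
  apply: (@segment_proportional f ((1 + e) / (1 + s) / e) e^-1 _ x); rewrite ?invr_gt0 // => w wz.
  have -> : y w = (1 + e) * (f w / (1 + s)) - e * x w by rewrite -(roof_neq_z wz) E; ring.
  by field; rewrite !gt_eqF.
have Ez := E z; have El := E lam; have gs := roof_z_lam.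
have xs : x z + x lam = 1 by apply: (roof_top_tight Qx Qy e0); nra.
have [_ _ _ x_clauses] := Qx; have [_ _ _ y_clauses] := Qy.
have [xz_le _] := x_clauses _ cphi; have [yz_le _] := y_clauses _ cphi.
rewrite (clause_sum_proportional xE cphi) sE in xz_le.
rewrite (clause_sum_proportional yE cphi) sE in yz_le.
rewrite roof_z in Ez; rewrite roof_lam in El.
have xlz : x z = x lam * s.
  have : (1 + e) * (s / (1 + s)) = s * ((1 + e) * (1 + s)^-1) by ring.
  by rewrite Ez El; nra.
have xl : x lam = (1 + s)^-1.
  by apply: (mulIf (lt0r_neq0 s1)); rewrite mulVf ?gt_eqF //; lra.
apply: funext => w; have [->|wz] := eqVneq w z; first by rewrite xlz roof_z xl mulrC.
by rewrite xE // xl roof_neq_z // mulrC.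
Qed.

Lemma edge_roof : edge cnf_polytope f g.
Proof.
split=> //; first exact: extremal_roof.
  by move/(congr1 (fun u => u z)); rewrite fz roof_z => /esym /eqP; rewrite gt_eqF // divr_gt0.
move=> x y e Qx Qy e0 E.
have xE : forall w, w != z -> x w = x lam * f w.
  apply: (@segment_proportional f ((1 + e) * (2^-1 * (1 + (1 + s)^-1))) e _ y) => // w wz.
  by rewrite -E /midpoint roof_neq_z //; ring.
have xs : x z + x lam = 1.
  apply: (roof_top_tight Qx Qy e0); have := E z; have := E lam; have := roof_z_lam.
  by rewrite /midpoint fz f1; nra.
exists ((1 - x lam) * (1 + s) / s) => w.
have sn : s != 0 by rewrite gt_eqF.
have s1n : 1 + s != 0 by rewrite gt_eqF.
have [->|wz] := eqVneq w z.
  by rewrite roof_z fz (_ : x z = 1 - x lam); [field; rewrite sn s1n | lra].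
by rewrite xE // roof_neq_z //; field; rewrite sn s1n.
Qed.

Lemma edge_roof_apex : edge cnf_polytope g apex.
Proof.
have gl0 : 0 < g lam by rewrite roof_lam invr_gt0.
apply: extremal_edge_apex; first exact: extremal_roof.
  by rewrite gt_eqF.
by rewrite roof_lam invf_lt1 // ltrDl.
Qed.

End Roof.

Lemma good_path f : extremal cnf_polytope f -> good f ->
  exists2 g, edge cnf_polytope f g & edge cnf_polytope g apex.
Proof.
move=> fV [f1 pos]; have [c cphi c_min] := exists_seq_argmin (clause_sum f) (cnf_neq_nil phi).
have s0 := pos _ cphi.
exists (roof f (clause_sum f c)).
  exact: (edge_roof fV f1 cphi s0 erefl c_min).
exact: (edge_roof_apex fV f1 cphi s0 erefl c_min).
Qed.

Lemma path_to_apex f : extremal cnf_polytope f ->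
  [\/ f = apex, edge cnf_polytope f apex |
      good f /\ exists2 g, edge cnf_polytope f g & edge cnf_polytope g apex].
Proof.
move=> fV; have [Qf _] := fV.
have [f0|f0] := eqVneq (f lam) 0; first by apply: Or31; exact: cnf_polytope_lam0.
have [f1|f1] := eqVneq (f lam) 1; last first.
  by apply: Or32; apply: extremal_edge_apex => //; rewrite lt_neqAle f1 cnf_polytope_lam_le1.
have [gf|ngf] := pselect (good f); first by apply: Or33; split=> //; exact: good_path.
apply: Or32.
have [c cphi c0] : exists2 c, c \in phi & clause_sum f c <= 0.
  apply: contrapT => none; apply: ngf; split=> // c cphi; rewrite ltNge; apply/negP => c0.
  by apply: none; exists c.
exact: unsatisfied_edge_apex c0.
Qed.

Lemma good_not_edge_apex f : good f -> ~ edge cnf_polytope f apex.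
Proof.
move=> [f1 pos] fe; have [fV _ _ _] := fe; have [[box _ _ _] _] := fV.
have [fz _] := extremal_lam1 fV f1.
have [e' e'0 e'le] := exists_pos_lower_bound pos.
pose e : R := Num.min (e' / 2) (2^-1).
have e0 : 0 < e by rewrite lt_min; apply/andP; split; lra.
have [e_le_slack e_le_half] : e <= e' / 2 /\ e <= 2^-1 by rewrite !ge_min !lexx orbT.
have Qbump t : - e <= t <= e -> cnf_polytope (bump (midpoint f apex) z t).
  move=> /andP[t_ge t_le].
  have bE w : w != z -> bump (midpoint f apex) z t w = 2^-1 * f w.
    by move=> wz; rewrite /bump /midpoint /apex (negbTE wz) !addr0.
  have bz : bump (midpoint f apex) z t z = t by rewrite /bump /midpoint /apex eqxx fz; lra.
  split; rewrite ?bz ?bE ?f1 ?lam_z //; try lra.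
    by move=> w wl wz; rewrite !bE ?lam_z //; have := box _ wl wz; lra.
  move=> c cphi; rewrite (@eq_clause_sum _ (fun w => 2^-1 * f w)) // clause_sumZ.
  by have := e'le _ cphi; lra.
have := @edge_bump _ _ _ _ _ z e fe; rewrite (gt_eqF e0) => /(_ isT).
move=> /(_ (Qbump _ _) (Qbump _ _) _ lam_z); rewrite f1 /apex => contra.
by have := contra _ _; lra.
Qed.

Definition assign a : W -> R :=
  fun w => if w == z then 0 else if w == lam then 1 else (a w)%:R.

Lemma assign_z a : assign a z = 0.
Proof. by rewrite /assign eqxx. Qed.

Lemma assign_lam a : assign a lam = 1.
Proof. by rewrite /assign (negbTE lam_z) eqxx. Qed.

Lemma assign01 a w : w != z -> assign a w = 0 \/ assign a w = 1.
Proof.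
move=> wz; rewrite /assign (negbTE wz); case: ifP => _; first by right.
by case: (a w); [right | left].
Qed.

Lemma literal_value_assign a (k : bool * W) : k.2 != lam -> k.2 != z ->
  literal_value (assign a) k = (k.1 != a k.2)%:R.
Proof.
move=> k_lam k_z; rewrite /literal_value assign_lam /assign (negbTE k_lam) (negbTE k_z).
by case: (k.1); case: (a _) => /=; lra.
Qed.

Lemma extremal_assign a : extremal cnf_polytope (assign a).
Proof.
have box w : w != lam -> w != z -> 0 <= assign a w <= assign a lam.
  by move=> _ /(assign01 a); rewrite assign_lam => -[] ->; rewrite lexx ler01.
split.
  split; rewrite ?assign_z ?assign_lam ?oppr0 ?add0r //.
    by move=> w wl wz; rewrite -(assign_lam a) box.
  by move=> c cphi; split; apply: clause_sum_ge0.
move=> x y e Qx Qy e0 E.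
have xE : forall w, w != z -> x w = x lam * assign a w.
  apply: (@segment_proportional _ (1 + e) e _ y) => //; first exact: assign01.
  exact: assign_lam.
have xl : x lam = 1.
  have := E lam; rewrite assign_lam.
  by have := cnf_polytope_lam_le1 Qx; have := cnf_polytope_lam_le1 Qy; nra.
have xz : x z = 0 by have [_ ? ? _] := Qx; lra.
apply: funext => w; have [->|wz] := eqVneq w z; first by rewrite xz assign_z.
by rewrite xE // xl mul1r.
Qed.

Definition satisfies a c := has (fun k => k.1 != a k.2) c.

Lemma good_assign a : {in phi, forall c, satisfies a c} -> good (assign a).
Proof.
move=> sat; split=> [|c cphi]; first exact: assign_lam.
have /hasP[k kc ka] := sat _ cphi.
rewrite /clause_sum (big_rem k) //=.
have /andP[k_lam k_z] := cnf_var_lam_z cphi kc.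
rewrite literal_value_assign // ka ltr_pwDl ?ltr01 // big_seq; apply: sumr_ge0 => k' k'c.
have /andP[k_lam' k_z'] := cnf_var_lam_z cphi (mem_rem k'c).
by rewrite literal_value_assign.
Qed.

Lemma good_satisfies f : extremal cnf_polytope f -> good f ->
  {in phi, forall c, satisfies (fun w => 0 < f w) c}.
Proof.
move=> fV [f1 pos] c cphi; have [fz f01] := extremal_lam1 fV f1.
apply/negPn/negP => /hasPn unsat; have := pos _ cphi.
suff -> : clause_sum f c = 0 by rewrite ltxx.
apply: big1_seq => k /= kc; have /andP[_ kz] := cnf_var_lam_z cphi kc.
have := unsat _ kc; rewrite negbK => /eqP; rewrite /literal_value => ->.
by case: (f01 _ kz) => ->; rewrite ?ltxx ?ltr01 ?f1 ?subrr.
Qed.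

(** * A potential that changes by at most one along edges *)

Definition dummy_count f : nat := #|[pred j | f (dummy j) == f lam]|.

Definition potential f : nat :=
  if f lam == 0 then 2%N else if `[< good f >] then dummy_count f
  else minn 3 (maxn 1 (dummy_count f)).

Lemma cnf_polytope_bump_dummy p j (e : R) : cnf_polytope p ->
  0 <= p (dummy j) + e <= p lam -> cnf_polytope (bump p (dummy j) e).
Proof.
move=> [box z_le Nz_le clauses] pje.
have bE w : w != dummy j -> bump p (dummy j) e w = p w.
  by move=> wj; rewrite /bump (negbTE wj) addr0.
have bl : bump p (dummy j) e lam = p lam by rewrite bE // eq_sym dummy_lam.
have bz : bump p (dummy j) e z = p z by rewrite bE // eq_sym dummy_z.
split; rewrite ?bl ?bz //.
  move=> w wl wz; have [->|wj] := eqVneq w (dummy j); first by rewrite /bump eqxx.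
  by rewrite bE // box.
move=> c cphi; suff -> : clause_sum (bump p (dummy j) e) c = clause_sum p c by exact: clauses.
apply: eq_big_seq => k kc; rewrite /literal_value bl bE //.
exact: cnf_var_dummy cphi kc.
Qed.

Lemma extremal_dummy p j : extremal cnf_polytope p -> p (dummy j) = 0 \/ p (dummy j) = p lam.
Proof.
move=> pV; have [Qp _] := pV; have [box _ _ _] := Qp.
apply: (extremal_endpoint pV) => [|e]; first exact: box (dummy_lam j) (dummy_z j).
exact: cnf_polytope_bump_dummy.
Qed.

Lemma edge_dummy p q j k : edge cnf_polytope p q -> p lam != 0 -> q lam != 0 -> j != k ->
  (p (dummy j) == p lam) != (q (dummy j) == q lam) ->
  (p (dummy k) == p lam) = (q (dummy k) == q lam).
Proof.
move=> pq p0 q0 jk j_flips; have [pV qV _ _] := pq.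
have [Qp _] := pV; have [Qq _] := qV.
have pl0 : 0 < p lam by rewrite lt_def p0 cnf_polytope_lam_ge0.
have ql0 : 0 < q lam by rewrite lt_def q0 cnf_polytope_lam_ge0.
set m := midpoint p q.
have [m_gt0 m_lt] : 0 < m (dummy j) /\ m (dummy j) < m lam.
  move: j_flips; rewrite /m /midpoint.
  case: (extremal_dummy j pV) => ->; case: (extremal_dummy j qV) => ->;
    rewrite ?eqxx ?(eq_sym 0) ?(negbTE p0) ?(negbTE q0) //= => _; lra.
pose e : R := Num.min (m (dummy j)) (m lam - m (dummy j)).
have e0 : 0 < e by rewrite lt_min m_gt0 subr_gt0 m_lt.
have [e_le_lo e_le_hi] : e <= m (dummy j) /\ e <= m lam - m (dummy j) by rewrite !ge_min !lexx orbT.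
have Qbump t : - e <= t <= e -> cnf_polytope (bump m (dummy j) t).
  move=> te; apply: cnf_polytope_bump_dummy; last by lra.
  exact: cnf_polytope_midpoint.
have e_neq0 : e != 0 by rewrite gt_eqF.
have same : forall i, i != dummy j -> p i = q i.
  by apply: (edge_bump pq e_neq0); apply: Qbump; lra.
by rewrite !same 1?eq_sym ?dummy_lam // (inj_eq dummy_inj).
Qed.

Lemma dummy_count_edge p q : edge cnf_polytope p q -> p lam != 0 -> q lam != 0 ->
  (dummy_count q <= (dummy_count p).+1)%N.
Proof.
move=> pq pl ql; rewrite /dummy_count.
have [E|] := boolP [forall j, (p (dummy j) == p lam) == (q (dummy j) == q lam)].
  apply: leqW; apply: subset_leq_card; apply/fintype.subsetP => j; rewrite !inE.
  by have /eqP -> := forallP E j.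
rewrite negb_forall => /existsP [j j_flips].
have same k : k != j -> (p (dummy k) == p lam) = (q (dummy k) == q lam).
  by move=> kj; apply: (edge_dummy pq pl ql _ j_flips); rewrite eq_sym.
have := cardUI [pred k | p (dummy k) == p lam] (pred1 j); rewrite card1 addn1 => <-.
apply: leq_trans (leq_addr _ _); apply: subset_leq_card; apply/fintype.subsetP => k.
rewrite !inE; have [//|kj] := eqVneq k j; first by rewrite orbT.
by rewrite same // => ->.
Qed.

Lemma potential_edge p q : edge cnf_polytope p q -> (potential q <= (potential p).+1)%N.
Proof.
move=> pq; rewrite /potential.
have [q0|q0] := eqVneq (q lam) 0.
  have [p0|p0] := eqVneq (p lam) 0 => //.
  have [Qq _] : extremal cnf_polytope q by case: pq.
  case: asboolP => [gp|_]; last by lia.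
  by case: (good_not_edge_apex gp); rewrite -(cnf_polytope_lam0 Qq q0).
have [p0|p0] := eqVneq (p lam) 0.
  have [Qp _] : extremal cnf_polytope p by case: pq.
  case: asboolP => [gq|_]; last by lia.
  by case: (good_not_edge_apex gq); rewrite -(cnf_polytope_lam0 Qp p0); exact: edge_sym.
have qp := dummy_count_edge pq p0 q0; have pq' := dummy_count_edge (edge_sym pq) q0 p0.
have le4 f : (dummy_count f <= 4)%N by rewrite /dummy_count (leq_trans (max_card _)) ?card_ord.
have p4 := le4 p; have q4 := le4 q.
by case: asboolP => _; case: asboolP => _; lia.
Qed.

Lemma dummy_count_assign a (v : bool) : (forall j, a (dummy j) = v) ->
  dummy_count (assign a) = if v then 4%N else 0%N.
Proof.
move=> av; rewrite /dummy_count.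
have E j : (assign a (dummy j) == assign a lam) = v.
  rewrite assign_lam /assign (negbTE (dummy_z j)) (negbTE (dummy_lam j)) av.
  by case: (v); rewrite ?eqxx // eq_sym oner_eq0.
rewrite (eq_card (_ : _ =i [pred _ : 'I_4 | v])); last by move=> j; rewrite !inE E.
by case: (v); rewrite ?card0 // (eq_card (_ : _ =i 'I_4)) ?card_ord.
Qed.

End CnfPolytope.

Arguments apex {R W}.

(** * Distances in products of formula polytopes *)

Section Walks.
Variables (R : realType) (d : nat) (P : set 'cV[R]_d).
Implicit Types u v w : 'cV[R]_d.

Lemma walk_cat n m u v w : walk P n u v -> walk P m v w -> walk P (n + m) u w.
Proof.
elim: n u => [|n IH] u /=; first by move->.
by move=> [x [ux xv]] vw; exists x; split=> //; apply: IH.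
Qed.

Lemma adjacent_sym u v : adjacent P u v -> adjacent P v u.
Proof.
move=> [uV vV uv [F [Ff F1 Fu Fv]]]; split=> //; first by move/esym.
by exists F.
Qed.

Lemma walk_rev n u v : walk P n u v -> walk P n v u.
Proof.
elim: n u => [|n IH] u /=; first by move->.
move=> [x [ux /IH vx]]; have := @walk_cat n 1 v x u vx; rewrite addn1; apply=> /=.
by exists u; split=> //; apply: adjacent_sym.
Qed.

Lemma skeleton_dist_le n u v : walk P n u v -> (skeleton_dist P u v <= n)%N.
Proof. by move=> uv; rewrite /skeleton_dist; case: xgetP => [k -> [_ kmin]|_ //]; exact: kmin. Qed.

Lemma skeleton_dist_ge m n u v : walk P n u v ->
  (forall k, walk P k u v -> (m <= k)%N) -> (m <= skeleton_dist P u v)%N.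
Proof.
move=> uv m_le; rewrite /skeleton_dist; case: xgetP => [k -> [/m_le //]|no_min].
have ex : exists k, `[< walk P k u v >] by exists n; apply/asboolP.
case: (ex_minnP ex) => k /asboolP uvk kmin; case: (no_min k); split=> // j uvj.
by apply: kmin; apply/asboolP.
Qed.

End Walks.

Definition prod_finType (I W : finType) : finType := (I * W)%type.

Section CnfProduct.
Variables (R : realType) (I W : finType) (F : frame W) (phi : I -> cnf F).
Local Notation IW := (prod_finType I W).
Local Notation vecIW := (@vec R IW).
Local Notation coordsIW := (@coords R IW).
Local Notation Q l := (cnf_polytope (R := R) (phi l)).
Variables (m : nat) (A : 'M[R]_(m, #|IW|)) (b : 'cV[R]_m).
Local Notation P := (polyhedron A b).
Hypothesis P_product : forall f, P (vecIW f) <-> product (fun l => Q l) f.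
Implicit Types (u v : 'cV[R]_#|IW|) (l : I) (p : W -> R).

Let P_productE : (fun f => P (vecIW f)) = product (fun l => Q l).
Proof. by apply: funext => f; apply: propext. Qed.

Definition block u : I -> W -> R := slice (coordsIW u).
Definition set_block u l p : 'cV[R]_#|IW| := vecIW (set_slice (coordsIW u) l p).

Lemma block_inj u v : block u = block v -> u = v.
Proof. by move=> /slice_inj /(can_inj (@coordsK R IW)). Qed.

Lemma block_set_block u l p l' : block (set_block u l p) l' = if l' == l then p else block u l'.
Proof. by rewrite /block /set_block vecK slice_set_slice. Qed.

Lemma vertex_blocks u : is_vertex P u <-> forall l, extremal (Q l) (block u l).
Proof. by rewrite is_vertex_coords P_productE extremal_product. Qed.

Lemma vertex_set_block u l p : is_vertex P u -> extremal (Q l) p -> is_vertex P (set_block u l p).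
Proof.
move=> /vertex_blocks uV pV; apply/vertex_blocks => l'.
by rewrite block_set_block; case: eqP => [->|].
Qed.

Lemma adjacent_set_block u l p : is_vertex P u -> edge (Q l) (block u l) p ->
  adjacent P u (set_block u l p).
Proof.
move=> /vertex_blocks uV up; apply/adjacent_coords; rewrite P_productE vecK.
exact: edge_set_slice.
Qed.

Lemma walk_block_to_apex u l : is_vertex P u ->
  exists2 n, (n <= 1 + `[< good (phi l) (block u l) >])%N & walk P n u (set_block u l apex).
Proof.
move=> uV; case: (path_to_apex (iffLR (vertex_blocks u) uV l)) => [u0|u1|[gu [p up p0]]].
- exists 0%N => //=; apply: block_inj; apply: funext => l'.
  by rewrite block_set_block; case: eqP => [->|].
- exists 1%N; first by rewrite leq_addr.
  by exists (set_block u l apex); split=> //; exact: adjacent_set_block.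
- exists 2%N; first by rewrite asboolT.
  have [_ pV _ _] := up; pose v := set_block u l p.
  exists v; split; first exact: adjacent_set_block.
  exists (set_block v l apex); split.
    by apply: adjacent_set_block; [exact: vertex_set_block | rewrite block_set_block eqxx].
  apply: block_inj; apply: funext => l'.
  by rewrite !block_set_block; case: eqP => //; case: eqP.
Qed.

Lemma walk_blocks_to_apex (s : seq I) u : uniq s -> is_vertex P u ->
  (forall l, l \notin s -> block u l = apex) ->
  exists2 n, (n <= \sum_(l <- s) (1 + `[< good (phi l) (block u l) >]))%N & walk P n u 0.
Proof.
elim: s u => [|l s IH] u /= => [_ _ u0|/andP[ls us] uV u0].
  exists 0%N; rewrite ?big_nil //=; apply: block_inj; apply: funext => l.
  by rewrite u0 //; apply: funext => w; rewrite /block /slice /apex /coords mxE.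
have [n le_n walk_n] := walk_block_to_apex l uV.
have [|l' l's|k le_k walk_k] := IH (set_block u l apex) us.
- exact: vertex_set_block uV (extremal_apex R (phi l)).
- by rewrite block_set_block; case: eqP => // /eqP ne; apply: u0; rewrite inE negb_or ne.
exists (n + k)%N; last exact: walk_cat walk_n walk_k.
rewrite big_cons leq_add //; apply: leq_trans le_k _; apply: eq_leq; apply: eq_big_seq => l' l's.
by rewrite block_set_block; case: eqP => // E; rewrite -E l's in ls.
Qed.

Lemma walk_to_apex u : is_vertex P u ->
  exists2 n, (n <= \sum_l (1 + `[< good (phi l) (block u l) >]))%N & walk P n u 0.
Proof.
move=> uV; have [l|n le_n walk_n] := walk_blocks_to_apex (enum_uniq I) uV.
  by rewrite mem_enum.
by exists n; rewrite // -big_enum.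
Qed.

Lemma dist_le_good u v : is_vertex P u -> is_vertex P v ->
  (skeleton_dist P u v <= \sum_l (2 + 2 *
    `[< good (phi l) (block u l) \/ good (phi l) (block v l) >]))%N.
Proof.
move=> uV vV; have [n le_n walk_n] := walk_to_apex uV; have [k le_k walk_k] := walk_to_apex vV.
apply: (leq_trans (skeleton_dist_le (walk_cat walk_n (walk_rev walk_k)))).
apply: (leq_trans (leq_add le_n le_k)); rewrite -big_split; apply: leq_sum => l _ /=.
by rewrite asbool_or; case: `[< _ >]; case: `[< _ >].
Qed.

Definition assign_vec (a : I -> W -> bool) : 'cV[R]_#|IW| :=
  vecIW (fun lw => assign R F (a lw.1) lw.2).

Lemma block_assign_vec a l : block (assign_vec a) l = assign R F (a l).
Proof. by rewrite /block /assign_vec vecK. Qed.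

Lemma vertex_assign_vec a : is_vertex P (assign_vec a).
Proof. by apply/vertex_blocks => l; rewrite block_assign_vec; exact: extremal_assign. Qed.

Definition total_potential u : nat := (\sum_l potential (phi l) (block u l))%N.

Lemma total_potential_adjacent u v : adjacent P u v ->
  (total_potential v <= (total_potential u).+1)%N.
Proof.
move=> /adjacent_coords; rewrite P_productE => /edge_product[l [uv same]].
rewrite /total_potential (bigD1 l) //= [in X in (_ <= X.+1)%N](bigD1 l) //= -addSn leq_add //.
  exact: potential_edge uv.
by apply: eq_leq; apply: eq_bigr => l' l'l; rewrite /block same.
Qed.

Lemma total_potential_walk n u v : walk P n u v ->
  (total_potential v <= total_potential u + n)%N.
Proof.
elim: n u => [|n IH] u /=; first by move->; rewrite addn0.
by move=> [w [/total_potential_adjacent uw /IH]]; lia.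
Qed.

Lemma dist_ge_assign (a0 a1 : I -> W -> bool) :
  (forall l j, a0 l (frame_dummy F j) = false) -> (forall l j, a1 l (frame_dummy F j) = true) ->
  (\sum_l (2 + 2 * `[< good (phi l) (assign R F (a0 l)) /\ good (phi l) (assign R F (a1 l)) >])
    <= skeleton_dist P (assign_vec a0) (assign_vec a1))%N.
Proof.
move=> a0_dummy a1_dummy; have [n _ walk_n] := walk_to_apex (vertex_assign_vec a0).
have [k _ walk_k] := walk_to_apex (vertex_assign_vec a1).
apply: (skeleton_dist_ge (walk_cat walk_n (walk_rev walk_k))) => j /total_potential_walk.
suff : (total_potential (assign_vec a0) + \sum_l (2 + 2 * `[< good (phi l) (assign R F (a0 l)) /\
    good (phi l) (assign R F (a1 l)) >]) <= total_potential (assign_vec a1))%N by lia.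
rewrite /total_potential -big_split; apply: leq_sum => l _ /=.
rewrite !block_assign_vec /potential !assign_lam oner_eq0.
rewrite (dummy_count_assign R (a0_dummy l)) (dummy_count_assign R (a1_dummy l)).
by rewrite asbool_and; case: `[< _ >]; case: `[< _ >].
Qed.

End CnfProduct.

Local Close Scope ring_scope.

(** * Stack programs *)

Section StackPrograms.
Variables Reg G : finType.

Definition stacks := Reg -> seq G.
Definition tops_type := {ffun Reg -> option G}.

Inductive op := Keep | Pop | Push of G | Rep of G.

Definition apply_op (o : op) (s : seq G) : seq G :=
  match o with
  | Keep => s | Pop => behead s | Push a => a :: s | Rep a => a :: behead s
  end.

Definition tops (s : stacks) : tops_type := [ffun r => ohead (s r)].
Definition do_ops (o : Reg -> op) (s : stacks) : stacks := fun r => apply_op (o r) (s r).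

Inductive prog :=
  | Do of (tops_type -> Reg -> op)
  | Seq of prog & prog
  | If of (tops_type -> bool) & prog & prog
  | While of (tops_type -> bool) & prog.

Fixpoint pc (p : prog) : finType :=
  match p with
  | Do _ => unit
  | Seq p q => (pc p + pc q)%type
  | If _ p q => option (pc p + pc q)%type
  | While _ p => option (pc p)
  end.

Fixpoint pc_start (p : prog) : pc p :=
  match p return pc p with
  | Do _ => tt
  | Seq p q => inl (pc_start p)
  | If _ p q => None
  | While _ p => None
  end.

Fixpoint pc_next (p : prog) : pc p -> tops_type -> option (pc p) * (Reg -> op) :=
  match p return pc p -> tops_type -> option (pc p) * (Reg -> op) with
  | Do a => fun _ t => (None, a t)
  | Seq p q => fun k t =>
      match k with
      | inl k =>
          (Some (if (pc_next k t).1 is Some k' then inl k' else inr (pc_start q)), (pc_next k t).2)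
      | inr k => (omap inr (pc_next k t).1, (pc_next k t).2)
      end
  | If c p q => fun k t =>
      match k with
      | None => (Some (Some (if c t then inl (pc_start p) else inr (pc_start q))), fun _ => Keep)
      | Some (inl k) => (omap (fun k' => Some (inl k')) (pc_next k t).1, (pc_next k t).2)
      | Some (inr k) => (omap (fun k' => Some (inr k')) (pc_next k t).1, (pc_next k t).2)
      end
  | While c p => fun k t =>
      match k with
      | None => (if c t then Some (Some (pc_start p)) else None, fun _ => Keep)
      | Some k => (Some (pc_next k t).1, (pc_next k t).2)
      end
  end.

(* A halted configuration has program counter [None]. *)
Definition prog_step (p : prog) (c : option (pc p) * stacks) : option (pc p) * stacks :=
  if c.1 is Some k then ((pc_next k (tops c.2)).1, do_ops (pc_next k (tops c.2)).2 c.2) else c.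

Definition prog_run (p : prog) (n : nat) (c : option (pc p) * stacks) := iter n (@prog_step p) c.

Lemma prog_runD p a b c : @prog_run p (a + b) c = prog_run b (prog_run a c).
Proof. by rewrite /prog_run addnC iterD. Qed.

Lemma prog_runS p n c : @prog_run p n.+1 c = prog_run n (prog_step c).
Proof. exact: iterSr. Qed.

Lemma prog_run_halted p n s : @prog_run p n (None, s) = (None, s).
Proof. by elim: n => // n IH; rewrite prog_runS. Qed.

Definition halts_within (p : prog) (n : nat) (s s' : stacks) : Prop :=
  exists2 k, k <= n & prog_run k (Some (pc_start p), s) = (None, s').

Lemma size_prog_run p n c r : size ((@prog_run p n c).2 r) <= size (c.2 r) + n.
Proof.
elim: n c => [|n IH] c; first by rewrite addn0.
rewrite prog_runS; apply: leq_trans (IH _) _; rewrite addnS -addSn leq_add2r /prog_step.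
case: c => [[k|] s] /=; last exact: leqnSn.
by rewrite /do_ops; case: ((pc_next k (tops s)).2 r) => [||a|a] //=; rewrite ?size_behead; lia.
Qed.

Fixpoint iterates (c : tops_type -> bool) (body : stacks -> stacks -> Prop) (k : nat) s s' : Prop :=
  if k is k'.+1 then c (tops s) /\ exists t, body s t /\ iterates c body k' t s'
  else ~~ c (tops s) /\ s' = s.

(* [p] leads from [s] to [s'], and no loop iterates more than [B] times. *)
Fixpoint bigstep (B : nat) (p : prog) (s s' : stacks) : Prop :=
  match p with
  | Do a => s' = do_ops (a (tops s)) s
  | Seq p q => exists t, bigstep B p s t /\ bigstep B q t s'
  | If c p q => if c (tops s) then bigstep B p s s' else bigstep B q s s'
  | While c p => exists2 k, k <= B & iterates c (bigstep B p) k s s'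
  end.

Fixpoint cost (B : nat) (p : prog) : nat :=
  match p with
  | Do _ => 1
  | Seq p q => cost B p + cost B q
  | If _ p q => (maxn (cost B p) (cost B q)).+1
  | While _ p => (B * (cost B p).+1).+1
  end.

(* [e] embeds the program counters of [p] into those of [p']; a halt of [p] becomes [x]. *)
Lemma prog_run_embed p p' (e : pc p -> pc p') (x : option (pc p')) :
  (forall k t, pc_next (e k) t =
    (if (pc_next k t).1 is Some k1 then Some (e k1) else x, (pc_next k t).2)) ->
  forall n k s s', prog_run n (Some k, s) = (None, s') ->
  exists2 n', n' <= n & prog_run n' (Some (e k), s) = (x, s').
Proof.
move=> e_next; elim=> [|n IH] k s s' //; rewrite prog_runS /prog_step /=.
have := e_next k (tops s); case: (pc_next k (tops s)) => [[k1|] o] /= E.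
  by move=> /IH [n' nn run]; exists n'.+1 => //; rewrite prog_runS /prog_step /= E.
rewrite prog_run_halted => -[<-]; exists 1 => //.
by rewrite /prog_run /= /prog_step /= E.
Qed.

Lemma halts_within_seq p q a b s t s' : halts_within p a s t -> halts_within q b t s' ->
  halts_within (Seq p q) (a + b) s s'.
Proof.
move=> [kp kp_le p_run] [kq kq_le q_run].
have [k t'|jp jp_le p_run_e] :=
  @prog_run_embed p (Seq p q) inl (Some (inr (pc_start q))) _ kp _ _ _ p_run.
  by rewrite /=; case: (pc_next k t').1.
have [k t'|jq jq_le q_run_e] := @prog_run_embed q (Seq p q) inr None _ kq _ _ _ q_run.
  by rewrite /=; case: (pc_next k t').1.
by exists (jp + jq); [lia | rewrite prog_runD p_run_e].
Qed.

Lemma halts_within_if (c : tops_type -> bool) p q a s s' :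
  halts_within (if c (tops s) then p else q) a s s' -> halts_within (If c p q) a.+1 s s'.
Proof.
case E : (c (tops s)) => -[k hk r].
  have [j t'|k' g e] := @prog_run_embed p (If c p q) (fun x => Some (inl x)) None _ k _ _ _ r.
    by rewrite /=; case: (pc_next j t').1.
  by exists k'.+1; [lia | rewrite prog_runS /prog_step /= E].
have [j t'|k' g e] := @prog_run_embed q (If c p q) (fun x => Some (inr x)) None _ k _ _ _ r.
  by rewrite /=; case: (pc_next j t').1.
by exists k'.+1; [lia | rewrite prog_runS /prog_step /= E].
Qed.

Lemma halts_within_while (c : tops_type -> bool) p (body : stacks -> stacks -> Prop) a k s s' :
  (forall t t', body t t' -> halts_within p a t t') -> iterates c body k s s' ->
  halts_within (While c p) (k * a.+1).+1 s s'.
Proof.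
move=> halts; elim: k s => [|k IH] s /=.
  by move=> [/negbTE cs ->]; exists 1 => //; rewrite /prog_run /= /prog_step /= cs.
move=> [cs [t [/halts [kp kp_le p_run] /IH [kq kq_le loop_run]]]].
have [j t'|jp jp_le p_run_e] := @prog_run_embed p (While c p) Some (Some None) _ kp _ _ _ p_run.
  by rewrite /=; case: (pc_next j t').1.
exists (jp + kq).+1; first by lia.
by rewrite prog_runS /prog_step /= cs prog_runD p_run_e.
Qed.

Lemma bigstep_halts B p s s' : bigstep B p s s' -> halts_within p (cost B p) s s'.
Proof.
elim: p s s' => [a|p IHp q IHq|c p IHp q IHq|c p IH] s s' /=.
- by move=> ->; exists 1.
- by move=> [t [/IHp hp /IHq hq]]; exact: halts_within_seq hp hq.
- move=> branch; apply: halts_within_if; case: (c (tops s)) branch => [/IHp|/IHq] [k hk r].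
    by exists k; rewrite // (leq_trans hk) // leq_maxl.
  by exists k; rewrite // (leq_trans hk) // leq_maxr.
- move=> [k kB /(halts_within_while IH)[n hn r]]; exists n => //.
  by apply: (leq_trans hn); rewrite ltnS leq_mul2r kB orbT.
Qed.

Lemma size_bigstep p B s s' r : bigstep B p s s' -> size (s' r) <= size (s r) + cost B p.
Proof.
move=> /bigstep_halts[k kc E]; have := size_prog_run k (Some (pc_start p), s) r; rewrite E /=.
by move=> size_le; apply: leq_trans size_le _; rewrite leq_add2l.
Qed.

Lemma cost_poly p : exists C d, forall B, cost B p <= C * B.+1 ^ d.
Proof.
have mono a b B : a <= b -> B.+1 ^ a <= B.+1 ^ b by move=> ab; rewrite leq_pexp2l.
elim: p => [a|p [C1 [d1 p_le]] q [C2 [d2 q_le]]|c p [C1 [d1 p_le]] q [C2 [d2 q_le]]|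
  c p [C [d cost_le]]] /=.
- by exists 1, 0 => B; rewrite expn0.
- exists (C1 + C2), (d1 + d2) => B; rewrite mulnDl leq_add //.
    by apply: (leq_trans (p_le B)); rewrite leq_mul2l mono ?leq_addr ?orbT.
  by apply: (leq_trans (q_le B)); rewrite leq_mul2l mono ?leq_addl ?orbT.
- exists (C1 + C2).+1, (d1 + d2) => B.
  have pow_gt0 : 0 < B.+1 ^ (d1 + d2) by rewrite expn_gt0.
  have cost_p : cost B p <= C1 * B.+1 ^ (d1 + d2).
    by apply: (leq_trans (p_le B)); rewrite leq_mul2l mono ?leq_addr ?orbT.
  have cost_q : cost B q <= C2 * B.+1 ^ (d1 + d2).
    by apply: (leq_trans (q_le B)); rewrite leq_mul2l mono ?leq_addl ?orbT.
  by rewrite mulSn mulnDl; lia.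
- exists C.+2, d.+1 => B.
  have pow_gt0 : 0 < B.+1 ^ d by rewrite expn_gt0.
  by have := cost_le B; rewrite expnS; nia.
Qed.

End StackPrograms.

Arguments Keep {G}.
Arguments Pop {G}.

Reserved Notation "s .[ r <- v ]" (left associativity, format "s .[ r  <-  v ]").

Declare Scope prog_scope.
Delimit Scope prog_scope with prog.
Bind Scope prog_scope with prog.
Notation "p ;; q" := (Seq p q) (at level 61, right associativity) : prog_scope.
Local Open Scope prog_scope.

(** * Compilation to Turing machines *)

Lemma tm_runD (M : tm) a b c : tm_run (a + b) c = tm_run b (@tm_run M a c).
Proof. by rewrite /tm_run addnC iterD. Qed.

Lemma tm_runS (M : tm) k c : tm_run k.+1 c = tm_run k (odflt c (@tm_step M c)).
Proof. exact: iterSr. Qed.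

Lemma tm_computes_mono (M : tm) t t' ws out :
  tm_computes_in M t ws out -> t <= t' -> tm_computes_in M t' ws out.
Proof.
move=> [halted outE] tt; rewrite /tm_computes_in -(subnK tt) addnC tm_runD.
set c := tm_run t _ in halted outE *; have -> : tm_run (t' - t) c = c.
  by elim: (t' - t) => // k IH; rewrite tm_runS halted.
by [].
Qed.

Lemma size_nth_sumn (T : Type) (ws : seq (seq T)) i :
  size (nth [::] ws i) <= sumn [seq size w | w <- ws].
Proof.
elim: ws i => [|w ws IH] [|i] //=; first by rewrite leq_addr.
by apply: leq_trans (IH i) _; rewrite leq_addl.
Qed.

Lemma nth_head_behead (T : Type) (x0 : T) l k : nth x0 (head x0 l :: behead l) k = nth x0 l k.
Proof. by case: l => //=; case: k => [|[]]. Qed.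

Lemma tape_write_id (S : finType) (t : tape S) : tape_write (tape_head t) t = t.
Proof. by case: t. Qed.

Lemma leading_bits_nth (S : finType) (l : seq (cell S)) (out : bits) :
  (forall k, nth None l k = nth None [seq Some (inl b) | b <- out] k) ->
  leading_bits l = out.
Proof.
elim: out l => [|b out IH] [|x l] lE //=; have := lE 0 => /= E; rewrite ?E //.
by congr cons; apply: IH => k; have := lE k.+1.
Qed.

Section Compile.
Variables (Reg S : finType) (K : nat) (tape_of : Reg -> 'I_K.+1) (reg_of : 'I_K.+1 -> Reg).
Hypotheses (tape_ofK : cancel tape_of reg_of) (reg_ofK : cancel reg_of tape_of).
Local Notation G := ((bool + S)%type : finType).
Variable p : prog Reg G.

Definition control : finType :=
  option (bool + (option (pc p) * option {ffun Reg -> option G}))%type.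

Definition loading : control := Some (inl true).
Definition unloading : control := Some (inl false).
Definition at_pc q : control := Some (inr (q, None)).

(* A stack operation takes two steps: a push first moves the head, then writes. *)
Definition compile_trans (q : control) (h : {ffun 'I_K.+1 -> cell S}) :
    option (control * ('I_K.+1 -> cell S * move)) :=
  match q with
  | None => None
  | Some (inl true) =>
      if [exists i, h i != None]
      then Some (loading, fun i => (h i, if h i == None then MoveN else MoveR))
      else Some (at_pc (Some (pc_start p)), fun i => (h i, MoveL))
  | Some (inl false) =>
      if h ord0 == None
      then Some (None, fun i => (h i, if i == ord0 then MoveR else MoveN))
      else Some (unloading, fun i => (h i, if i == ord0 then MoveL else MoveN))
  | Some (inr (Some k, None)) =>
      let n := pc_next k [ffun r => h (tape_of r)] in
      Some (Some (inr (n.1, Some [ffun r => if n.2 r is Push a then Some a else None])),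
        fun i => match n.2 (reg_of i) with
                 | Keep => (h i, MoveN) | Pop => (None, MoveL)
                 | Push _ => (h i, MoveR) | Rep a => (Some a, MoveN) end)
  | Some (inr (k, Some pending)) =>
      Some (at_pc k, fun i => (if pending (reg_of i) is Some a then Some a else h i, MoveN))
  | Some (inr (None, None)) => Some (unloading, fun i => (h i, MoveN))
  end.

Definition compile : tm := @TM K control S loading compile_trans.

(* The stack grows to the right: its top is under the head, and the part of the
   tape right of the head is blank. *)
Definition represents (t : tape S) (s : seq G) :=
  (forall k, nth None (tape_head t :: tape_left t) k = nth None (map Some s) k) /\
  (forall k, nth None (tape_right t) k = None).

Lemma represents_head t s : represents t s -> tape_head t = ohead s.
Proof. by move=> [/(_ 0) /= -> _]; case: s. Qed.

Lemma represents_pop t s :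
  represents t s -> represents (tape_move MoveL (tape_write None t)) (behead s).
Proof.
move=> [left_s right_blank]; split=> /= k; last by case: k.
rewrite nth_head_behead; have /= -> := left_s k.+1.
by case: s {left_s} => //=; rewrite nth_nil.
Qed.

Lemma represents_push t s a : represents t s ->
  represents (tape_write (Some a) (tape_move MoveR (tape_write (tape_head t) t))) (a :: s).
Proof.
move=> [left_s right_blank]; split=> /= k; first by case: k => //= k; rewrite left_s.
by rewrite nth_behead right_blank.
Qed.

Lemma represents_rep t s a : represents t s -> represents (tape_write (Some a) t) (a :: behead s).
Proof.
move=> [left_s right_blank]; split=> //= k; case: k => //= k; have /= -> := left_s k.+1.
by case: s {left_s} => //=; rewrite nth_nil.
Qed.

Definition simulates (c : config compile) (q : option (pc p)) (s : stacks Reg G) :=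
  cfg_state c = at_pc q /\ forall r, represents (cfg_tape c (tape_of r)) (s r).

Lemma compile_step (c : config compile) k (s : stacks Reg G) :
  simulates c (Some k) s ->
  simulates (tm_run 2 c) (prog_step (Some k, s)).1 (prog_step (Some k, s)).2.
Proof.
move=> [cq rep].
have E : [ffun r => [ffun i => tape_head (cfg_tape c i)] (tape_of r)] = tops s.
  by apply/ffunP => r; rewrite !ffunE (represents_head (rep r)).
rewrite /simulates tm_runS /tm_step cq /= E.
rewrite /prog_step /=; case: (pc_next k (tops s)) => [q' o] /=.
case: q' => [q'|] /=; split=> // r; rewrite !ffunE tape_ofK /do_ops.
all: case: (o r) => [||a|a] /=; rewrite ?tape_write_id //.
all: by [apply: represents_pop | apply: represents_push | exact: (represents_rep a (rep r))].
Qed.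

Lemma compile_run n (c : config compile) k (s : stacks Reg G) s' :
  simulates c (Some k) s -> prog_run n (Some k, s) = (None, s') ->
  exists2 n', n' <= 2 * n & simulates (tm_run n' c) None s'.
Proof.
elim: n c k s => [|n IH] c k s // cs; rewrite prog_runS.
have := compile_step cs; case E : (prog_step (Some k, s)) => [[k1|] s1] /= cs1.
  by move=> /(IH _ _ _ cs1) [n' nn h]; exists (2 + n'); [lia | rewrite tm_runD].
by rewrite prog_run_halted => -[<-]; exists 2 => //; lia.
Qed.

Lemma unload_loop (c : config compile) (s : seq G) : forall (r : seq G),
  cfg_state c = unloading ->
  (forall k, nth None (tape_head (cfg_tape c ord0) :: tape_left (cfg_tape c ord0)) k =
             nth None (map Some s) k) ->
  (forall k, nth None (tape_right (cfg_tape c ord0)) k = nth None (map Some r) k) ->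
  let c' := tm_run (size s).+1 c in
  cfg_state c' = None /\ forall k,
    nth None (tape_head (cfg_tape c' ord0) :: tape_right (cfg_tape c' ord0)) k =
    nth None (map Some (catrev s r)) k.
Proof.
elim: s c => [|a s IH] c r cq left_s right_r.
  have headE := left_s 0; rewrite /= in headE.
  rewrite /tm_run /= /tm_step cq /= ffunE headE /=; split=> // k.
  by rewrite nth_head_behead right_r.
have headE : tape_head (cfg_tape c ord0) = Some a := left_s 0.
pose c1 := Config (M := compile) unloading (fun i =>
  tape_move (if i == ord0 then MoveL else MoveN) (cfg_tape c i)).
have step_c : tm_step c = Some c1.
  rewrite /tm_step cq /= ffunE headE /=; congr (Some (Config _ _)).
  by apply: funext => i; rewrite ffunE tape_write_id.
have -> : (size (a :: s)).+1 = (size s).+1.+1 by [].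
rewrite tm_runS step_c; apply: (IH c1 (a :: r)) => // k.
  by rewrite /= nth_head_behead; have := left_s k.+1.
by case: k => [|k] //=.
Qed.

Lemma unload_run (c : config compile) (s : stacks Reg G) (out : bits) :
  simulates c None s -> s (reg_of ord0) = [seq inl b | b <- rev out] ->
  let c' := tm_run (size out).+2 c in
  tm_step c' = None /\ tape_output (cfg_tape c' ord0) = out.
Proof.
move=> [cq rep] sE; pose c1 := tm_run 1 c.
have c1E : c1 = Config (M := compile) unloading (cfg_tape c).
  rewrite /c1 /tm_run /= /tm_step cq /=; congr Config; apply: funext => i.
  by rewrite ffunE tape_write_id.
have [left_s right_blank] := rep (reg_of ord0); rewrite reg_ofK sE in left_s right_blank.
have [|||halted outE] := @unload_loop c1 ([seq inl b | b <- rev out] : seq G) [::].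
- by rewrite c1E.
- by rewrite c1E.
- by move=> j; rewrite c1E /= nth_nil; exact: right_blank.
have -> : (size out).+2 = 1 + (size ([seq inl b | b <- rev out] : seq G)).+1.
  by rewrite size_map size_rev.
rewrite tm_runD -/c1 /=; split; first by rewrite /tm_step halted.
apply: leading_bits_nth => j; rewrite outE catrevE cats0 -map_rev revK -map_comp.
by [].
Qed.

Lemma load_loop (ws : seq bits) j :
  (forall i, i < j -> [exists k : 'I_K.+1, i < size (nth [::] ws k)]) ->
  let c := tm_run j (tm_init compile ws) in
  cfg_state c = loading /\ forall i : 'I_K.+1,
  let cs := [seq Some (inl b) | b <- nth [::] ws i] : seq (cell S) in
  cfg_tape c i = Tape (rev (take j cs)) (nth None cs j) (drop j.+1 cs).
Proof.
elim: j => [|j IH] long.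
  by split=> // i cs; rewrite take0 drop1 nth0.
rewrite /tm_run iterS -/(tm_run j _); have [|cq cT] := IH; first by move=> i ij; apply: long; lia.
set c := tm_run j _ in cq cT *.
have some_cell : [exists i, [ffun i => tape_head (cfg_tape c i)] i != None].
  have /existsP[k hk] := long j (ltnSn j); apply/existsP; exists k; rewrite ffunE cT /=.
  by rewrite (nth_map false).
rewrite /tm_step cq /= some_cell /=; split=> // i; rewrite ffunE cT /= /tape_write /=.
set cs := [seq _ | _ <- _]; have [le|lt] := leqP (size cs) j.
  by rewrite nth_default // eqxx /= !take_oversize ?drop_oversize ?nth_default //; lia.
have -> /= : (nth None cs j == None) = false.
  by rewrite (nth_map false) //; rewrite size_map in lt.
rewrite (take_nth None lt) rev_rcons; congr Tape.
  by rewrite -nth0 nth_drop addn0.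
by rewrite -drop1 drop_drop add1n.
Qed.

Definition input_stacks (ws : seq bits) : stacks Reg G :=
  fun r => [seq inl b | b <- rev (nth [::] ws (tape_of r))].

Lemma load_run (ws : seq bits) : exists2 j, j <= (sumn [seq size w | w <- ws]).+1 &
  simulates (tm_run j (tm_init compile ws)) (Some (pc_start p)) (input_stacks ws).
Proof.
pose J := \max_(i < K.+1) size (nth [::] ws i).
have J_le : J <= sumn [seq size w | w <- ws] by apply/bigmax_leqP => i _; exact: size_nth_sumn.
have [|cq cT] := @load_loop ws J.
  move=> i iJ; apply/existsP; apply: contrapT => /forallNP short.
  move: iJ; rewrite ltnNge => /negP; apply.
  by apply/bigmax_leqP => k' _; rewrite leqNgt; apply/negP; exact: short.
set c := tm_run J _ in cq cT.
have tapeE (i : 'I_K.+1) : let cs := [seq Some (inl b) | b <- nth [::] ws i] : seq (cell S) in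
    cfg_tape c i = Tape (rev cs) None [::].
  move=> cs; have szc : size cs <= J by rewrite size_map; exact: (leq_bigmax i).
  by rewrite cT -/cs take_oversize // (@nth_default _ None cs) // drop_oversize // leqW.
exists (J + 1); first by rewrite addn1.
rewrite tm_runD -/c /tm_run /= /tm_step cq /=.
have -> : [exists i, [ffun i => tape_head (cfg_tape c i)] i != None] = false.
  by apply/negbTE/existsPn => i; rewrite ffunE tapeE.
split=> //= r; rewrite ffunE tapeE /input_stacks; split=> /= j; last by case: j => [|[]].
by rewrite nth_head_behead -map_rev -!map_comp.
Qed.

Theorem compile_correct B ws s' out :
  bigstep B p (input_stacks ws) s' -> s' (reg_of ord0) = [seq inl b | b <- rev out] ->
  tm_computes_in compile (2 * cost B p + sumn [seq size w | w <- ws] + size out + 3) ws out.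
Proof.
move=> /bigstep_halts [k kc run_p] outE.
have [j j_le loaded] := load_run ws.
have [k' k'_le simulated] := compile_run loaded run_p.
have unloaded := unload_run simulated outE.
apply: (@tm_computes_mono _ (j + (k' + (size out).+2))); last by lia.
by rewrite /tm_computes_in !tm_runD.
Qed.

End Compile.

(** * The computation tableau of a stack program *)

Lemma onth_behead (T : Type) (s : seq T) i : onth (behead s) i = onth s i.+1.
Proof. by case: s => //; case: i. Qed.

Lemma onth_nthE (T : Type) (x0 : T) (s : seq T) i : i < size s -> onth s i = Some (nth x0 s i).
Proof. by move=> i_lt; rewrite onthE (nth_map x0). Qed.

Lemma ohead_onth (T : Type) (s : seq T) : ohead s = onth s 0.
Proof. by case: s. Qed.

Lemma inord_id n (i : 'I_n.+1) : inord i = i.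
Proof. by apply: val_inj; rewrite /= inordK. Qed.

(* Positions relative to an index [i]: 0, [i] and [i + 1]. *)
Definition offset : eqType := option bool.
Notation Zero := None (only parsing).
Notation Here := (Some false) (only parsing).
Notation Next := (Some true) (only parsing).

Definition shift N (i : 'I_N.+1) (d : offset) : 'I_N.+1 :=
  match d with Zero => ord0 | Here => i | Next => inord i.+1 end.

Lemma shift_here_next N (i j : 'I_N.+1) : j = i.+1 :> nat -> shift i Next = j.
Proof. by move=> ji; apply: val_inj; rewrite /= -ji inordK. Qed.

(* Data of an index: is it first, is it last, the bits of the instance and of the
   threshold at this depth, and whether the guessed word may extend to it. *)
Definition index_info : finType := (bool * bool * option bool * option bool * bool)%type.
Definition info_first (e : index_info) := e.1.1.1.1.
Definition info_last (e : index_info) := e.1.1.1.2.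
Definition info_x (e : index_info) := e.1.1.2.
Definition info_th (e : index_info) := e.1.2.
Definition info_w (e : index_info) := e.2.

Record interface (Reg G : finType) := Interface {
  io_x : Reg;
  io_w : Reg;
  io_th : Reg;
  io_verdict : Reg;
  io_bit : bool -> G;
  io_x_neq_w : io_x != io_w;
  io_x_neq_th : io_x != io_th;
  io_w_neq_th : io_w != io_th }.

(* A value of type [C] attached to a variable of kind [placed_kind], at the given offsets
   from a position of the tableau. *)
Record placed (C K : Type) := Placed {
  placed_val : C;
  placed_time : offset;
  placed_depth : offset;
  placed_kind : K }.

Definition tuple_of_placed (C K : Type) (l : placed C K) : C * offset * offset * K :=
  (placed_val l, placed_time l, placed_depth l, placed_kind l).
Definition placed_of_tuple (C K : Type) (u : C * offset * offset * K) : placed C K :=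
  Placed u.1.1.1 u.1.1.2 u.1.2 u.2.

Lemma tuple_of_placedK (C K : Type) : cancel (@tuple_of_placed C K) (@placed_of_tuple C K).
Proof. by case. Qed.

HB.instance Definition _ (C K : eqType) :=
  Equality.copy (placed C K) (can_type (@tuple_of_placedK C K)).

Section Tableau.
Variables (Reg G : finType) (p : prog Reg G) (io : interface Reg G).
Local Notation rX := (io_x io).
Local Notation rW := (io_w io).
Local Notation rT := (io_th io).
Local Notation rV := (io_verdict io).
Local Notation bit := (io_bit io).

Definition kind : finType := ((option (pc p) + Reg * option G) + ('I_4 + bool))%type.
Definition KPc (q : option (pc p)) : kind := inl (inl q).
Definition KCell (r : Reg) (g : option G) : kind := inl (inr (r, g)).
Definition KDummy (j : 'I_4) : kind := inr (inl j).
Definition KLam : kind := inr (inr true).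
Definition KZ : kind := inr (inr false).

Definition context : finType := (option (pc p) * tops_type Reg G)%type.

Definition clause_kind : finType :=
  ((Reg + option bool) + (context + (context * Reg + context * Reg * option G)))%type.
Notation CInit r := (inl (inl r)).
Notation CStart := (inl (inr None)).
Notation CWord := (inl (inr (Some false))).
Notation CVerdict := (inl (inr (Some true))).
Notation CPc c := (inr (inl c)).
Notation CTop c r := (inr (inr (inl (c, r)))).
Notation CCell c r g := (inr (inr (inr (c, r, g)))).

Local Notation rel_literal := (placed bool kind).
Local Notation pos := (Placed false Here).
Local Notation neg := (Placed true Here).
Local Notation pos_next := (Placed false Next).

Definition context_next (c : context) : option (pc p) * (Reg -> op G) :=
  if c.1 is Some q then pc_next q c.2 else (None, fun _ => Keep).

Definition premise (c : context) : seq rel_literal :=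
  neg Zero (KPc c.1) :: [seq neg Zero (KCell r (c.2 r)) | r <- enum Reg].

Definition clause_literals (c : clause_kind) (te de : index_info) : option (seq rel_literal) :=
  match c with
  | CInit r =>
      if ~~ info_first te then None else
      if r == rW then
        Some (if info_w de then [:: pos Here (KCell rW (Some (bit false)));
                                    pos Here (KCell rW (Some (bit true)));
                                    pos Here (KCell rW None)]
              else [:: pos Here (KCell rW None)])
      else if r == rX then Some [:: pos Here (KCell rX (omap bit (info_x de)))]
      else if r == rT then Some [:: pos Here (KCell rT (omap bit (info_th de)))]
      else Some [:: pos Here (KCell r None)]
  | CStart =>
      if info_first te && info_first de then Some [:: pos Zero (KPc (Some (pc_start p)))] else None
  | CWord =>
      if info_first te && ~~ info_last de
      then Some [:: neg Here (KCell rW None); pos Next (KCell rW None)] else None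
  | CVerdict =>
      if info_last te && info_first de
      then Some [:: neg Zero (KCell rV (Some (bit false)))] else None
  | CPc c =>
      if ~~ info_last te && info_first de
      then Some (rcons (premise c) (pos_next Zero (KPc (context_next c).1))) else None
  | CTop c r =>
      if ~~ info_last te && info_first de then
        match (context_next c).2 r with
        | Push b | Rep b => Some (rcons (premise c) (pos_next Zero (KCell r (Some b))))
        | _ => None
        end
      else None
  | CCell c r a =>
      if info_last te then None else
      match (context_next c).2 r with
      | Keep => Some (premise c ++ [:: neg Here (KCell r a); pos_next Here (KCell r a)])
      | Pop => if info_last de then None else
          Some (premise c ++ [:: neg Next (KCell r a); pos_next Here (KCell r a)])
      | Push _ => if info_last de then None else
          Some (premise c ++ [:: neg Here (KCell r a); pos_next Next (KCell r a)])
      | Rep _ => if info_first de then None else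
          Some (premise c ++ [:: neg Here (KCell r a); pos_next Here (KCell r a)])
      end
  end.

(* Literals stay inside the tableau and only mention program counters and cells. *)
Definition literal_in_range (te de : index_info) : pred rel_literal := fun l =>
  [&& (if placed_time l is Next then ~~ info_last te else true),
      (if placed_depth l is Next then ~~ info_last de else true)
    & (if placed_kind l is inl _ then true else false)].

Lemma clause_literals_in_range c te de ls : clause_literals c te de = Some ls ->
  all (literal_in_range te de) ls.
Proof.
set ok := literal_in_range te de.
have ok_premise cx s : all ok s -> all ok (premise cx ++ s).
  by move=> s_ok; rewrite all_cat s_ok andbT /= all_map; apply/allP.
rewrite /clause_literals; case: c => [[r|[[]|]]|[c|[[c r]|[[c r] a]]]].
- do 4?[case: ifP => // _]; by move=> [<-] //=; case: ifP.
- by case: ifP => // /andP[_ de_cond] [<-] /=; rewrite /ok /literal_in_range /= ?de_cond.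
- by case: ifP => // /andP[_ de_cond] [<-] /=; rewrite /ok /literal_in_range /= ?de_cond.
- by case: ifP => // /andP[_ de_cond] [<-] /=; rewrite /ok /literal_in_range /= ?de_cond.
- case: ifP => // /andP[te_cond _] [<-].
  by rewrite -cats1 ok_premise //= /ok /literal_in_range /= te_cond.
- case: ifP => // /andP[te_cond _]; case: ((context_next c).2 r) => // [a|a] [<-];
    by rewrite -cats1 ok_premise //= /ok /literal_in_range /= te_cond.
- case: ifP => // /negbT te_cond.
  by case: ((context_next c).2 r) => [||b|b]; [|case: ifP => // /negbT de_cond..]; move=> [<-];
    rewrite ok_premise //= /ok /literal_in_range /= ?te_cond ?de_cond.
Qed.

Section Grid.
Variables (N nw : nat) (x th : bits).
Local Notation n := N.+1.
Implicit Types (t i : 'I_n).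

Definition var : finType := ('I_n * ('I_n * kind))%type.

Definition time_info (t : nat) : index_info := (t == 0, t == N, None, None, false).
Definition depth_info (i : nat) : index_info := (i == 0, i == N, onth x i, onth th i, i < nw).

Definition place (C : Type) t i (l : placed C kind) : C * var :=
  (placed_val l, (shift t (placed_time l), (shift i (placed_depth l), placed_kind l))).

Definition tableau_clauses : seq (seq (bool * var)) :=
  pmap (fun tic : 'I_n * ('I_n * clause_kind) =>
    omap (map (place tic.1 tic.2.1))
      (clause_literals tic.2.2 (time_info tic.1) (depth_info tic.2.1)))
  (enum {: 'I_n * ('I_n * clause_kind)}).

Lemma tableau_clausesP c : reflect
  (exists t i ct ls, clause_literals ct (time_info t) (depth_info i) = Some ls /\
     c = map (place t i) ls)
  (c \in tableau_clauses).
Proof.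
rewrite /tableau_clauses mem_pmap; apply: (iffP mapP).
  move=> [[t [i ct]] _ /=]; case E : (clause_literals _ _ _) => [ls|] //= [->].
  by exists t, i, ct, ls.
by move=> [t [i [ct [ls [E ->]]]]]; exists (t, (i, ct)); rewrite ?mem_enum //= E.
Qed.

Lemma tableau_clauses_neq_nil : tableau_clauses != [::].
Proof.
have : [:: (false, (ord0, (ord0, KPc (Some (pc_start p)))) : var)] \in tableau_clauses.
  by apply/tableau_clausesP; exists ord0, ord0, CStart; eexists; split; first by [].
by case: tableau_clauses.
Qed.

Definition var_lam : var := (ord0, (ord0, KLam)).
Definition var_z : var := (ord0, (ord0, KZ)).
Definition var_dummy (j : 'I_4) : var := (ord0, (ord0, KDummy j)).

Lemma var_reserved_uniq : uniq [:: var_lam, var_z & codom var_dummy].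
Proof.
rewrite /= inE negb_or map_inj_uniq ?enum_uniq ?andbT; last by move=> i j [].
by rewrite -andbA; apply/and3P; split=> //; apply/codomP => -[].
Qed.

Definition tableau_frame : frame var := Frame var_reserved_uniq.

Lemma tableau_clause_vars :
  {in tableau_clauses, forall c, {in c, forall k, k.2 \notin reserved tableau_frame}}.
Proof.
move=> c /tableau_clausesP[t [i [ct [ls [E ->]]]]] k /mapP[l l_ls ->].
have /allP /(_ _ l_ls) /and3P[_ _] := clause_literals_in_range E.
rewrite /place; case: l {l_ls} => ng nx dp [kd _|//] /=.
by rewrite !inE !xpair_eqE !andbF /=; apply/codomP => -[j []].
Qed.

Definition tableau_cnf : cnf tableau_frame := Cnf tableau_clauses_neq_nil tableau_clause_vars.

Definition guess (a : nat -> option bool -> bool) : bits :=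
  [seq a j (Some true) | j <- iota 0 (find (fun j => a j None) (iota 0 n))].

Lemma size_guess a : size (guess a) <= n.
Proof. by rewrite size_map size_iota (leq_trans (find_size _ _)) // size_iota. Qed.

Lemma eq_guess a b :
  (forall j, j < n -> a j None = b j None /\ a j (Some true) = b j (Some true)) ->
  guess a = guess b.
Proof.
move=> ab; rewrite /guess.
have -> : find (fun j => a j None) (iota 0 n) = find (fun j => b j None) (iota 0 n).
  by apply: eq_in_find => j; rewrite mem_iota => /ab[].
apply/eq_in_map => j; rewrite mem_iota add0n => j_lt; apply: (ab j _).2.
by apply: leq_trans j_lt _; rewrite (leq_trans (find_size _ _)) // size_iota.
Qed.

Definition guess_var (a : var -> bool) (i : nat) (c : option bool) : bool :=
  a (ord0, (inord i, KCell rW (omap bit c))).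

Definition input (w : bits) : stacks Reg G := fun r =>
  if r == rX then map bit x else if r == rW then map bit w
  else if r == rT then map bit th else [::].

Lemma input_w w : input w rW = map bit w.
Proof. by rewrite /input eq_sym (negbTE (io_x_neq_w io)) eqxx. Qed.

Lemma input_th w : input w rT = map bit th.
Proof.
by rewrite /input !(eq_sym rT) (negbTE (io_x_neq_th io)) (negbTE (io_w_neq_th io)) eqxx.
Qed.

Lemma input_other w r : r != rX -> r != rW -> r != rT -> input w r = [::].
Proof. by rewrite /input => /negbTE -> /negbTE -> /negbTE ->. Qed.

Definition configuration (w : bits) (t : nat) := prog_run t (Some (pc_start p), input w).
Definition configuration_context w t : context :=
  ((configuration w t).1, tops (configuration w t).2).

Lemma configurationS w t : configuration w t.+1 =
  ((context_next (configuration_context w t)).1,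
   do_ops (context_next (configuration_context w t)).2 (configuration w t).2).
Proof.
rewrite /configuration_context /configuration /prog_run iterS /prog_step /context_next.
by case: (iter _ _ _) => [[q|] s].
Qed.

(** * A satisfying assignment encodes an accepting computation *)

Section Sound.
Variable a : var -> bool.
Hypothesis a_sat : {in tableau_cnf, forall c, satisfies a c}.
Local Notation w := (guess (guess_var a)).

Definition holds (l : bool * var) := l.1 != a l.2.

Lemma clause_holds t i ct ls : clause_literals ct (time_info t) (depth_info i) = Some ls ->
  has (fun l => holds (place t i l)) ls.
Proof.
move=> E; rewrite -(has_map (place t i)); apply: a_sat; apply/tableau_clausesP.
by exists t, i, ct, ls.
Qed.

Lemma holds_pos t i d k : holds (place t i (pos d k)) = a (t, (shift i d, k)).
Proof. by rewrite /holds /=; case: (a _). Qed.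

Lemma holds_neg t i d k : holds (place t i (neg d k)) = ~~ a (t, (shift i d, k)).
Proof. by rewrite /holds /=; case: (a _). Qed.

Lemma holds_pos_next t t' i d k : t' = t.+1 :> nat ->
  holds (place t i (pos_next d k)) = a (t', (shift i d, k)).
Proof. by move=> tt'; rewrite /holds -(shift_here_next tt') /=; case: (a _). Qed.

Lemma unit_clause_pos t i ct d k :
  clause_literals ct (time_info t) (depth_info i) = Some [:: pos d k] -> a (t, (shift i d, k)).
Proof. by move=> /clause_holds; rewrite has_seq1 holds_pos. Qed.

Definition blank (j : nat) := guess_var a j None.

Lemma blankE i : blank i = a (ord0, (i, KCell rW None)).
Proof. by rewrite /blank /guess_var inord_id. Qed.

Lemma blank_above_bound i : nw <= i -> blank i.
Proof.
move=> nwi; rewrite blankE; apply: (@unit_clause_pos ord0 i (CInit rW) Here).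
by rewrite /clause_literals eqxx /info_w /= ltnNge nwi.
Qed.

Lemma blankS (j : nat) : j.+1 < n -> blank j -> blank j.+1.
Proof.
move=> jN bj; pose i : 'I_n := Ordinal (ltnW jN).
have := @clause_holds ord0 i CWord [:: neg Here (KCell rW None); pos Next (KCell rW None)].
have -> : clause_literals CWord (time_info (ord0 : 'I_n)) (depth_info i) =
    Some [:: neg Here (KCell rW None); pos Next (KCell rW None)].
  by rewrite /clause_literals /info_last /= (_ : (j == N) = false) //; lia.
move=> /(_ erefl); rewrite -cat1s has_cat !has_seq1 holds_neg holds_pos.
by move: bj; rewrite -[j]/(nat_of_ord i) blankE => ->.
Qed.

Lemma size_w : size w = find blank (iota 0 n).
Proof. by rewrite size_map size_iota. Qed.

Lemma not_blank_in_word (j : nat) : j < size w -> blank j = false.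
Proof.
rewrite size_w => j_lt; have := before_find 0 j_lt.
by rewrite nth_iota // (leq_trans j_lt) // (leq_trans (find_size _ _)) ?size_iota.
Qed.

Lemma blank_after_word (j : nat) : size w <= j < n -> blank j.
Proof.
move=> /andP[]; elim: j => [|j IH] wj jN; last first.
  have [wE|w_neq] := eqVneq (size w) j.+1; last by apply: blankS => //; apply: IH; lia.
  have : has blank (iota 0 n) by rewrite has_find size_iota -size_w; lia.
  by move=> /(nth_find 0); rewrite -size_w wE nth_iota.
have : has blank (iota 0 n) by rewrite has_find size_iota -size_w; lia.
by move=> /(nth_find 0); rewrite -size_w (_ : size w = 0) //; lia.
Qed.

Lemma size_word : size w <= nw.
Proof.
have [n_le|nw_lt] := leqP n nw; first exact: leq_trans (size_guess _) n_le.
rewrite leqNgt; apply/negP => /not_blank_in_word.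
by have := @blank_above_bound (Ordinal nw_lt) (leqnn _); rewrite /= => ->.
Qed.

Definition row_correct t :=
  a (t, (ord0, KPc (configuration w t).1)) /\
  forall r i, i + t < n -> a (t, (i, KCell r (onth ((configuration w t).2 r) i))).

Lemma initial_word i : a (ord0, (i, KCell rW (omap bit (onth w i)))).
Proof.
have [w_le|i_lt] := leqP (size w) i.
  by rewrite onth_default // -blankE blank_after_word // w_le ltn_ord.
have init : clause_literals (CInit rW) (time_info (ord0 : 'I_n)) (depth_info i) =
    Some [:: pos Here (KCell rW (Some (bit false))); pos Here (KCell rW (Some (bit true)));
             pos Here (KCell rW None)].
  by rewrite /clause_literals eqxx /info_w /= (leq_trans i_lt size_word).
have := clause_holds init; rewrite -cat1s -[[:: _; _]]cat1s !has_cat !has_seq1 !holds_pos.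
rewrite -blankE not_blank_in_word // orbF.
rewrite (onth_nthE false) //= (nth_map 0) ?size_iota -?size_w // nth_iota -?size_w // add0n.
rewrite /guess_var inord_id /=.
by case E : (a (ord0, (i, KCell rW (Some (bit true))))); rewrite ?E // orbF.
Qed.

Lemma row_correct0 : row_correct ord0.
Proof.
split=> [|r i _].
  exact: (@unit_clause_pos ord0 ord0 CStart Zero).
rewrite /configuration /=; have [->|rX_neq] := eqVneq r rX.
  rewrite /input eqxx onth_map; apply: (@unit_clause_pos ord0 i (CInit rX) Here).
  by rewrite /clause_literals (negbTE (io_x_neq_w io)) eqxx.
have [->|rW_neq] := eqVneq r rW; first by rewrite input_w onth_map; exact: initial_word.
have [->|rT_neq] := eqVneq r rT.
  rewrite input_th onth_map; apply: (@unit_clause_pos ord0 i (CInit rT) Here).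
  by rewrite /clause_literals !(eq_sym rT) (negbTE (io_w_neq_th io)) (negbTE (io_x_neq_th io)) eqxx.
rewrite input_other // onth0n; apply: (@unit_clause_pos ord0 i (CInit r) Here).
by rewrite /clause_literals (negbTE rX_neq) (negbTE rW_neq) (negbTE rT_neq).
Qed.

Section Step.
Variables t t' : 'I_n.
Hypotheses (tt' : t' = t.+1 :> nat) (t_correct : row_correct t).
Local Notation c := (configuration_context w t).
Local Notation s := ((configuration w t).2).

Lemma time_not_last : info_last (time_info t) = false.
Proof. by rewrite /info_last /=; have := ltn_ord t'; lia. Qed.

Lemma premise_false i : has (fun l => holds (place t i l)) (premise c) = false.
Proof.
have [pc_ok cells_ok] := t_correct; apply/negbTE; rewrite /= negb_or holds_neg negbK pc_ok /=.
rewrite has_map; apply/hasPn => r _; rewrite /= holds_neg negbK ffunE ohead_onth.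
exact: (cells_ok r ord0 (ltn_ord t)).
Qed.

Lemma next_pc_correct : a (t', (ord0, KPc (context_next c).1)).
Proof.
have := @clause_holds t ord0 (CPc c) _; rewrite /clause_literals time_not_last => /(_ _ erefl).
by rewrite has_rcons premise_false orbF (holds_pos_next _ _ _ tt').
Qed.

Lemma next_top_correct r b : (context_next c).2 r = Push b \/ (context_next c).2 r = Rep b ->
  a (t', (ord0, KCell r (Some b))).
Proof.
move=> opE; have := @clause_holds t ord0 (CTop c r)
  (rcons (premise c) (pos_next Zero (KCell r (Some b)))).
rewrite has_rcons premise_false orbF (holds_pos_next _ _ _ tt'); apply.
by rewrite /clause_literals time_not_last; case: opE => ->.
Qed.

Lemma cell_transfer i d d' r b :
  has (fun l => holds (place t i l))
    (premise c ++ [:: neg d (KCell r b); pos_next d' (KCell r b)]) ->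
  a (t, (shift i d, KCell r b)) -> a (t', (shift i d', KCell r b)).
Proof.
rewrite has_cat premise_false orFb -cat1s has_cat !has_seq1 holds_neg (holds_pos_next _ _ _ tt').
by move=> /orP[/negP|//].
Qed.

Lemma next_cell_correct r i : i + t' < n ->
  a (t', (i, KCell r (onth (do_ops (context_next c).2 s r) i))).
Proof.
move=> it'; have [_ cells_ok] := t_correct; have lt := time_not_last.
have i_n := ltn_ord i; rewrite /do_ops; case E : ((context_next c).2 r) => [||b|b] /=.
- have := @clause_holds t i (CCell c r (onth (s r) i)) _.
  by rewrite /clause_literals lt E => /(_ _ erefl)/cell_transfer; apply; apply: cells_ok => /=; lia.
- have li : info_last (depth_info i) = false by rewrite /info_last /=; lia.
  have := @clause_holds t i (CCell c r (onth (s r) i.+1)) _.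
  rewrite /clause_literals lt E li onth_behead => /(_ _ erefl)/cell_transfer; apply.
  have iS : (inord i.+1 : 'I_n) = i.+1 :> nat by rewrite inordK //; lia.
  by have := cells_ok r (inord i.+1); rewrite iS; apply; lia.
- have [i0|i_gt0] := posnP i.
    by rewrite (_ : i = ord0) ?next_top_correct //; [left | apply: val_inj].
  pose j : 'I_n := inord i.-1; have ji : i = j.+1 :> nat by rewrite inordK; lia.
  have lj : info_last (depth_info j) = false by rewrite /info_last /=; lia.
  have := @clause_holds t j (CCell c r (onth (s r) j)) _.
  rewrite /clause_literals lt E lj => /(_ _ erefl)/cell_transfer.
  by rewrite ji (shift_here_next ji); apply; apply: cells_ok => /=; lia.
- have [i0|i_gt0] := posnP i.
    by rewrite (_ : i = ord0) ?next_top_correct //; [right | apply: val_inj].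
  have fi : info_first (depth_info i) = false by rewrite /info_first /=; lia.
  have := @clause_holds t i (CCell c r (onth (s r) i)) _.
  rewrite /clause_literals lt E fi => /(_ _ erefl)/cell_transfer.
  have -> : onth (b :: behead (s r)) i = onth (s r) i.
    by rewrite -{1}(prednK i_gt0) /= onth_behead prednK.
  by apply; apply: cells_ok => /=; lia.
Qed.

Lemma row_correctS : row_correct t'.
Proof.
rewrite /row_correct tt' configurationS; split; first exact: next_pc_correct.
by move=> r i it'; apply: next_cell_correct; rewrite tt'.
Qed.

End Step.

Lemma row_correct_all t : row_correct t.
Proof.
case: t => t; elim: t => [|t IH] tn.
  by rewrite (_ : Ordinal tn = ord0); [exact: row_correct0 | exact: val_inj].
exact: (@row_correctS (Ordinal (ltnW tn))).
Qed.

Lemma tableau_sound : (size w <= nw) && (ohead ((configuration w N).2 rV) != Some (bit false)).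
Proof.
rewrite size_word /=; have [_ /(_ rV ord0 (ltnSn N))] := row_correct_all ord_max.
apply: contraTN => /eqP; rewrite ohead_onth /= => ->.
suff /clause_holds :
  clause_literals CVerdict (time_info (ord_max : 'I_n)) (depth_info (ord0 : 'I_n)) =
    Some [:: neg Zero (KCell rV (Some (bit false)))] by rewrite has_seq1 holds_neg.
by rewrite /clause_literals /info_last /= eqxx.
Qed.

End Sound.
(** * An accepting computation satisfies all clauses *)

Definition tableau (w : bits) (dv : bool) : var -> bool := fun v =>
  match v.2.2 with
  | inl (inl q) => (configuration w v.1).1 == q
  | inl (inr (r, g)) => onth ((configuration w v.1).2 r) v.2.1 == g
  | inr _ => dv
  end.

Section Complete.
Variables (w : bits) (dv : bool).
Hypothesis size_w : size w <= nw.
Hypothesis accepting : ohead ((configuration w N).2 rV) != Some (bit false).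
Local Notation T := (tableau w dv).

Definition clause_true t i := has (fun l => holds T (place t i l)).

Lemma clause_true_cons t i l ls :
  clause_true t i (l :: ls) = holds T (place t i l) || clause_true t i ls.
Proof. by []. Qed.

Lemma tableau_pc t i q : T (t, (i, KPc q)) = ((configuration w t).1 == q).
Proof. by []. Qed.

Lemma tableau_cell t i r g : T (t, (i, KCell r g)) = (onth ((configuration w t).2 r) i == g).
Proof. by []. Qed.

Lemma first_pc t : info_first (time_info t) -> (configuration w t).1 = Some (pc_start p).
Proof. by rewrite /info_first /= => /eqP ->. Qed.

Lemma first_stacks t : info_first (time_info t) -> (configuration w t).2 = input w.
Proof. by rewrite /info_first /= => /eqP ->. Qed.

Lemma shift_next_time t : info_last (time_info t) = false -> shift t Next = t.+1 :> nat.
Proof. by rewrite /info_last /= => tN; rewrite inordK //; have := ltn_ord t; lia. Qed.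

Lemma shift_next_depth i : info_last (depth_info i) = false -> shift i Next = i.+1 :> nat.
Proof. by rewrite /info_last /= => iN; rewrite inordK //; have := ltn_ord i; lia. Qed.

Lemma premise_or t i c rest :
  (c = configuration_context w t -> clause_true t i rest) -> clause_true t i (premise c ++ rest).
Proof.
move=> rest_true; rewrite /clause_true has_cat; apply/orP.
have [cE|c_neq] := eqVneq c (configuration_context w t); first by right; exact: rest_true.
left; apply/hasP; case: c c_neq {rest_true} => q tp; rewrite xpair_eqE negb_and => /orP[qE|tpE].
  exists (neg Zero (KPc q)); first exact: mem_head.
  by rewrite holds_neg tableau_pc eq_sym.
have [r rE] : exists r, tp r != tops (configuration w t).2 r.
  apply: contrapT => /forallNP same; case/negP: tpE; apply/eqP/ffunP => r.
  by apply/eqP; rewrite -[_ == _]negbK; apply/negP; exact: same.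
exists (neg Zero (KCell r (tp r))).
  by rewrite inE map_f ?orbT // mem_enum.
by rewrite holds_neg tableau_cell -ohead_onth eq_sym; move: rE; rewrite ffunE.
Qed.

Lemma init_clause_true t i r ls :
  clause_literals (CInit r) (time_info t) (depth_info i) = Some ls -> clause_true t i ls.
Proof.
rewrite /clause_literals; case: ifP => // /negbFE /first_stacks tE.
have [_|rW_neq] := eqVneq r rW.
  move=> [<-]; rewrite /info_w /=; case: ifP => i_nw;
    rewrite !clause_true_cons !holds_pos !tableau_cell tE input_w !onth_map.
    have [i_lt|i_ge] := ltnP i (size w); last by rewrite (onth_default i_ge) eqxx !orbT.
    by rewrite (onth_nthE false) //=; case: (nth _ _ _); rewrite eqxx ?orbT.
  by rewrite onth_default //= (leq_trans size_w) // leqNgt i_nw.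
have [_|rX_neq] := eqVneq r rX.
  by move=> [<-]; rewrite clause_true_cons holds_pos tableau_cell tE /input eqxx onth_map eqxx.
have [_|rT_neq] := eqVneq r rT; move=> [<-]; rewrite clause_true_cons holds_pos tableau_cell tE.
  by rewrite input_th onth_map eqxx.
by rewrite input_other // onth0n.
Qed.

Lemma io_clause_true t i b ls :
  clause_literals (inl (inr b)) (time_info t) (depth_info i) = Some ls -> clause_true t i ls.
Proof.
rewrite /clause_literals; case: b => [[]|]; case: ifP => // /andP[].
- rewrite /info_last /= => /eqP tN _ [<-].
  rewrite clause_true_cons holds_neg tableau_cell tN -ohead_onth.
  by rewrite accepting.
- move=> /first_stacks tE /negbTE /shift_next_depth iS [<-].
  rewrite !clause_true_cons holds_neg holds_pos !tableau_cell tE iS input_w !onth_map.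
  have [i_lt|i_ge] := ltnP i (size w); first by rewrite (onth_nthE false).
  by rewrite !onth_default //= leqW.
- by move=> /first_pc tE _ [<-]; rewrite clause_true_cons holds_pos tableau_pc tE eqxx.
Qed.

Lemma pos_next_true t i d k : info_last (time_info t) = false ->
  holds T (place t i (pos_next d k)) = T (shift t Next, (shift i d, k)).
Proof. by move=> /shift_next_time tS; rewrite (holds_pos_next _ _ _ _ tS). Qed.

Lemma step_clause_true t i (c : context + context * Reg) ls :
  clause_literals (match c with inl c => CPc c | inr (c, r) => CTop c r end)
    (time_info t) (depth_info i) = Some ls -> clause_true t i ls.
Proof.
rewrite /clause_literals; case: c => [c|[c r]]; case: ifP => // /andP[/negbTE t_last _].
  move=> [<-]; rewrite -cats1; apply: premise_or => cE.
  rewrite clause_true_cons pos_next_true // tableau_pc (shift_next_time t_last) configurationS.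
  by rewrite cE eqxx.
case E : ((context_next c).2 r) => [||b|b] // [<-]; rewrite -cats1; apply: premise_or => cE;
  rewrite clause_true_cons pos_next_true // tableau_cell (shift_next_time t_last) configurationS;
  by rewrite -cE /= /do_ops E eqxx.
Qed.

Lemma cell_clause_true t i c r g ls :
  clause_literals (CCell c r g) (time_info t) (depth_info i) = Some ls -> clause_true t i ls.
Proof.
rewrite /clause_literals; case: ifP => // t_last.
have pair d d' : (c = configuration_context w t ->
    onth (do_ops (context_next c).2 (configuration w t).2 r) (shift i d') =
    onth ((configuration w t).2 r) (shift i d)) ->
    clause_true t i (premise c ++ [:: neg d (KCell r g); pos_next d' (KCell r g)]).
  move=> same; apply: premise_or => cE; rewrite !clause_true_cons holds_neg pos_next_true //.
  rewrite !tableau_cell (shift_next_time t_last) configurationS /= -cE same //.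
  by case: (_ == g).
case E : ((context_next c).2 r) => [||b|b].
- by move=> [<-]; apply: pair; rewrite /do_ops E.
- case: ifP => // /shift_next_depth iS [<-]; apply: pair => _.
  by rewrite /do_ops E iS /= onth_behead.
- case: ifP => // /shift_next_depth iS [<-]; apply: pair => _.
  by rewrite /do_ops E iS.
- case: ifP => //; rewrite /info_first /= => i0 [<-]; apply: pair => _; rewrite /do_ops E /=.
  have i_gt0 : 0 < i by rewrite lt0n i0.
  by rewrite -{1}(prednK i_gt0) /= onth_behead prednK.
Qed.

Lemma tableau_complete : {in tableau_cnf, forall c, satisfies T c}.
Proof.
move=> c /tableau_clausesP[t [i [ct [ls [E ->]]]]].
rewrite /satisfies has_map -/(clause_true t i ls).
move: E; case: ct => [[r|b]|[c0|[cr|[[c0 r] g]]]].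
- exact: init_clause_true.
- exact: io_clause_true.
- exact: (@step_clause_true t i (inl c0)).
- by case: cr => c0 r; exact: (@step_clause_true t i (inr (c0, r))).
- exact: cell_clause_true.
Qed.

End Complete.
End Grid.
End Tableau.

Local Open Scope ring_scope.

(** * The inequality system of a family of tableaux *)

(* Position of a column index relative to a row index: is it zero, is it equal to the
   row index, is it its successor. *)
Definition column_info : finType := (bool * bool * bool)%type.

Definition column_at (e : column_info) (d : offset) : bool :=
  match d with Zero => e.1.1 | Here => e.1.2 | Next => e.2 end.

Definition column_of (i j : nat) : column_info := (j == 0, j == i, j == i.+1)%N.

Lemma column_atE N (i j : 'I_N.+1) d : (d = Next -> i != N :> nat) ->
  column_at (column_of i j) d = (j == shift i d).
Proof.
case: d => [[]|] iN //=.
by rewrite -val_eqE /= inordK //; have := iN erefl; have := ltn_ord i; lia.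
Qed.

Lemma sum_delta (V : finType) (R : pzRingType) (v0 : V) (c : R) (f : V -> R) :
  \sum_v (if v == v0 then c else 0) * f v = c * f v0.
Proof.
rewrite (bigD1 v0) //= eqxx big1 ?addr0 // => v /negbTE ->.
by rewrite mul0r.
Qed.

Section System.
Variables (Reg G : finType) (p : prog Reg G) (io : interface Reg G).
Local Notation kind := (kind p).
Local Notation KLam := (KLam p).
Local Notation KZ := (KZ p).
Local Notation clause_kind := (clause_kind p).
Local Notation clause_literals := (@clause_literals _ _ p io).

Definition sign (b : bool) : int := if b then 1 else -1.

(* A row [inl (lo, k)] bounds the variable of kind [k] from below or from above, except
   that the rows of [lam] bound [z + lam] and [- z + lam]; a row [inr (sg, c)] bounds [z]
   or [- z] by the sum of the clause [c]. *)
Definition row_kind : finType := ((bool * kind) + (bool * clause_kind))%type.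

Definition row_terms (ro : row_kind) (te de : index_info) : seq (placed int kind) :=
  match ro with
  | inl (lo, k) =>
      if [&& info_first te, info_first de & k == KLam] then
        [:: Placed (sign lo) Zero Zero KZ; Placed 1 Zero Zero KLam]
      else if [&& info_first te, info_first de & k == KZ] then [::]
      else if lo then [:: Placed (-1) Here Here k]
      else [:: Placed 1 Here Here k; Placed (-1) Zero Zero KLam]
  | inr (sg, c) =>
      if clause_literals c te de is Some ls then
        [:: Placed (sign sg) Zero Zero KZ,
            Placed (- (count (@placed_val _ _) ls)%:Z) Zero Zero KLam &
            [seq Placed (sign (placed_val l)) (placed_time l) (placed_depth l) (placed_kind l)
              | l <- ls]]
      else [::]
  end.

Definition row_entry (ro : row_kind) (te de : index_info) (el et ed : column_info)
    (k : kind) : int :=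
  if column_at el Here then
    \sum_(u <- row_terms ro te de)
      (if [&& column_at et (placed_time u), column_at ed (placed_depth u) & k == placed_kind u]
       then placed_val u else 0)
  else 0.

Definition row_rhs (ro : row_kind) (te de : index_info) : int :=
  if ro is inl (_, k) then ([&& info_first te, info_first de & k == KLam] : nat)%:Z else 0.

Section Family.
Variables (N nw L : nat) (x : bits) (th : 'I_L -> bits).
Local Notation n := N.+1.
Local Notation time_info := (time_info N).
Local Notation depth_info l := (depth_info N nw x (th l)).
Local Notation var := (var p N).
Local Notation phi l := (tableau_cnf p io N nw x (th l)).
Local Notation lam := (var_lam p N).
Local Notation z := (var_z p N).

Definition system_column : finType := prod_finType 'I_L var.
Definition system_row : finType := ('I_L * ('I_n * ('I_n * row_kind)))%type.

Definition system_entry (r : system_row) (v : system_column) : int :=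
  row_entry r.2.2.2 (time_info r.2.1) (depth_info r.1 r.2.2.1)
    (column_of r.1 v.1) (column_of r.2.1 v.2.1) (column_of r.2.2.1 v.2.2.1) v.2.2.2.

Definition system_rhs (r : system_row) : int :=
  row_rhs r.2.2.2 (time_info r.2.1) (depth_info r.1 r.2.2.1).

Definition system_mx : 'M[rat]_(#|system_row|, #|system_column|) :=
  \matrix_(i, j) (system_entry (enum_val i) (enum_val j))%:~R.
Definition system_col : 'cV[rat]_#|system_row| := \col_i (system_rhs (enum_val i))%:~R.

Lemma row_terms_in_range ro l (t i : 'I_n) u : u \in row_terms ro (time_info t) (depth_info l i) ->
  (placed_time u = Next -> t != N :> nat) /\ (placed_depth u = Next -> i != N :> nat).
Proof.
case: ro => [[lo k]|[sg c]] /=.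
  case: ifP => _; first by rewrite !inE => /orP[] /eqP ->.
  case: ifP => _ //; case: ifP => _; rewrite !inE; first by move/eqP ->.
  by move=> /orP[] /eqP ->.
case E : clause_literals => [ls|] //;
  rewrite !inE => /or3P[/eqP -> //|/eqP -> //|/mapP[v v_ls -> /=]].
have /allP /(_ _ v_ls) /and3P[time_ok depth_ok _] := clause_literals_in_range E; split.
  by move=> vE; move: time_ok; rewrite vE.
by move=> vE; move: depth_ok; rewrite vE.
Qed.

Variable R : realType.
Implicit Types (f : system_column -> R) (l : 'I_L) (t i : 'I_n).

Definition row_value f (r : system_row) : R :=
  \sum_(u <- row_terms r.2.2.2 (time_info r.2.1) (depth_info r.1 r.2.2.1))
    (placed_val u)%:~R * f (r.1, (place r.2.1 r.2.2.1 u).2).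

Lemma system_entry_sum f r : \sum_v (system_entry r v)%:~R * f v = row_value f r.
Proof.
case: r => l [t [i ro]]; rewrite /row_value /system_entry /row_entry /=.
transitivity (\sum_(u <- row_terms ro (time_info t) (depth_info l i))
    \sum_v (if v == (l, (place t i u).2) :> system_column then (placed_val u)%:~R else 0) * f v);
  last by apply: eq_bigr => u _; rewrite sum_delta.
rewrite exchange_big /=; apply: eq_bigr => -[l' [t' [i' k]]] _ /=.
rewrite -mulr_suml; congr (_ * _).
case: (boolP (l' == l :> nat)) => ll'.
  rewrite rmorph_sum /=; apply: eq_big_seq => u /row_terms_in_range[time_ok depth_ok].
  rewrite !column_atE // !xpair_eqE -[l' == l]val_eqE /= ll' /=.
  by case: ifP.
by rewrite mulr0z big1 // => u _; rewrite !xpair_eqE -[l' == l]val_eqE /= (negbTE ll').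
Qed.

Definition row_holds f (r : system_row) : Prop := row_value f r <= (system_rhs r)%:~R.

Lemma system_rows f :
  polyhedron (map_mx ratr system_mx) (map_mx ratr system_col) (@vec R system_column f) <->
  forall r, row_holds f r.
Proof.
have lhsE (j : 'I_#|system_row|) :
  (map_mx ratr system_mx *m @vec R system_column f) j 0 = row_value f (enum_val j).
  rewrite -system_entry_sum mxE (reindex (@enum_rank system_column));
    last exact: onW_bij (enum_rank_bij _).
  by apply: eq_bigr => v _; rewrite !mxE ratr_int enum_rankK.
have rhsE j : (map_mx ratr system_col : 'cV[R]_#|system_row|) j 0 = (system_rhs (enum_val j))%:~R.
  by rewrite !mxE ratr_int.
split=> [sys r|rows j]; last by rewrite lhsE rhsE; exact: rows.
by have := sys (enum_rank r); rewrite lhsE rhsE enum_rankK.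
Qed.

Lemma sign_intr b : (sign b)%:~R = (if b then 1 else -1) :> R.
Proof. by case: b. Qed.

Lemma row_value_clause f l t i sg c ls :
  clause_literals c (time_info t) (depth_info l i) = Some ls ->
  row_value f (l, (t, (i, inr (sg, c)))) =
  (sign sg)%:~R * f (l, z) - clause_sum (tableau_frame p N) (slice f l) (map (place t i) ls).
Proof.
move=> E; rewrite /row_value /= E !big_cons /= big_map /clause_sum big_map.
congr (_ + _); elim: ls {E} => [|u ls IH]; first by rewrite !big_nil /= oppr0 mul0r addr0 oppr0.
rewrite !big_cons opprD -IH /literal_value /slice /=.
case: (placed_val u) => /=; rewrite ?add1n ?add0n; last by rewrite mulrN1z; ring.
by rewrite intS opprD rmorphD /=; ring.
Qed.

Lemma clause_rows f l : (forall t i u, row_holds f (l, (t, (i, inr u)))) <->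
  {in phi l, forall c, f (l, z) <= clause_sum (tableau_frame p N) (slice f l) c /\
                       - f (l, z) <= clause_sum (tableau_frame p N) (slice f l) c}.
Proof.
split=> [rows c /tableau_clausesP[t [i [ct [ls [E ->]]]]]|cls t i [sg ct]].
  have := rows t i (true, ct); have := rows t i (false, ct).
  by rewrite /row_holds !(row_value_clause _ _ E) !sign_intr /system_rhs /=; lra.
rewrite /row_holds /system_rhs /=.
case E : (clause_literals ct (time_info t) (depth_info l i)) => [ls|]; last first.
  by rewrite /row_value /= E big_nil.
have [] := cls (map (place t i) ls); first by apply/tableau_clausesP; exists t, i, ct, ls.
by rewrite (row_value_clause _ _ E) sign_intr; case: sg; lra.
Qed.

Lemma is_lam t i k : (t, (i, k)) = lam <-> [&& t == 0 :> nat, i == 0 :> nat & k == KLam].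
Proof.
split=> [[-> -> ->]|/and3P[/eqP t0 /eqP i0 /eqP ->]]; first by rewrite !eqxx.
by congr (_, (_, _)); apply: val_inj.
Qed.

Lemma is_z t i k : (t, (i, k)) = z <-> [&& t == 0 :> nat, i == 0 :> nat & k == KZ].
Proof.
split=> [[-> -> ->]|/and3P[/eqP t0 /eqP i0 /eqP ->]]; first by rewrite !eqxx.
by congr (_, (_, _)); apply: val_inj.
Qed.

Lemma row_value_box f l t i lo k : (t, (i, k)) != lam -> (t, (i, k)) != z ->
  row_value f (l, (t, (i, inl (lo, k)))) =
  if lo then - f (l, (t, (i, k))) else f (l, (t, (i, k))) - f (l, lam).
Proof.
move=> /eqP/is_lam/negP/negbTE kl /eqP/is_z/negP/negbTE kz.
rewrite /row_value /= /info_first /= kl kz.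
by case: lo; rewrite !big_cons big_nil /=; ring.
Qed.

Lemma row_value_lam f l lo :
  row_value f (l, (ord0, (ord0, inl (lo, KLam)))) = (sign lo)%:~R * f (l, z) + f (l, lam).
Proof. by rewrite /row_value /= /info_first /= ?eqxx !big_cons big_nil /=; ring. Qed.

Lemma system_rhs_box l t i lo k : (t, (i, k)) != lam -> system_rhs (l, (t, (i, inl (lo, k)))) = 0.
Proof. by move=> /eqP/is_lam/negP/negbTE kl; rewrite /system_rhs /= /info_first /= kl. Qed.

Lemma system_rhs_lam l lo : system_rhs (l, (ord0, (ord0, inl (lo, KLam)))) = 1.
Proof. by rewrite /system_rhs /= /info_first /= ?eqxx. Qed.

Lemma box_rows f l : (forall t i u, row_holds f (l, (t, (i, inl u)))) <->
  [/\ forall v, v != lam -> v != z -> 0 <= f (l, v) <= f (l, lam),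
      f (l, z) + f (l, lam) <= 1 & - f (l, z) + f (l, lam) <= 1].
Proof.
split=> [rows|[box up down] t i [lo k]].
  split.
  - move=> [t [i k]] vl vz; have := rows t i (true, k); have := rows t i (false, k).
    by rewrite /row_holds !row_value_box // !system_rhs_box //; lra.
  - by have := rows ord0 ord0 (true, KLam);
    rewrite /row_holds row_value_lam system_rhs_lam sign_intr; lra.
  - by have := rows ord0 ord0 (false, KLam);
    rewrite /row_holds row_value_lam system_rhs_lam sign_intr; lra.
rewrite /row_holds; have [[-> -> ->]|vl] := eqVneq (t, (i, k)) lam.
  by rewrite row_value_lam system_rhs_lam sign_intr; case: lo; move: up down => /=; lra.
rewrite system_rhs_box //; have [[-> -> ->]|vz] := eqVneq (t, (i, k)) z.
  by rewrite /row_value /= big_nil.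
by rewrite row_value_box //; have := box _ vl vz; case: lo; lra.
Qed.

Lemma systemP f : polyhedron (map_mx ratr system_mx) (map_mx ratr system_col)
  (@vec R system_column f) <->
  product (fun l => cnf_polytope (phi l)) f.
Proof.
rewrite system_rows; split=> [rows l|prod [l [t [i ro]]]].
  have [box up down] := iffLR (box_rows f l) (fun t i u => rows _).
  by split=> //; exact: (iffLR (clause_rows f l) (fun t i u => rows _)).
have [box up down cls] := prod l.
case: ro => u; first exact: (iffRL (box_rows f l) (And3 box up down)).
exact: (iffRL (clause_rows f l) cls).
Qed.

Lemma system_bounded : bounded (rat_polyhedron R system_mx system_col).
Proof.
exists 1 => v Pv i.
have /systemP prod : polyhedron (map_mx ratr system_mx) (map_mx ratr system_col)
    (@vec R system_column (coords v)) by rewrite coordsK.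
have -> : v i 0 = coords v (enum_val i) by rewrite /coords enum_valK.
case: (enum_val i) => l w; have Ql := prod l; have [box up down _] := Ql.
have lam_ge0 := cnf_polytope_lam_ge0 Ql; have lam_le1 := cnf_polytope_lam_le1 Ql.
rewrite /slice /= in box up down lam_ge0 lam_le1; rewrite ler_norml.
have [->|wl] := eqVneq w lam; first by lra.
have [->|wz] := eqVneq w z; first by lra.
by have := box _ wl wz; lra.
Qed.

Definition system_polytope : polytope R := Polytope system_bounded.

End Family.
End System.

Local Close Scope ring_scope.

(** * A library of stack programs *)

Section Library.
Variables Reg S : finType.
Local Notation G := ((bool + S)%type : finType).
Local Notation stacks := (stacks Reg G).
Local Notation prog := (prog Reg G).
Local Notation tops_type := (tops_type Reg G).
Implicit Types (s : stacks) (a b r : Reg) (B : nat).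

Definition bit_sym (v : bool) : G := inl v.
Definition sym_bit (g : option G) : option bool := if g is Some (inl v) then Some v else None.

Definition upd s r (v : seq G) : stacks := fun r' => if r' == r then v else s r'.
Local Notation "s .[ r <- v ]" := (upd s r v).

Lemma upd_same s r v : s.[r <- v] r = v.
Proof. by rewrite /upd eqxx. Qed.

Lemma upd_other s r v r' : r' != r -> s.[r <- v] r' = s r'.
Proof. by rewrite /upd => /negbTE ->. Qed.

Lemma upd_upd s r v v' : s.[r <- v].[r <- v'] = s.[r <- v'].
Proof. by apply: funext => r'; rewrite /upd; case: eqP. Qed.

Lemma upd_comm s r r' v v' : r != r' -> s.[r <- v].[r' <- v'] = s.[r' <- v'].[r <- v].
Proof.
move=> rr'; apply: funext => q; rewrite /upd; case: eqP => [->|//].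
by rewrite eq_sym (negbTE rr').
Qed.

Lemma upd_id s r v : s r = v -> s.[r <- v] = s.
Proof. by move=> <-; apply: funext => q; rewrite /upd; case: eqP => [->|]. Qed.

Lemma bigstep_seq B (p q : prog) s s1 s2 :
  bigstep B p s s1 -> bigstep B q s1 s2 -> bigstep B (p ;; q) s s2.
Proof. by move=> ps qs; exists s1. Qed.

Lemma bigstep_if B (c : tops_type -> bool) (p q : prog) s s' :
  bigstep B (if c (tops s) then p else q) s s' -> bigstep B (If c p q) s s'.
Proof. by rewrite /=; case: ifP. Qed.

Lemma bigstep_while B (c : tops_type -> bool) (p : prog) (F : nat -> stacks) k : k <= B ->
  (forall i, i < k -> c (tops (F i)) /\ bigstep B p (F i) (F i.+1)) ->
  ~~ c (tops (F k)) -> bigstep B (While c p) (F 0) (F k).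
Proof.
move=> kB step stop; exists k => //; elim: k F step stop {kB} => [|k IH] F step stop //=.
have [c0 p0] := step 0 isT; split=> //; exists (F 1); split=> //.
by apply: (IH (fun i => F i.+1)) => // i ik; apply: step.
Qed.

Lemma bigstep_eq B (p : prog) s s1 s2 : bigstep B p s s1 -> s1 = s2 -> bigstep B p s s2.
Proof. by move=> ps <-. Qed.

Definition nop : prog := Do (fun _ _ => Keep).

Lemma bigstep_nop B s : bigstep B nop s s.
Proof. by []. Qed.

Definition nonempty a : tops_type -> bool := fun tp => tp a != None.

Lemma nonempty_tops a s : nonempty a (tops s) = (s a != [::]).
Proof. by rewrite /nonempty ffunE; case: (s a). Qed.

Definition act_on a (o : tops_type -> op G) : prog :=
  Do (fun tp r => if r == a then o tp else Keep).

Lemma bigstep_act_on B a o s : bigstep B (act_on a o) s s.[a <- apply_op (o (tops s)) (s a)].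
Proof. by apply: funext => r; rewrite /upd /do_ops; case: eqP => [->|]. Qed.

Definition push a g : prog := act_on a (fun _ => Push g).
Definition pop a : prog := act_on a (fun _ => Pop).
Definition rep_top a g : prog := act_on a (fun _ => Rep g).

Definition pour_step a (f : G -> Reg -> option G) : tops_type -> Reg -> op G :=
  fun tp r => if r == a then Pop else
    if tp a is Some x then (if f x r is Some y then Push y else Keep) else Keep.

Definition pour a f : prog := While (nonempty a) (Do (pour_step a f)).

Lemma bigstep_pour B a f s : size (s a) <= B ->
  bigstep B (pour a f) s
    (fun r => if r == a then [::] else catrev (pmap (f^~ r) (s a)) (s r)).
Proof.
move=> sB; exists (size (s a)) => //; move: {sB} (erefl (s a)).
move: {2 3 4}(s a) => xs; elim: xs s => [|x xs IH] s sa /=.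
  rewrite nonempty_tops sa; split=> //; apply: funext => r.
  by case: eqP => [->|].
rewrite nonempty_tops sa; split=> //.
set s1 := do_ops (pour_step a f (tops s)) s; exists s1; split=> //.
have s1a : s1 a = xs by rewrite /s1 /do_ops /pour_step eqxx /= sa.
suff <- : (fun r => if r == a then [::] else catrev (pmap (f^~ r) xs) (s1 r)) =
    (fun r => if r == a then [::] else
       catrev (oapp (cons^~ (pmap (f^~ r) xs)) (pmap (f^~ r) xs) (f x r)) (s r)) by exact: IH.
apply: funext => r; case: eqP => // /eqP ra.
rewrite /s1 /do_ops /pour_step (negbTE ra) ffunE sa /=.
by case: (f x r).
Qed.

Lemma pmap_const_none (T U : Type) (l : seq T) : pmap (fun _ => None : option U) l = [::].
Proof. by elim: l. Qed.

Lemma pmap_some (T U : Type) (f : T -> U) l : pmap (fun x => Some (f x)) l = map f l.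
Proof. by elim: l => //= x l ->. Qed.

Definition clear_stack a : prog := pour a (fun _ _ => None).

Lemma bigstep_clear_stack B a s : size (s a) <= B -> bigstep B (clear_stack a) s s.[a <- [::]].
Proof.
move=> sB; apply: bigstep_eq (bigstep_pour _ sB) _.
by apply: funext => r; rewrite /upd pmap_const_none.
Qed.

Definition transfer_map a b (f : G -> G) : prog :=
  pour a (fun x r => if r == b then Some (f x) else None).

Lemma bigstep_transfer_map B a b f s : a != b -> size (s a) <= B ->
  bigstep B (transfer_map a b f) s s.[a <- [::]].[b <- catrev (map f (s a)) (s b)].
Proof.
move=> ab sB; apply: bigstep_eq (bigstep_pour _ sB) _; apply: funext => r; rewrite /upd.
have [->|ra] := eqVneq r a; first by rewrite (negbTE ab).
by case: eqP => [->|_]; rewrite ?pmap_some ?pmap_const_none.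
Qed.

Definition transfer a b : prog := transfer_map a b id.

Lemma bigstep_transfer B a b s : a != b -> size (s a) <= B ->
  bigstep B (transfer a b) s s.[a <- [::]].[b <- catrev (s a) (s b)].
Proof. by move=> ab sB; have := bigstep_transfer_map id ab sB; rewrite map_id. Qed.

(* [t] is an empty auxiliary stack. *)
Definition copy_map a b t (f : G -> G) : prog :=
  transfer a t ;;
  pour t (fun x r => if r == a then Some x else if r == b then Some (f x) else None).

Lemma bigstep_copy_map B a b t f s : a != b -> a != t -> b != t -> s t = [::] -> size (s a) <= B ->
  bigstep B (copy_map a b t f) s s.[b <- map f (s a) ++ s b].
Proof.
move=> ab at' bt st sB; apply: (bigstep_seq (bigstep_transfer at' sB)); rewrite st catrevE cats0.
set s1 := upd _ _ _; have s1t : s1 t = rev (s a) by rewrite /s1 upd_same.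
apply: bigstep_eq (bigstep_pour _ _) _; rewrite s1t ?size_rev //; apply: funext => r.
rewrite /s1 /upd; have [->|rt] := eqVneq r t; first by rewrite eq_sym (negbTE bt) st.
have [->|ra] := eqVneq r a.
  by rewrite (negbTE ab) pmap_some map_id catrevE cats0 revK.
case: eqP => [->|_]; last by rewrite pmap_const_none.
by rewrite pmap_some map_rev catrevE revK.
Qed.

Definition copy a b t : prog := copy_map a b t id.

Lemma bigstep_copy B a b t s : a != b -> a != t -> b != t -> s t = [::] -> size (s a) <= B ->
  bigstep B (copy a b t) s s.[b <- s a ++ s b].
Proof. by move=> ab at' bt st sB; have := bigstep_copy_map id ab at' bt st sB; rewrite map_id. Qed.

Definition next_elem a a' : prog :=
  Do (fun tp r => if r == a then Pop else
    if r == a' then (if tp a is Some x then Push x else Keep) else Keep).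

(* While [body] runs, the elements that have been processed are on [a'], in reverse order. *)
Definition for_each a a' (body : prog) : prog :=
  While (nonempty a) (next_elem a a' ;; body) ;; transfer a' a.

Definition split_at s a a' (xs : seq G) i : stacks := s.[a <- drop i xs].[a' <- rev (take i xs)].

Lemma split_at_left s a a' xs i : a != a' -> split_at s a a' xs i a = drop i xs.
Proof. by move=> aa'; rewrite /split_at upd_other // upd_same. Qed.

Lemma split_at_right s a a' xs i : split_at s a a' xs i a' = rev (take i xs).
Proof. by rewrite /split_at upd_same. Qed.

Lemma bigstep_next_elem B a a' s xs i : a != a' -> i < size xs ->
  bigstep B (next_elem a a') (split_at s a a' xs i) (split_at s a a' xs i.+1).
Proof.
move=> aa' ix; have [x [dropE takeE]] : exists x,
    drop i xs = x :: drop i.+1 xs /\ take i.+1 xs = rcons (take i xs) x.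
  case: xs ix => // x0 l ix; exists (nth x0 (x0 :: l) i).
  by rewrite -drop_nth // -take_nth.
apply: funext => r; rewrite /do_ops ffunE split_at_left //.
have [->|ra] := eqVneq r a; first by rewrite !split_at_left // dropE.
rewrite dropE /=; have [->|ra'] := eqVneq r a'; first by rewrite !split_at_right takeE rev_rcons.
by rewrite /split_at !upd_other.
Qed.

Lemma bigstep_for_each B a a' body xs (F : nat -> stacks) :
  a != a' -> size xs <= B -> (forall i, i <= size xs -> F i a = xs /\ F i a' = [::]) ->
  (forall i, i < size xs ->
     bigstep B body (split_at (F i) a a' xs i.+1) (split_at (F i.+1) a a' xs i.+1)) ->
  bigstep B (for_each a a' body) (F 0) (F (size xs)).
Proof.
move=> aa' xB Fxs Fbody; pose F' i := split_at (F i) a a' xs i.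
have -> : F 0 = F' 0.
  by have [F0a F0a'] := Fxs 0 isT; rewrite /F' /split_at drop0 take0 /rev /= !upd_id ?upd_other.
apply: (bigstep_seq (s1 := F' (size xs))).
  apply: bigstep_while => // [i ix|]; rewrite nonempty_tops /F' split_at_left ?drop_size //.
  rewrite -size_eq0 size_drop subn_eq0 -ltnNge; split=> //.
  exact: bigstep_seq (bigstep_next_elem _ _ aa' ix) (Fbody i ix).
have a'a : a' != a by rewrite eq_sym.
apply: bigstep_eq (bigstep_transfer a'a _) _; rewrite /F' split_at_right take_size ?size_rev //.
have [Fa Fa'] := Fxs _ (leqnn _); rewrite split_at_left // drop_size catrevE cats0 revK.
apply: funext => r; have [->|ra] := eqVneq r a; first by rewrite upd_same Fa.
rewrite upd_other //; have [->|ra'] := eqVneq r a'; first by rewrite upd_same Fa'.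
by rewrite upd_other // /split_at !upd_other.
Qed.

Definition seq_progs (T : Type) (f : T -> prog) (l : seq T) : prog :=
  foldr (fun x q => f x ;; q) nop l.

Section Printing.
Variable out : Reg.

Definition prints B (p : prog) s (w : bits) :=
  forall o, bigstep B p s.[out <- o] s.[out <- catrev (map bit_sym w) o].

Lemma prints_seq B p q s w1 w2 :
  prints B p s w1 -> prints B q s w2 -> prints B (p ;; q) s (w1 ++ w2).
Proof. by move=> ps qs o; apply: (bigstep_seq (ps o)); rewrite map_cat catrev_catl. Qed.

Lemma prints_seq_progs B T (f : T -> prog) s (w : T -> bits) l :
  (forall x, prints B (f x) s (w x)) -> prints B (seq_progs f l) s (flatten [seq w x | x <- l]).
Proof. by move=> fw; elim: l => [|x l IH] //=; apply: prints_seq. Qed.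

Lemma prints_for_each B a a' body s xs n (w : nat -> bits) :
  a != a' -> a != out -> a' != out -> s a = xs -> s a' = [::] -> size xs = n -> n <= B ->
  (forall i, i < n -> prints B body (split_at s a a' xs i.+1) (w i)) ->
  prints B (for_each a a' body) s (flatten [seq w i | i <- iota 0 n]).
Proof.
move=> aa' ao ao' sa sa' <- xB body_w o.
have oa : out != a by rewrite eq_sym. have oa' : out != a' by rewrite eq_sym.
pose F i := s.[out <- catrev (map bit_sym (flatten [seq w j | j <- iota 0 i])) o].
rewrite -[s.[out <- o]]/(F 0) -[s.[out <- _]]/(F (size xs)).
apply: bigstep_for_each => // [i _|i ix]; first by rewrite /F !upd_other.
have split_out v k : split_at s.[out <- v] a a' xs k = (split_at s a a' xs k).[out <- v].
  by rewrite /split_at (upd_comm _ _ _ oa) (upd_comm _ _ _ oa').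
rewrite /F !split_out -(addn1 i) iotaD map_cat flatten_cat /= cats0 add0n map_cat catrev_catl.
by rewrite addn1; exact: body_w.
Qed.

Lemma prints_let B init body fin s s1 w :
  (forall o, bigstep B init s.[out <- o] s1.[out <- o]) -> prints B body s1 w ->
  (forall o, bigstep B fin s1.[out <- o] s.[out <- o]) ->
  prints B (init ;; body ;; fin) s w.
Proof.
move=> init_run body_prints fin_run o; apply: (bigstep_seq (init_run o)).
by apply: (bigstep_seq (body_prints o)).
Qed.

Definition indep_of_out (T : Type) (f : tops_type -> T) :=
  forall tp tp' : tops_type, (forall r, r != out -> tp r = tp' r) -> f tp = f tp'.

Lemma indep_of_out_upd T (f : tops_type -> T) s o :
  indep_of_out f -> f (tops s.[out <- o]) = f (tops s).
Proof. by move=> indep; apply: indep => r ro; rewrite !ffunE upd_other. Qed.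

Definition print_bit (wd : tops_type -> bits) i : prog :=
  If (fun tp => i < size (wd tp))
    (act_on out (fun tp => Push (bit_sym (nth false (wd tp) i)))) nop.

Lemma prints_bit B wd s i : indep_of_out wd -> prints B (print_bit wd i) s
  (if i < size (wd (tops s)) then [:: nth false (wd (tops s)) i] else [::]).
Proof.
move=> indep o; apply: bigstep_if; rewrite indep_of_out_upd //; case: ifP => _ //.
apply: bigstep_eq; first exact: bigstep_act_on.
by rewrite upd_same upd_upd /= (indep_of_out_upd s o indep).
Qed.

Lemma flatten_nth_iota (u : bits) m : size u <= m ->
  flatten [seq (if i < size u then [:: nth false u i] else [::]) | i <- iota 0 m] = u.
Proof.
elim: u m => [|b u IH] m; first by elim: (iota _ _).
case: m => // m um; rewrite /= (iotaDl 1 0 m) -map_comp; congr (_ :: _).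
exact: IH um.
Qed.

Definition print_word (wd : tops_type -> bits) : prog :=
  seq_progs (print_bit wd) (iota 0 (\max_(tp : tops_type) size (wd tp))).

Lemma prints_word B wd s : indep_of_out wd -> prints B (print_word wd) s (wd (tops s)).
Proof.
move=> indep; have := prints_seq_progs (iota 0 (\max_(tp : tops_type) size (wd tp)))
  (fun i => prints_bit B s i indep).
by rewrite flatten_nth_iota //; exact: (leq_bigmax (tops s)).
Qed.

Lemma prints_const B s u : prints B (print_word (fun _ => u)) s u.
Proof. exact: (@prints_word B (fun _ => u) s). Qed.

End Printing.

Fixpoint incr (u : bits) : bits :=
  match u with
  | [::] => [:: true]
  | true :: u => false :: incr u
  | false :: u => true :: u
  end.

Lemma incrE u : incr u = nseq (find negb u) false ++ true :: drop (find negb u).+1 u.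
Proof. by elim: u => //= -[] u IH; rewrite ?IH ?drop0. Qed.

Definition increment c t : prog :=
  While (fun tp => tp c == Some (bit_sym true))
    (Do (fun tp r => if r == c then Pop else if r == t then Push (bit_sym false) else Keep)) ;;
  rep_top c (bit_sym true) ;;
  transfer t c.

Lemma bigstep_increment B c t s u : c != t -> s c = map bit_sym u -> s t = [::] -> size u <= B ->
  bigstep B (increment c t) s s.[c <- map bit_sym (incr u)].
Proof.
move=> ct sc st uB; set n := find negb u; have tc : t != c by rewrite eq_sym.
have nu : n <= size u by rewrite /n find_size.
pose F i := s.[c <- map bit_sym (drop i u)].[t <- nseq i (bit_sym false)].
have -> : s = F 0 by rewrite /F drop0 /= upd_id ?upd_id // upd_id.
apply: (bigstep_seq (s1 := F n)).
  apply: bigstep_while; first exact: leq_trans nu uB.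
    move=> i i_n; have dropE : drop i u = true :: drop i.+1 u.
      by rewrite (drop_nth false (leq_trans i_n nu)); have /negbFE -> := before_find false i_n.
    split; first by rewrite ffunE /F upd_other // upd_same dropE /= eqxx.
    apply: funext => r; rewrite /do_ops /F /upd.
    by have [->|rt] := eqVneq r t;
      [rewrite (negbTE tc) | have [_|rc] := eqVneq r c; rewrite ?dropE].
  rewrite ffunE /F upd_other // upd_same; have [n_ge|n_lt] := leqP (size u) n.
    by rewrite drop_oversize.
  rewrite (drop_nth false n_lt) /=.
  by have := @nth_find _ false negb u; rewrite has_find => /(_ n_lt) /negbTE ->.
apply: (bigstep_seq (bigstep_act_on _ _ _ _)); rewrite [F n c]upd_other // upd_same.
apply: bigstep_eq; first by apply: bigstep_transfer;
  rewrite // upd_other // /F upd_same size_nseq (leq_trans nu).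
apply: funext => r; rewrite /F /upd; have [_|rc] := eqVneq r c; last first.
  by have [_|//] := eqVneq r t.
rewrite !eqxx ?(negbTE tc) ?(negbTE ct) ?eqxx catrevE rev_nseq incrE -/n map_cat map_nseq /=.
by rewrite behead_map -drop1 drop_drop add1n.
Qed.

End Library.

Arguments nop {Reg S}.
Arguments pop {Reg S} a.
Arguments clear_stack {Reg S} a.
Arguments transfer {Reg S} a b.
Arguments copy {Reg S} a b t.
Arguments increment {Reg S} c t.

(** * Simulation of Turing machines *)

Definition tm_reg (M : tm) : finType :=
  (('I_(tm_tapes M).+1 + 'I_(tm_tapes M).+1) + ('I_(tm_tapes M).+1 + unit))%type.
Notation TmLeft j := (inl (inl j)) (only parsing).
Notation TmHead j := (inl (inr j)) (only parsing).
Notation TmRight j := (inr (inl j)) (only parsing).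
Notation TmState := (inr (inr tt)) (only parsing).

(* Stacks and symbols of a stack program that hold the configurations of [M]. *)
Record embedding (M : tm) (Reg S : finType) := Embedding {
  emb_reg : tm_reg M -> Reg;
  emb_inv : Reg -> option (tm_reg M);
  emb_cell : cell (tm_symbol M) -> bool + S;
  emb_cell_inv : bool + S -> cell (tm_symbol M);
  emb_state : tm_state M -> bool + S;
  emb_state_inv : bool + S -> tm_state M;
  emb_regK : pcancel emb_reg emb_inv;
  emb_invK : ocancel emb_inv emb_reg;
  emb_cellK : cancel emb_cell emb_cell_inv;
  emb_stateK : cancel emb_state emb_state_inv }.

Definition config_stack (M : tm) (T : Type) (enc_cell : cell (tm_symbol M) -> T)
    (enc_state : tm_state M -> T) (c : config M) (m : tm_reg M) : seq T :=
  match m with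
  | TmLeft j => map enc_cell (tape_left (cfg_tape c j))
  | TmHead j => [:: enc_cell (tape_head (cfg_tape c j))]
  | TmRight j => map enc_cell (tape_right (cfg_tape c j))
  | inr (inr _) => [:: enc_state (cfg_state c)]
  end.

Section ConfigSize.
Variable M : tm.
Implicit Types (c : config M) (D : nat).

Definition config_size_le c D :=
  forall m, size (config_stack (fun _ => tt) (fun _ => tt) c m) <= D.

Lemma size_config_stack T (enc_cell : _ -> T) enc_state c m :
  size (config_stack enc_cell enc_state c m) =
  size (config_stack (fun _ => tt) (fun _ => tt) c m).
Proof. by case: m => [[j|j]|[j|[]]]; rewrite /= ?size_map. Qed.

Lemma config_size_init ws : config_size_le (tm_init M ws) (sumn [seq size w | w <- ws]).+1.
Proof.
move=> [[j|j]|[j|[]]] //=; rewrite size_map size_behead size_map.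
by have := size_nth_sumn ws j; lia.
Qed.

Lemma config_size_run c D n : config_size_le c D -> 0 < D -> config_size_le (tm_run n c) (D + n).
Proof.
elim: n c D => [|n IH] c D cD D0; first by rewrite addn0.
rewrite tm_runS addnS -addSn; apply: IH => //; rewrite /tm_step.
case: tm_trans => [[q a]|] /= m; last exact: leqW (cD m).
case: m => [[j|j]|[j|[]]] //=; have left_size := cD (TmLeft j); have right_size := cD (TmRight j);
  rewrite /= !size_map in left_size right_size *; case: (a j).2 => //=; rewrite ?size_behead; lia.
Qed.

Lemma config_size_computation n ws :
  config_size_le (tm_run n (tm_init M ws)) ((sumn [seq size w | w <- ws]).+1 + n).
Proof. by apply: config_size_run; first exact: config_size_init. Qed.

Lemma size_leading_bits (S : finType) (l : seq (cell S)) : size (leading_bits l) <= size l.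
Proof. by elim: l => //= -[[b|q]|] l IH. Qed.

Lemma size_tape_output c D : config_size_le c D -> size (tape_output (cfg_tape c ord0)) <= D.+1.
Proof.
move=> cD; apply: leq_trans (size_leading_bits _) _ => /=.
by have := cD (TmRight ord0); rewrite /= size_map.
Qed.

Lemma size_computes t ws out : tm_computes_in M t ws out ->
  size out <= sumn [seq size w | w <- ws] + t + 2.
Proof.
by move=> [_ <-]; have := size_tape_output (@config_size_computation t ws); rewrite !addSn addn2.
Qed.

End ConfigSize.

Section Simulation.
Variables (M : tm) (Reg S : finType) (E : embedding M Reg S).
Local Notation G := ((bool + S)%type : finType).
Local Notation stacks := (stacks Reg G).
Local Notation prog := (prog Reg G).
Local Notation tops_type := (tops_type Reg G).
Local Notation k := (tm_tapes M).+1.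
Local Notation mcell := (cell (tm_symbol M)).
Local Notation e := (emb_reg E).
Local Notation "s .[ r <- v ]" := (upd s r v).
Local Notation bit_sym := (@bit_sym S).
Local Notation contents := (config_stack (emb_cell E) (emb_state E)).
Implicit Types (s : stacks) (c : config M) (a r t dst : Reg) (B D : nat) (tp : tops_type).

Definition outside r := emb_inv E r == None.

Lemma outside_emb m : outside (e m) = false.
Proof. by rewrite /outside emb_regK. Qed.

Lemma outside_neq r m : outside r -> r != e m.
Proof. by apply: contraTneq => ->; rewrite outside_emb. Qed.

Lemma emb_inv_some r m : emb_inv E r = Some m -> r = e m.
Proof. by move=> rm; have := emb_invK E r; rewrite rm. Qed.

Lemma emb_reg_eq m m' : (e m == e m') = (m == m').
Proof. exact: inj_eq (pcan_inj (emb_regK E)) _ _. Qed.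

Definition cell_of_top (g : option G) : mcell := if g is Some g then emb_cell_inv E g else None.

Definition with_config c s : stacks := fun r => if emb_inv E r is Some m then contents c m else s r.

Lemma with_config_reg c s m : with_config c s (e m) = contents c m.
Proof. by rewrite /with_config emb_regK. Qed.

Lemma with_config_outside c s r : outside r -> with_config c s r = s r.
Proof. by rewrite /with_config => /eqP ->. Qed.

Lemma with_config_upd c s r v : outside r -> with_config c s.[r <- v] = (with_config c s).[r <- v].
Proof.
move=> /eqP ro; apply: funext => q; rewrite /with_config /upd; case: eqP => [->|_];
  first by rewrite ro.
by [].
Qed.

Lemma eq_with_config (s1 : stacks) c s : (forall r, outside r -> s1 r = s r) ->
  (forall m, s1 (e m) = contents c m) -> s1 = with_config c s.
Proof.
move=> s1_out s1_emb; apply: funext => r; rewrite /with_config.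
by case rE : (emb_inv E r) => [m|];
  [rewrite (emb_inv_some rE) | apply: s1_out; rewrite /outside rE].
Qed.

Definition tops_trans tp :=
  if tp (e TmState) is Some g
  then tm_trans (emb_state_inv E g) [ffun j => cell_of_top (tp (e (TmHead j)))] else None.

Definition running tp : bool := tops_trans tp.

Definition step_ops tp r : op G :=
  match emb_inv E r, tops_trans tp with
  | Some m, Some (q, a) =>
      match m with
      | TmLeft j =>
          match (a j).2 with
          | MoveL => Pop | MoveR => Push (emb_cell E (a j).1) | MoveN => Keep end
      | TmHead j =>
          match (a j).2 with
          | MoveL => Rep (emb_cell E (cell_of_top (tp (e (TmLeft j)))))
          | MoveR => Rep (emb_cell E (cell_of_top (tp (e (TmRight j)))))
          | MoveN => Rep (emb_cell E (a j).1) end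
      | TmRight j =>
          match (a j).2 with
          | MoveL => Push (emb_cell E (a j).1) | MoveR => Pop | MoveN => Keep end
      | inr (inr _) => Rep (emb_state E q)
      end
  | _, _ => Keep
  end.

Lemma cell_of_top_map (l : seq mcell) : cell_of_top (ohead (map (emb_cell E) l)) = head None l.
Proof. by case: l => //= x l; rewrite emb_cellK. Qed.

Lemma tops_trans_with_config c s : tops_trans (tops (with_config c s)) =
  tm_trans (cfg_state c) [ffun i => tape_head (cfg_tape c i)].
Proof.
rewrite /tops_trans ffunE with_config_reg /= emb_stateK; congr tm_trans; apply/ffunP => j.
by rewrite !ffunE with_config_reg /= emb_cellK.
Qed.

Lemma running_with_config c s : running (tops (with_config c s)) = tm_step c.
Proof. by rewrite /running tops_trans_with_config /tm_step; case: tm_trans => [[]|]. Qed.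

Lemma step_ops_with_config c s :
  do_ops (step_ops (tops (with_config c s))) (with_config c s) =
  with_config (odflt c (tm_step c)) s.
Proof.
apply: eq_with_config => [r /eqP ro|m].
  by rewrite /do_ops /step_ops ro /= with_config_outside // /outside ro.
rewrite /do_ops /step_ops emb_regK tops_trans_with_config with_config_reg /tm_step.
case: tm_trans => [[q a]|] //=.
have topE m' : tops (with_config c s) (e m') = ohead (contents c m')
  by rewrite ffunE with_config_reg.
case: m => [[j|j]|[j|[]]] //=; rewrite ?topE /= ?cell_of_top_map; case: (a j).2 => //=.
- by case: (tape_left _).
- by case: (tape_right _).
Qed.

Definition run_tm : prog := While running (Do step_ops).

Lemma bigstep_run_tm B c s n : tm_step (tm_run n c) = None -> n <= B ->
  bigstep B run_tm (with_config c s) (with_config (tm_run n c) s).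
Proof.
move=> halted nB; suff [j jn iter_j] : exists2 j, j <= n &
    iterates running (bigstep B (Do step_ops)) j (with_config c s) (with_config (tm_run n c) s).
  by exists j; first exact: leq_trans jn nB.
elim: n c halted {nB} => [|n IH] c; rewrite ?tm_runS.
  by move=> halted; exists 0; rewrite //= running_with_config halted.
case cE : (tm_step c) => [c'|] /=.
  move=> /IH [j jn iter_j]; exists j.+1; rewrite //= running_with_config cE; split=> //.
  by exists (with_config c' s); split=> //; rewrite step_ops_with_config cE.
have -> : tm_run n c = c by elim: n {IH} => // n IH; rewrite tm_runS cE.
by move=> _; exists 0; rewrite //= running_with_config cE.
Qed.

Definition run_tm_clocked clock : prog :=
  While (nonempty clock) (Do (fun tp r => if r == clock then Pop else step_ops tp r)).

Lemma bigstep_run_tm_clocked B clock c s : outside clock -> size (s clock) <= B ->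
  bigstep B (run_tm_clocked clock) (with_config c s)
    (with_config (tm_run (size (s clock)) c) s.[clock <- [::]]).
Proof.
move=> clock_out sB; exists (size (s clock)) => //.
move: {sB} (erefl (s clock)); move: {2 3 4}(s clock) => xs; elim: xs c s => [|x xs IH] c s sx.
  rewrite /= nonempty_tops with_config_outside // sx; split=> //.
  by rewrite with_config_upd // upd_id ?with_config_outside.
rewrite [size _]/= tm_runS /= nonempty_tops with_config_outside // sx; split=> //.
exists (with_config (odflt c (tm_step c)) s.[clock <- xs]); split.
  rewrite /= with_config_upd //; apply: funext => r; rewrite /do_ops.
  have [->|r_clock] := eqVneq r clock; first by rewrite upd_same with_config_outside // sx.
  by rewrite upd_other // -step_ops_with_config.
have := IH (odflt c (tm_step c)) s.[clock <- xs]; by rewrite upd_same upd_upd; apply.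
Qed.

Definition clear_tm : prog :=
  While (fun tp => [exists m, tp (e m) != None])
    (Do (fun _ r => if emb_inv E r is Some _ then Pop else Keep)).

Definition without_config s : stacks := fun r => if emb_inv E r is Some _ then [::] else s r.

Lemma without_config_reg s m : without_config s (e m) = [::].
Proof. by rewrite /without_config emb_regK. Qed.

Lemma without_config_outside s r : outside r -> without_config s r = s r.
Proof. by rewrite /without_config => /eqP ->. Qed.

Lemma without_with_config c s : without_config (with_config c s) = without_config s.
Proof. by apply: funext => r; rewrite /without_config /with_config; case: (emb_inv E r). Qed.

Lemma without_config_id s : (forall m, s (e m) = [::]) -> without_config s = s.
Proof.
move=> s_empty; apply: funext => r; rewrite /without_config.
by case rE : (emb_inv E r) => //; rewrite (emb_inv_some rE) s_empty.
Qed.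

Lemma bigstep_clear_tm B s : (forall m, size (s (e m)) <= B) ->
  bigstep B clear_tm s (without_config s).
Proof.
move=> sB; pose n := \max_(m : tm_reg M) size (s (e m)).
pose F i : stacks := fun r => if emb_inv E r is Some _ then drop i (s r) else s r.
have -> : without_config s = F n.
  apply: funext => r; rewrite /without_config /F; case rE : (emb_inv E r) => [m|] //.
  by rewrite drop_oversize // (emb_inv_some rE) (leq_bigmax m).
have -> : s = F 0 by apply: funext => r; rewrite /F drop0; case: (emb_inv E r).
apply: bigstep_while; first by apply/bigmax_leqP => m _; exact: sB.
  move=> i i_n; split.
    apply: contraTT i_n => /existsPn all_empty; rewrite -leqNgt; apply/bigmax_leqP => m _.
    have := all_empty m; rewrite negbK ffunE /F emb_regK; case dE : (drop i _) => [|//] _.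
    by move/(congr1 size): dE; rewrite size_drop /=; lia.
  apply: funext => r; rewrite /do_ops /F; case: (emb_inv E r) => // _ /=.
  by rewrite -drop1 drop_drop add1n.
apply/existsPn => m; rewrite ffunE /F emb_regK negbK drop_oversize //.
exact: (leq_bigmax m).
Qed.

Definition input_cell (g : G) : G := emb_cell E (if g is inl b then Some (inl b) else None).

Definition load_tape (srcs : seq Reg) t (j : 'I_k) : prog :=
  if j < size srcs then copy_map (nth t srcs j) (e (TmRight j)) t input_cell else nop.

Definition start_tm : prog := Do (fun tp r =>
  match emb_inv E r with
  | Some (TmHead j) => Push (emb_cell E (cell_of_top (tp (e (TmRight j)))))
  | Some (TmRight j) => Pop
  | Some (inr (inr _)) => Push (emb_state E (tm_start M))
  | _ => Keep
  end).

Definition init_tm (srcs : seq Reg) t : prog :=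
  clear_tm ;; seq_progs (load_tape srcs t) (enum 'I_k) ;; start_tm.

Section Init.
Variables (srcs : seq Reg) (t : Reg) (ws : seq bits) (s : stacks) (B : nat).
Hypotheses (t_out : outside t) (st : s t = [::]).
Hypotheses (srcs_out : {in srcs, forall a, outside a}) (srcs_t : t \notin srcs).
Hypothesis srcs_ws : [seq s a | a <- srcs] = [seq map bit_sym w | w <- ws].
Hypotheses (sB : forall m, size (s (e m)) <= B) (wsB : sumn [seq size w | w <- ws] <= B).

Definition tape_input (j : 'I_k) : seq G := [seq emb_cell E (Some (inl v)) | v <- nth [::] ws j].

Definition loaded (l : seq 'I_k) : stacks := fun r =>
  if emb_inv E r is Some (TmRight j) then if j \in l then tape_input j else [::]
  else without_config s r.

Lemma loaded_outside l r : outside r -> loaded l r = s r.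
Proof. by move=> ro; rewrite -(without_config_outside s ro) /loaded (eqP ro). Qed.

Lemma bigstep_load_tape l j : j \notin l ->
  bigstep B (load_tape srcs t j) (loaded l) (loaded (j :: l)).
Proof.
move=> jl; have szE : size srcs = size ws by rewrite -(size_map s) srcs_ws size_map.
have loadedE : loaded (j :: l) = (loaded l).[e (TmRight j) <- tape_input j].
  apply: funext => r; rewrite /upd; have [->|r_neq] := eqVneq r (e (TmRight j)).
    by rewrite /loaded emb_regK mem_head.
  rewrite /loaded; case rE : (emb_inv E r) => [[//|[i|//]]|//]; rewrite inE.
  by case: eqP => // ij; rewrite (emb_inv_some rE) ij eqxx in r_neq.
have emptyE : loaded l (e (TmRight j)) = [::] by rewrite /loaded emb_regK (negbTE jl).
rewrite /load_tape; case: ltnP => j_lt; last first.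
  apply: (bigstep_eq (bigstep_nop _ _)); rewrite loadedE upd_id //.
  by rewrite emptyE /tape_input nth_default // -szE.
have src_in : nth t srcs j \in srcs by rewrite mem_nth.
have srcE : s (nth t srcs j) = map bit_sym (nth [::] ws j).
  by rewrite -(nth_map t [::] s) // srcs_ws (nth_map [::]) // -szE.
apply: bigstep_eq; first apply: bigstep_copy_map.
- exact: outside_neq (srcs_out src_in).
- by apply: contraNneq srcs_t => <-.
- by rewrite eq_sym outside_neq.
- by rewrite loaded_outside.
- by rewrite loaded_outside ?srcs_out // srcE size_map (leq_trans (size_nth_sumn _ _)).
by rewrite loadedE emptyE cats0 loaded_outside ?srcs_out // srcE -map_comp.
Qed.

Lemma bigstep_load_tapes l l' : uniq (l ++ l') ->
  bigstep B (seq_progs (load_tape srcs t) l) (loaded l') (loaded (rev l ++ l')).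
Proof.
elim: l l' => [|j l IH] l' //= /andP[jll' ll']; rewrite rev_cons cat_rcons.
have jl' : j \notin l' by apply: contra jll'; rewrite mem_cat orbC => ->.
apply: bigstep_seq (bigstep_load_tape jl') (IH _ _).
have /perm_uniq -> : perm_eq (l ++ j :: l') (j :: l ++ l') := permEl (perm_catCA l [:: j] l').
by rewrite /= jll'.
Qed.

Lemma bigstep_start_tm l : l =i 'I_k ->
  bigstep B start_tm (loaded l) (with_config (tm_init M ws) s).
Proof.
move=> l_all; apply/esym/eq_with_config => [r ro|m].
  by rewrite /do_ops (eqP ro) loaded_outside.
have rightE j : loaded l (e (TmRight j)) = tape_input j by rewrite /loaded emb_regK l_all.
have cellE j : tape_input j = map (emb_cell E) [seq Some (inl v) | v <- nth [::] ws j].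
  by rewrite -map_comp.
have emptyE m' : (if m' is TmRight _ then False else True) -> loaded l (e m') = [::].
  by rewrite /loaded emb_regK; case: m' => [[i|i]|[//|i]] _; rewrite without_config_reg.
rewrite /do_ops emb_regK; case: m => [[j|j]|[j|[]]] /=.
- by rewrite emptyE.
- by rewrite emptyE // ffunE rightE cellE cell_of_top_map.
- by rewrite rightE cellE behead_map.
- by rewrite emptyE.
Qed.

Lemma bigstep_init_tm : bigstep B (init_tm srcs t) s (with_config (tm_init M ws) s).
Proof.
apply: (bigstep_seq (bigstep_clear_tm sB)).
have -> : without_config s = loaded [::].
  apply: funext => r; rewrite /loaded; case rE : (emb_inv E r) => [[//|[j|//]]|//].
  by rewrite (emb_inv_some rE) without_config_reg.
apply: bigstep_seq (bigstep_load_tapes _) (bigstep_start_tm _); first by rewrite cats0 enum_uniq.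
by move=> j; rewrite cats0 mem_rev mem_enum.
Qed.

End Init.

Definition output_bit tp : option bool :=
  if tp (e (TmHead ord0)) is Some g
  then (if emb_cell_inv E g is Some (inl b) then Some b else None) else None.

Definition output_ops dst tp r : op G :=
  if r == dst then (if output_bit tp is Some b then Push (bit_sym b) else Keep)
  else if r == e (TmHead ord0) then Rep (emb_cell E (cell_of_top (tp (e (TmRight ord0)))))
  else if r == e (TmRight ord0) then Pop else Keep.

Definition read_output dst : prog := While (fun tp => output_bit tp : bool) (Do (output_ops dst)).

Lemma output_bit_with_config c s : output_bit (tops (with_config c s)) =
  if tape_head (cfg_tape c ord0) is Some (inl b) then Some b else None.
Proof. by rewrite /output_bit ffunE with_config_reg /= emb_cellK. Qed.

Definition pop_output c : config M :=
  Config (cfg_state c) (fun j => if j == ord0 then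
    let T := cfg_tape c ord0 in
    Tape (tape_left T) (head None (tape_right T)) (behead (tape_right T))
    else cfg_tape c j).

Lemma config_size_pop_output c D : config_size_le c D -> config_size_le (pop_output c) D.
Proof.
move=> cD [[j|j]|[j|[]]] /=.
- by case: eqP => [_|_]; [exact: cD (TmLeft ord0) | exact: cD (TmLeft j)].
- exact: cD (TmHead ord0).
- case: eqP => [_|_]; last exact: cD (TmRight j).
  by rewrite size_map size_behead; have := cD (TmRight ord0); rewrite /= size_map; lia.
- exact: cD TmState.
Qed.

Lemma output_ops_with_config dst c s b : outside dst ->
  tape_head (cfg_tape c ord0) = Some (inl b) ->
  do_ops (output_ops dst (tops (with_config c s))) (with_config c s) =
  with_config (pop_output c) s.[dst <- bit_sym b :: s dst].
Proof.
move=> dst_out headE; apply: eq_with_config => [r ro|m]; rewrite /do_ops /output_ops.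
  rewrite output_bit_with_config headE (negbTE (outside_neq _ ro)) (negbTE (outside_neq _ ro)).
  by rewrite /upd; case: eqP => [->|_]; rewrite with_config_outside.
rewrite eq_sym (negbTE (outside_neq _ dst_out)) !emb_reg_eq with_config_reg.
rewrite ffunE with_config_reg /= cell_of_top_map.
case: m => [[j|j]|[j|[]]] //=.
- by case: (j =P ord0) => [->|].
- have -> : (TmHead j == TmHead ord0 :> tm_reg M) = (j == ord0) by [].
  by case: (j =P ord0).
- have -> : (TmRight j == TmRight ord0 :> tm_reg M) = (j == ord0) by [].
  by case: (j =P ord0) => [->|//] /=; rewrite behead_map.
Qed.

Lemma bigstep_read_output B dst c s D : outside dst -> config_size_le c D -> D < B ->
  exists2 c', config_size_le c' D & bigstep B (read_output dst) (with_config c s)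
    (with_config c' s.[dst <- catrev (map bit_sym (tape_output (cfg_tape c ord0))) (s dst)]).
Proof.
move=> dst_out cD DB; set w := tape_output _.
suff [c' c'D iter_w] : exists2 c', config_size_le c' D & iterates (fun tp => output_bit tp : bool)
    (bigstep B (Do (output_ops dst))) (size w) (with_config c s)
    (with_config c' s.[dst <- catrev (map bit_sym w) (s dst)]).
  by exists c' => //; exists (size w) => //; exact: leq_trans (size_tape_output cD) DB.
move: (erefl w); rewrite {1}/w; move: w => w; elim: w c s cD => [|b w IH] c s cD.
  rewrite /tape_output => wE; exists c => //=; rewrite output_bit_with_config upd_id //.
  by case: (tape_head _) wE => [[]|].
rewrite {1}/tape_output; case headE : (tape_head _) => [[b'|//]|//] /= [b'b wE].
have [|c' c'D iter_w] :=
  IH (pop_output c) s.[dst <- bit_sym b :: s dst] (config_size_pop_output cD).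
  by rewrite -wE /tape_output /=; case: (tape_right _).
exists c' => //; rewrite output_bit_with_config headE; split=> //.
exists (with_config (pop_output c) s.[dst <- bit_sym b :: s dst]); split.
  by rewrite (output_ops_with_config s dst_out headE) b'b.
by move: iter_w; rewrite upd_same upd_upd.
Qed.

Definition call_with (run : prog) (srcs : seq Reg) t dst : prog :=
  init_tm srcs t ;; run ;; read_output dst ;; clear_tm.

Section Call.
Variables (srcs : seq Reg) (t dst : Reg) (ws : seq bits) (s : stacks) (B n : nat).
Hypotheses (t_out : outside t) (dst_out : outside dst) (st : s t = [::]).
Hypotheses (srcs_out : {in srcs, forall a, outside a}) (srcs_t : t \notin srcs).
Hypothesis srcs_ws : [seq s a | a <- srcs] = [seq map bit_sym w | w <- ws].
Hypothesis s_empty : forall m, s (e m) = [::].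
Hypothesis nB : (sumn [seq size w | w <- ws]).+1 + n < B.

Lemma bigstep_call_with (run : prog) (s' : stacks) :
  bigstep B run (with_config (tm_init M ws) s) (with_config (tm_run n (tm_init M ws)) s') ->
  (forall m, s' (e m) = [::]) ->
  bigstep B (call_with run srcs t dst) s s'.[dst <- catrev
    (map bit_sym (tape_output (cfg_tape (tm_run n (tm_init M ws)) ord0))) (s' dst)].
Proof.
move=> run_ok s'_empty; set c := tm_run n _ in run_ok *.
apply: bigstep_seq; first by apply: (bigstep_init_tm t_out st srcs_out srcs_t srcs_ws) => [m|];
  [rewrite s_empty | move: nB; lia].
apply: (bigstep_seq run_ok).
have [c' c'D read] := bigstep_read_output s' dst_out (config_size_computation n ws) nB.
apply: (bigstep_seq read); apply: bigstep_eq (bigstep_clear_tm _) _ => [m|].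
  by rewrite with_config_reg size_config_stack (leq_trans (c'D m)) // ltnW.
rewrite without_with_config without_config_id // => m.
by rewrite upd_other // eq_sym outside_neq.
Qed.

Definition call_tm : prog := call_with run_tm srcs t dst.

Lemma bigstep_call_tm out : tm_computes_in M n ws out ->
  bigstep B call_tm s s.[dst <- catrev (map bit_sym out) (s dst)].
Proof.
move=> [halted <-]; apply: bigstep_call_with => //.
by apply: bigstep_run_tm; rewrite // ltnW // (leq_ltn_trans _ nB) // leq_addl.
Qed.

Definition call_tm_clocked clock : prog := call_with (run_tm_clocked clock) srcs t dst.

Lemma bigstep_call_tm_clocked clock : outside clock -> clock != dst -> size (s clock) = n ->
  bigstep B (call_tm_clocked clock) s s.[clock <- [::]].[dst <- catrev
    (map bit_sym (tape_output (cfg_tape (tm_run n (tm_init M ws)) ord0))) (s dst)].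
Proof.
move=> clock_out clock_dst clockE; rewrite -[s dst](@upd_other _ _ s clock [::]);
  last by rewrite eq_sym.
apply: bigstep_call_with => [|m]; last by rewrite upd_other // eq_sym outside_neq.
rewrite -clockE; apply: bigstep_run_tm_clocked => //.
by rewrite clockE ltnW // (leq_ltn_trans _ nB) // leq_addl.
Qed.

End Call.
End Simulation.

(** * Binary numbers *)

Fixpoint nat_of_bits (u : bits) : nat := if u is b :: u' then b + (nat_of_bits u').*2 else 0.

Definition better (mx : bool) (v th : nat) : bool := if mx then th < v else v < th.

Definition compare_step (mx : bool) (a b fl : bool) : bool :=
  if a == b then fl else if mx then a else b.

Fixpoint compare_from (mx : bool) (k : nat) (v th : bits) (fl : bool) : bool :=
  if k is k'.+1 then
    compare_from mx k' (behead v) (behead th) (compare_step mx (head false v) (head false th) fl)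
  else fl.

Lemma nat_of_bits_behead u : nat_of_bits u = head false u + (nat_of_bits (behead u)).*2.
Proof. by case: u. Qed.

Lemma compare_fromE mx k v th fl : size v <= k -> size th <= k ->
  compare_from mx k v th fl =
  if nat_of_bits v == nat_of_bits th then fl else better mx (nat_of_bits v) (nat_of_bits th).
Proof.
elim: k v th fl => [|k IH] v th fl; first by case: v => //; case: th.
move=> hv ht; rewrite /= IH ?size_behead; try by lia.
rewrite (nat_of_bits_behead v) (nat_of_bits_behead th) /compare_step /better; clear IH hv ht.
move: (nat_of_bits (behead v)) (nat_of_bits (behead th)) => a b.
by case: (head false v); case: (head false th); case: mx; rewrite /=;
  case: (ltngtP a b) => h; case: eqP => h' //=; lia.
Qed.

Lemma nat_of_bits_nseq0 k u : nat_of_bits (nseq k false ++ u) = 2 ^ k * nat_of_bits u.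
Proof. by elim: k => [|k IH] /=; rewrite ?mul1n // IH expnS; lia. Qed.

Lemma nat_of_bits_drop k u : nat_of_bits (drop k u) = nat_of_bits u %/ 2 ^ k.
Proof.
elim: k u => [|k IH] u; first by rewrite drop0 divn1.
case: u => [|b u]; first by rewrite div0n.
rewrite /= IH expnS divnMA; congr (_ %/ _).
by rewrite -muln2 addnC divnMDl // divn_small ?addn0 //; case: b.
Qed.

Lemma nat_of_bits_lt u : nat_of_bits u < 2 ^ size u.
Proof. by elim: u => //= b u IH; rewrite expnS; case: b; lia. Qed.

Lemma nat_of_bits_incr u : nat_of_bits (incr u) = (nat_of_bits u).+1.
Proof. by elim: u => //= -[] u IH //=; rewrite ?IH; lia. Qed.

Definition canonical_bits (u : bits) := (u == [::]) || last false u.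

Lemma nat_of_bits_enc_nat n : nat_of_bits (enc_nat n) = n.
Proof.
rewrite /enc_nat -[RHS]bin_of_natK; case: (bin_of_nat n) => //= q.
elim: q => //= q ->; rewrite /= NatTrec.doubleE; lia.
Qed.

Lemma canonical_enc_nat n : canonical_bits (enc_nat n).
Proof.
rewrite /canonical_bits /enc_nat; case: (bin_of_nat n) => //= q; apply/orP; right.
have last_enc b r : last b (enc_pos r) = last false (enc_pos r).
  by elim: r b => //= r IH b; rewrite !(IH _).
by elim: q => //= q IH; rewrite last_enc.
Qed.

Lemma canonical_bits_inj u v : canonical_bits u -> canonical_bits v ->
  nat_of_bits u = nat_of_bits v -> u = v.
Proof.
have pos (b : bool) (u' : bits) : last b u' -> nat_of_bits (b :: u') != 0.
  elim: u' b => [|c u' IH] b; first by case: b.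
  by move=> /IH; rewrite /=; lia.
elim: u v => [|a u IH] [|b v] //.
- by move=> _ /= /(pos b v) /eqP + /esym.
- by move=> /= /(pos a u) /eqP.
rewrite /canonical_bits /= => ha hb E.
have ab : a = b by move: E; case: (a) (b) => -[]; lia.
rewrite ab; congr cons; apply: IH; last by move: E; rewrite ab; lia.
- by case: u ha {E} => //= c u; rewrite /canonical_bits.
- by case: v hb {E} => //= c u'; rewrite /canonical_bits.
Qed.

Lemma enc_natS n : enc_nat n.+1 = incr (enc_nat n).
Proof.
apply: canonical_bits_inj; first exact: canonical_enc_nat;
  last by rewrite nat_of_bits_incr !nat_of_bits_enc_nat.
have := canonical_enc_nat n; rewrite /canonical_bits.
have last_incr u : last false u -> last false (incr u).
  have last_incr_from b : last b u -> last false (incr u) || (u == [::]).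
    elim: u b => //= -[] u IH b.
      move=> u_last; have := IH true u_last; rewrite orbF => /orP[|/eqP -> //].
      by case: (incr u).
    by rewrite orbF => u_last; case: (u) u_last.
  by case: u last_incr_from => // a u from_last u_last; have := from_last a u_last; rewrite orbF.
by move=> /orP[/eqP -> //|/last_incr ->]; rewrite orbT.
Qed.

Lemma enc_nat_iter_incr n : enc_nat n = iter n incr [::].
Proof. by elim: n => // n IH; rewrite enc_natS IH. Qed.

Lemma size_incr u : size (incr u) <= (size u).+1.
Proof. by elim: u => //= -[] u IH. Qed.

Lemma size_enc_nat n : size (enc_nat n) <= n.
Proof. by rewrite enc_nat_iter_incr; elim: n => //= n IH; apply: leq_trans (size_incr _) _. Qed.

Lemma expn_size_enc_nat_le n : 0 < n -> 2 ^ size (enc_nat n) <= n.*2.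
Proof.
move=> n0; have := canonical_enc_nat n; rewrite /canonical_bits.
have : enc_nat n != [::].
  by apply/eqP => E; have := nat_of_bits_enc_nat n; rewrite E /=; lia.
move=> /negbTE -> /=; rewrite -[X in _ <= X.*2](nat_of_bits_enc_nat n).
elim: (enc_nat n) => // b u IH; case: u IH => [|c u] IH; first by case: b.
move=> /IH {}IH; have -> : size [:: b, c & u] = (size (c :: u)).+1 by [].
rewrite expnS; have -> : nat_of_bits [:: b, c & u] = b + (nat_of_bits (c :: u)).*2 by [].
by move: IH; move: (2 ^ _) (nat_of_bits _) => ? ?; case: b; lia.
Qed.

Lemma ltn_expn_size_enc_nat n : n < 2 ^ size (enc_nat n).
Proof. by have := nat_of_bits_lt (enc_nat n); rewrite nat_of_bits_enc_nat. Qed.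

(** * Arithmetic on stacks *)

Ltac simplify_upd := repeat match goal with
  | |- context [upd ?s ?r ?v ?r'] =>
      first [ rewrite (upd_same s r v) | rewrite (@upd_other _ _ s r v r' isT)
            | rewrite (@upd_other _ _ s r v r'); last by [] ]
  end.

Ltac simplify_eq_reg := repeat match goal with
  | |- context [?a == ?b] =>
      first [ rewrite (_ : (a == b) = false); last by [ | apply/negbTE]
            | rewrite (_ : (a == b) = true); last by [] ]
  end.

Ltac eq_stacks :=
  let q := fresh "q" in let E := fresh "E" in apply: funext => q; rewrite /upd;
  repeat match goal with
  | |- context [q == ?a] =>
      case: (q =P a) => [E|/eqP/negbTE E];
        [by rewrite ?E ?eqxx; simplify_eq_reg | rewrite ?E; clear E]
  end; try by [].

Ltac run L := eapply bigstep_seq; [apply: L => // |].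
Ltac run_last L := apply: bigstep_eq; [apply: L => // |].

Ltac distinct H := rewrite /= ?inE ?negb_or -?andbA in H;
  repeat (let h := fresh "neq" in let h' := fresh "neq" in
    case/andP: H => h H; have h' := h; rewrite eq_sym in h'); clear H.

Arguments bigstep : simpl never.

Definition vacant (Reg : Type) (G : Type) (s : Reg -> seq G) (rs : seq Reg) : Prop :=
  foldr (fun r => and (s r = [::])) True rs.

Lemma map_const (T U : Type) (c : U) (l : seq T) : [seq c | _ <- l] = nseq (size l) c.
Proof. by elim: l => //= a l ->. Qed.

Section Arithmetic.
Variables (Reg S : finType) (mark : (bool + S)%type).
Local Notation G := ((bool + S)%type : finType).
Local Notation stacks := (stacks Reg G).
Local Notation prog := (prog Reg G).
Local Notation tops_type := (tops_type Reg G).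
Local Notation "s .[ r <- v ]" := (upd s r v).
Local Notation bit_sym := (@bit_sym S).
Implicit Types (s : stacks) (a b c fl t : Reg) (B n m k : nat).

Definition unary n : seq G := nseq n mark.

Lemma size_unary n : size (unary n) = n.
Proof. exact: size_nseq. Qed.

Lemma unaryD n m : unary (n + m) = unary n ++ unary m.
Proof. exact: nseqD. Qed.

Lemma catrev_unary n m : catrev (unary n) (unary m) = unary (n + m).
Proof. by elim: n m => // n IH m; rewrite addSnnS -IH. Qed.

Lemma map_unary (l : seq G) : [seq mark | _ <- l] = unary (size l).
Proof. exact: map_const. Qed.

Definition multiply a b t1 t2 t3 : prog :=
  for_each b t3 (copy a t1 t2) ;; clear_stack a ;; transfer t1 a.

Lemma bigstep_multiply B s a b t1 t2 t3 n m : uniq [:: a; b; t1; t2; t3] ->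
  s a = unary n -> s b = unary m -> vacant s [:: t1; t2; t3] ->
  n <= B -> m <= B -> m * n <= B ->
  bigstep B (multiply a b t1 t2 t3) s s.[a <- unary (m * n)].
Proof.
move=> regs an bm [t1E [t2E [t3E _]]] nB mB mnB; distinct regs.
pose F i := s.[t1 <- unary (i * n)].
apply: (bigstep_seq (s1 := F m)).
  have {1}-> : s = F 0 by rewrite /F upd_id.
  have <- : F (size (unary m)) = F m by rewrite size_unary.
  apply: bigstep_for_each; rewrite ?size_unary // => i im.
    by rewrite /F; simplify_upd.
  rewrite /split_at /F; run_last bigstep_copy; simplify_upd; rewrite ?an ?size_unary //.
  by rewrite mulSn unaryD; eq_stacks.
rewrite /F; run bigstep_clear_stack; simplify_upd; rewrite ?an ?size_unary //.
run_last bigstep_transfer; simplify_upd; rewrite ?size_unary //.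
by rewrite catrevE cats0 rev_nseq; eq_stacks.
Qed.

Fixpoint raise a b t1 t2 t3 k : prog :=
  if k is k'.+1 then multiply a b t1 t2 t3 ;; raise a b t1 t2 t3 k' else nop.

Lemma bigstep_raise B s a b t1 t2 t3 n m k : uniq [:: a; b; t1; t2; t3] ->
  s a = unary n -> s b = unary m -> 0 < m -> vacant s [:: t1; t2; t3] ->
  m <= B -> m ^ k * n <= B ->
  bigstep B (raise a b t1 t2 t3 k) s s.[a <- unary (m ^ k * n)].
Proof.
move=> regs an bm m_gt0 empty mB; elim: k s n an bm empty => [|k IH] s n an bm empty mnB.
  by rewrite mul1n upd_id.
have mnB1 : m * n <= B.
  by apply: leq_trans mnB; rewrite expnS leq_mul2r leq_pmulr ?orbT // expn_gt0 m_gt0.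
have nB : n <= B by apply: leq_trans mnB1; rewrite leq_pmull.
apply: (bigstep_seq (bigstep_multiply regs an bm empty nB mB mnB1)).
have [[t1E [t2E [t3E _]]] regs'] := (empty, regs); distinct regs'.
have := IH s.[a <- unary (m * n)] (m * n); rewrite upd_upd /vacant /=; simplify_upd.
by rewrite expnSr -mulnA in mnB *; apply.
Qed.

Definition push_times a g k : prog := iter k (Seq (push a g)) nop.

Lemma bigstep_push_times B s a g k : bigstep B (push_times a g k) s s.[a <- nseq k g ++ s a].
Proof.
elim: k s => [|k IH] s; first by rewrite upd_id.
apply: (bigstep_seq (bigstep_act_on _ _ _ _)); apply: bigstep_eq (IH _) _.
by rewrite upd_upd upd_same -cat_rcons -[rcons _ _]cats1 -[[:: g]]/(nseq 1 g) -nseqD addn1.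
Qed.

Definition shift_left a c t1 t2 t3 : prog := for_each c t3 (copy a t1 t2 ;; transfer t1 a).

Lemma bigstep_shift_left B s a c t1 t2 t3 n : uniq [:: a; c; t1; t2; t3] ->
  s a = unary n -> vacant s [:: t1; t2; t3] -> size (s c) <= B -> n * 2 ^ size (s c) <= B ->
  bigstep B (shift_left a c t1 t2 t3) s s.[a <- unary (n * 2 ^ size (s c))].
Proof.
move=> regs an [t1E [t2E [t3E _]]] cB nB; distinct regs.
pose F i := s.[a <- unary (n * 2 ^ i)].
have {1}-> : s = F 0 by rewrite /F muln1 upd_id.
apply: bigstep_for_each => // i ic; first by rewrite /F; simplify_upd.
have iB : n * 2 ^ i <= B by apply: leq_trans nB; rewrite leq_mul2l leq_pexp2l ?orbT // ltnW.
rewrite /split_at /F; run bigstep_copy; simplify_upd; rewrite ?size_unary //.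
run_last bigstep_transfer; simplify_upd; rewrite ?size_cat ?size_unary ?t1E ?addn0 //.
rewrite cats0 catrev_unary;
  have -> : n * 2 ^ i + n * 2 ^ i = n * 2 ^ i.+1 by rewrite expnS mulnCA mul2n addnn.
by eq_stacks.
Qed.

Definition count_elements a a' c t : prog := for_each a a' (increment c t).

Lemma bigstep_count_elements B s a a' c t : uniq [:: a; a'; c; t] -> vacant s [:: a'; c; t] ->
  size (s a) <= B -> bigstep B (count_elements a a' c t) s
    s.[c <- map bit_sym (enc_nat (size (s a)))].
Proof.
move=> regs [a'E [cE [tE _]]] aB; distinct regs.
pose F i := s.[c <- map bit_sym (enc_nat i)].
have {1}-> : s = F 0 by rewrite /F upd_id.
apply: bigstep_for_each => // i ia; first by rewrite /F; simplify_upd.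
have szB : size (enc_nat i) <= B
  by rewrite (leq_trans (size_enc_nat i)) // (leq_trans _ aB) // ltnW.
apply: bigstep_eq; first by apply: (bigstep_increment (u := enc_nat i)); rewrite // /split_at /F;
  simplify_upd.
by rewrite -enc_natS /split_at /F; eq_stacks.
Qed.

Definition compare_top mx a b fl : tops_type -> Reg -> op G := fun tp r =>
  if (r == a) || (r == b) then Pop else
  if r == fl then Rep (bit_sym (compare_step mx (odflt false (sym_bit (tp a)))
                     (odflt false (sym_bit (tp b))) (odflt false (sym_bit (tp fl)))))
  else Keep.

Definition compare mx a b fl : prog :=
  While (fun tp => (tp a != None) || (tp b != None)) (Do (compare_top mx a b fl)).

Lemma bigstep_compare B s mx a b fl u v : uniq [:: a; b; fl] ->
  s a = map bit_sym u -> s b = map bit_sym v -> s fl = [:: bit_sym false] ->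
  size u <= B -> size v <= B ->
  bigstep B (compare mx a b fl) s
    s.[a <- [::]].[b <- [::]].[fl <- [:: bit_sym (better mx (nat_of_bits u) (nat_of_bits v))]].
Proof.
move=> regs au bv fl0 uB vB; distinct regs; set k := maxn (size u) (size v).
pose state w w' f := s.[a <- map bit_sym w].[b <- map bit_sym w'].[fl <- [:: bit_sym f]].
have {1}-> : s = state u v false by rewrite /state !upd_id ?upd_other // eq_sym.
have -> : better mx (nat_of_bits u) (nat_of_bits v) = compare_from mx k u v false.
  rewrite compare_fromE ?leq_maxl ?leq_maxr //; case: eqP => // ->.
  by rewrite /better ltnn if_same.
rewrite -[upd _ fl _]/(state [::] [::] _); exists k; first by rewrite geq_max uB vB.
have kE : k = maxn (size u) (size v) by []; clearbody k.
elim: k u v false kE {au bv uB vB} => [|k IH] u v f kE /=.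
  have [-> ->] : u = [::] /\ v = [::] by case: u v kE => [|? ?] [|? ?] //=; lia.
  by rewrite !ffunE /state; simplify_upd.
split.
  by rewrite !ffunE /state; simplify_upd; case: u v kE => [|? ?] [|? ?].
exists (state (behead u) (behead v) (compare_step mx (head false u) (head false v) f)); split;
  last first.
  by apply: IH; rewrite !size_behead; lia.
have sym_bit_head w : odflt false (sym_bit (ohead (map bit_sym w))) = head false w by case: w.
apply: funext => r; rewrite /do_ops /compare_top !ffunE /state; simplify_upd;
  rewrite !sym_bit_head /upd.
have [->|r_fl] := eqVneq r fl; first by simplify_eq_reg.
have [_|r_b] := eqVneq r b; first by rewrite orbT /= behead_map.
by have [_|//] := eqVneq r a; rewrite /= behead_map.
Qed.

End Arithmetic.

Arguments multiply {Reg S} a b t1 t2 t3.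
Arguments raise {Reg S} a b t1 t2 t3 k.
Arguments shift_left {Reg S} a c t1 t2 t3.
Arguments count_elements {Reg S} a a' c t.
Arguments compare {Reg S} mx a b fl.

(** * The machines of the reductions *)

(* A verifier of solutions, an evaluator of solutions and an approximation algorithm for a
   problem, together with the parameters of the reductions: the number of thresholds is
   [2 ^ ratio_exp] times a factor for the ratio, and the lengths of the solutions and of the
   computations are bounded by powers of the length of the input. *)
Record algorithms := Algorithms {
  verifier : tm;
  evaluator : tm;
  approximator : tm;
  maximizing : bool;
  ratio_exp : nat;
  word_exp : nat;
  time_exp : nat }.

Definition tm_alphabet (M : tm) : finType := (cell (tm_symbol M) + tm_state M)%type.

Section Registers.
Variable D : algorithms.

Definition host_symbol : finType :=
  (((index_info + column_info) + unit) +
   (tm_alphabet (verifier D) + (tm_alphabet (evaluator D) + tm_alphabet (approximator D))))%type.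
Definition host_char : finType := (bool + host_symbol)%type.

Definition host_work : finType :=
  ('I_37 + (tm_reg (verifier D) + (tm_reg (evaluator D) + tm_reg (approximator D))))%type.
Definition host_reg : finType := ('I_3 + host_work)%type.

Definition host_tape (r : host_reg) : 'I_(2 + #|host_work|).+1 :=
  unsplit (match r with inl i => inl i | inr r => inr (enum_rank r) end : 'I_3 + 'I_#|host_work|).
Definition tape_host (j : 'I_(2 + #|host_work|).+1) : host_reg :=
  match split (j : 'I_(3 + #|host_work|)) with inl i => inl i | inr i => inr (enum_val i) end.

Lemma host_tapeK : cancel host_tape tape_host.
Proof. by case=> [i|r]; rewrite /host_tape /tape_host unsplitK // enum_rankK. Qed.

Lemma tape_hostK : cancel tape_host host_tape.
Proof.
move=> j; have split_j := splitK (j : 'I_(3 + #|host_work|)); rewrite /host_tape /tape_host.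
by case: (split _) split_j => i ij; rewrite ?enum_valK; exact: ij.
Qed.

Definition io_reg (i : 'I_3) : host_reg := inl i.
Definition work_reg (i : 'I_37) : host_reg := inr (inl i).
Local Notation io_reg_of i := (io_reg (@Ordinal 3 i isT)).
Local Notation reg i := (work_reg (@Ordinal 37 i isT)).

(* Registers: instance [rInst], vertices [rPair], ratio [rRatio], candidate solution [rCand],
   threshold [rThr], value of the candidate [rVal], verdict [rVerdict], validity [rValid],
   unary sizes [rSide], [rWord] and [rLev], best solution [rBest] with its value [rBestVal];
   a primed register holds the part of a list that a loop has processed. *)
Definition rIn0 := io_reg_of 0.   Definition rIn1 := io_reg_of 1.   Definition rIn2 := io_reg_of 2.
Definition rInst := reg 0.        Definition rPair := reg 1.        Definition rRatio := reg 2.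
Definition rCand := reg 3.        Definition rThr := reg 4.         Definition rVal := reg 5.
Definition rVerdict := reg 6.     Definition rValid := reg 7.       Definition rTmp1 := reg 8.
Definition rTmp2 := reg 9.        Definition rTmp3 := reg 10.       Definition rTmp4 := reg 11.
Definition rTmp5 := reg 12.       Definition rSide := reg 13.       Definition rBase := reg 14.
Definition rWord := reg 15.       Definition rLev := reg 16.        Definition rLev' := reg 17.
Definition rTime := reg 18.       Definition rTime' := reg 19.      Definition rDepth := reg 20.
Definition rDepth' := reg 21.     Definition rLevCol := reg 22.     Definition rLevCol' := reg 23.
Definition rTimeCol := reg 24.    Definition rTimeCol' := reg 25.   Definition rDepthCol := reg 26.
Definition rDepthCol' := reg 27.  Definition rCount := reg 28.      Definition rBest := reg 29.
Definition rBestVal := reg 30.    Definition rFlags := reg 31.      Definition rFlagTrue := reg 32.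
Definition rFlagEnd := reg 33.    Definition rStop := reg 34.       Definition rUnary := reg 35.
Definition rQueue := reg 36.

Definition host_index (e : index_info) : host_char := inr (inl (inl (inl e))).
Definition host_column (e : column_info) : host_char := inr (inl (inl (inr e))).
Definition tick : host_char := inr (inl (inr tt)).

Definition verifier_embedding : embedding (verifier D) host_reg host_symbol.
Proof.
apply: (@Embedding _ host_reg host_symbol (fun m => inr (inr (inl m)))
  (fun r => if r is inr (inr (inl m)) then Some m else None)
  (fun c => inr (inr (inl (inl c)))) (fun g => if g is inr (inr (inl (inl c))) then c else None)
  (fun q => inr (inr (inl (inr q))))
  (fun g => if g is inr (inr (inl (inr q))) then q else tm_start _)) => //.
by case=> [|[|[]]].
Defined.

Definition evaluator_embedding : embedding (evaluator D) host_reg host_symbol.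
Proof.
apply: (@Embedding _ host_reg host_symbol (fun m => inr (inr (inr (inl m))))
  (fun r => if r is inr (inr (inr (inl m))) then Some m else None)
  (fun c => inr (inr (inr (inl (inl c)))))
  (fun g => if g is inr (inr (inr (inl (inl c)))) then c else None)
  (fun q => inr (inr (inr (inl (inr q)))))
  (fun g => if g is inr (inr (inr (inl (inr q)))) then q else tm_start _)) => //.
by case=> [|[|[|[]]]].
Defined.

Definition approximator_embedding : embedding (approximator D) host_reg host_symbol.
Proof.
apply: (@Embedding _ host_reg host_symbol (fun m => inr (inr (inr (inr m))))
  (fun r => if r is inr (inr (inr (inr m))) then Some m else None)
  (fun c => inr (inr (inr (inr (inl c)))))
  (fun g => if g is inr (inr (inr (inr (inl c)))) then c else None)
  (fun q => inr (inr (inr (inr (inr q)))))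
  (fun g => if g is inr (inr (inr (inr (inr q)))) then q else tm_start _)) => //.
by case=> [|[|[|[]]]].
Defined.

End Registers.

Arguments rIn0 {D}.       Arguments rIn1 {D}.       Arguments rIn2 {D}.
Arguments rInst {D}.      Arguments rPair {D}.      Arguments rRatio {D}.
Arguments rCand {D}.      Arguments rThr {D}.       Arguments rVal {D}.
Arguments rVerdict {D}.   Arguments rValid {D}.     Arguments rTmp1 {D}.
Arguments rTmp2 {D}.      Arguments rTmp3 {D}.      Arguments rTmp4 {D}.
Arguments rTmp5 {D}.      Arguments rSide {D}.      Arguments rBase {D}.
Arguments rWord {D}.      Arguments rLev {D}.       Arguments rLev' {D}.
Arguments rTime {D}.      Arguments rTime' {D}.     Arguments rDepth {D}.
Arguments rDepth' {D}.    Arguments rLevCol {D}.    Arguments rLevCol' {D}.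
Arguments rTimeCol {D}.   Arguments rTimeCol' {D}.  Arguments rDepthCol {D}.
Arguments rDepthCol' {D}. Arguments rCount {D}.     Arguments rBest {D}.
Arguments rBestVal {D}.   Arguments rFlags {D}.     Arguments rFlagTrue {D}.
Arguments rFlagEnd {D}.   Arguments rStop {D}.      Arguments rUnary {D}.
Arguments rQueue {D}.     Arguments tick {D}.       Arguments host_index {D} e.
Arguments host_column {D} e.

Section Check.
Variable D : algorithms.
Local Notation host_reg := (host_reg D).
Local Notation host_symbol := (host_symbol D).
Local Notation host_char := (host_char D).
Local Notation prog := (prog host_reg host_char).
Local Notation stacks := (stacks host_reg host_char).
Local Notation "s .[ r <- v ]" := (upd s r v).
Local Notation bit_sym := (@bit_sym host_symbol).
Implicit Types (s : stacks) (x w v th r : bits) (B t : nat).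

Definition machines_empty s := forall m, s (inr (inr m)) = [::].

Definition decided_in t x w (valid : bool) v : Prop :=
  tm_computes_in (verifier D) t [:: x; w] [:: valid] /\
  (valid -> tm_computes_in (evaluator D) t [:: x; w] v).

Lemma size_decided_value t x w v : decided_in t x w true v -> size v <= size x + size w + t + 2.
Proof. by move=> [_ /(_ isT) /size_computes] /=; rewrite addn0. Qed.

Definition check : prog :=
  call_tm (verifier_embedding D) [:: rInst; rCand] rTmp1 rValid ;;
  If (fun tp => tp rValid == Some (bit_sym true))
    (call_tm (evaluator_embedding D) [:: rInst; rCand] rTmp1 rTmp2 ;;
     transfer rTmp2 rVal ;;
     copy rVal rTmp2 rTmp1 ;;
     copy rThr rTmp3 rTmp1 ;;
     push rVerdict (bit_sym false) ;;
     compare (maximizing D) rTmp2 rTmp3 rVerdict)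
    (push rVerdict (bit_sym false)).

Definition checked s (valid : bool) v th : stacks :=
  s.[rValid <- [:: bit_sym valid]].[rVal <- if valid then map bit_sym v else [::]]
   .[rVerdict <- [:: bit_sym (valid && better (maximizing D) (nat_of_bits v) (nat_of_bits th))]].

Lemma bigstep_check B s x w th (valid : bool) v t :
  s rInst = map bit_sym x -> s rCand = map bit_sym w -> s rThr = map bit_sym th ->
  vacant s [:: rTmp1; rTmp2; rTmp3; rVerdict; rValid; rVal] -> machines_empty s ->
  decided_in t x w valid v -> size th <= B -> size x + size w + t + 2 < B ->
  bigstep B check s (checked s valid v th).
Proof.
move=> xE wE thE [t1E [t2E [t3E [verdictE [validE [valE _]]]]]] mE dec thB tB.
have [ver eval] := dec.
have srcs_out M (E : embedding M host_reg host_symbol) : outside E rInst -> outside E rCand ->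
  {in [:: rInst; rCand], forall a, outside E a} by move=> ? ? a; rewrite !inE => /orP[]/eqP->.
eapply bigstep_seq; first apply: (bigstep_call_tm (ws := [:: x; w]) _ _ _ _ _ _ _ _ ver) => //=.
- exact: srcs_out.
- by rewrite xE wE.
- by lia.
rewrite validE; apply: bigstep_if; rewrite ffunE upd_same /=.
case: valid dec {ver} eval => dec eval /=; last first.
  by run_last bigstep_act_on; rewrite /checked /=; simplify_upd; rewrite verdictE; eq_stacks.
have {}eval := eval isT; have vB := size_decided_value dec.
eapply bigstep_seq; first apply: (bigstep_call_tm (ws := [:: x; w]) _ _ _ _ _ _ _ _ eval) => //=.
- exact: srcs_out.
- by simplify_upd; rewrite xE wE.
- by move=> m; simplify_upd; exact: mE.
- by lia.
run bigstep_transfer; simplify_upd; rewrite t2E catrevE cats0 ?size_rev ?size_map; first by lia.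
run bigstep_copy; simplify_upd; rewrite ?valE ?catrevE ?cats0 ?revK ?size_map //; first by lia.
run bigstep_copy; simplify_upd; rewrite ?thE ?size_map //.
run bigstep_act_on; simplify_upd; rewrite t3E cats0 verdictE /=.
apply: bigstep_eq; first apply: (@bigstep_compare _ _ B _ _ _ _ _ v th); simplify_upd => //;
  first by lia.
by rewrite /checked; eq_stacks.
Qed.

End Check.

(** * Preparation: sizes and a first solution *)

Section Prepare.
Variable D : algorithms.
Local Notation host_reg := (host_reg D).
Local Notation host_symbol := (host_symbol D).
Local Notation host_char := (host_char D).
Local Notation prog := (prog host_reg host_char).
Local Notation stacks := (stacks host_reg host_char).
Local Notation "s .[ r <- v ]" := (upd s r v).
Local Notation bit_sym := (@bit_sym host_symbol).
Local Notation ticks := (unary tick).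
Implicit Types (s : stacks) (x w v r : bits) (y : seq host_char) (B t : nat).

Definition base_size x r := size x + size r + 2.
Definition grid_side x r := base_size x r ^ time_exp D.
Definition word_bound x r := base_size x r ^ word_exp D.
Definition level_count r := 2 ^ (ratio_exp D + size r).

Definition ample B x r t : Prop :=
  [/\ 2 * size x + grid_side x r + t + 4 < B, base_size x r <= B,
      word_bound x r <= B & level_count r <= B].

Definition compute_sizes : prog :=
  copy_map rInst rBase rTmp1 (fun _ => tick) ;;
  copy_map rRatio rBase rTmp1 (fun _ => tick) ;;
  push_times rBase tick 2 ;;
  push rSide tick ;; raise rSide rBase rTmp1 rTmp2 rTmp3 (word_exp D) ;; transfer rSide rWord ;;
  push rSide tick ;; raise rSide rBase rTmp1 rTmp2 rTmp3 (time_exp D) ;;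
  push_times rLev tick (2 ^ ratio_exp D) ;; shift_left rLev rRatio rTmp1 rTmp2 rTmp3.

Definition with_sizes s x r : stacks :=
  s.[rBase <- ticks (base_size x r)].[rSide <- ticks (grid_side x r)]
   .[rWord <- ticks (word_bound x r)].[rLev <- ticks (level_count r)].

Lemma bigstep_compute_sizes B s x r t : s rInst = map bit_sym x -> s rRatio = map bit_sym r ->
  vacant s [:: rTmp1; rTmp2; rTmp3; rBase; rSide; rWord; rLev] -> ample B x r t ->
  bigstep B compute_sizes s (with_sizes s x r).
Proof.
move=> xE rE [t1E [t2E [t3E [baseE [sideE [wordE [levE _]]]]]]] [gridB sB wB lB].
have base_gt0 : 0 < base_size x r by rewrite /base_size addn2.
have baseE' : base_size x r = 2 + (size r + size x) by rewrite /base_size; lia.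
have [xB rB] : size x <= B /\ size r <= B by move: sB; rewrite /base_size; lia.
have gB : grid_side x r <= B by lia.
run bigstep_copy_map; rewrite ?xE ?size_map // map_unary size_map baseE cats0.
run bigstep_copy_map; simplify_upd; rewrite ?rE ?size_map // map_unary size_map -unaryD upd_upd.
eapply bigstep_seq; first exact: bigstep_push_times.
rewrite upd_upd upd_same -[nseq 2 _]/(ticks 2) -unaryD -baseE'.
run bigstep_act_on; simplify_upd; rewrite sideE -[apply_op _ _]/(ticks 1).
eapply bigstep_seq; first by apply: (@bigstep_raise _ _ _ B _ _ _ _ _ _ 1 (base_size x r)) => //;
  rewrite ?muln1 // /vacant /=; simplify_upd.
rewrite muln1 upd_upd -/(word_bound x r).
run bigstep_transfer; simplify_upd; rewrite ?size_unary // upd_upd wordE catrevE cats0 rev_nseq.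
run bigstep_act_on; simplify_upd; rewrite -[apply_op _ _]/(ticks 1).
eapply bigstep_seq; first by apply: (@bigstep_raise _ _ _ B _ _ _ _ _ _ 1 (base_size x r)) => //;
  rewrite ?muln1 // /vacant /=; simplify_upd.
rewrite muln1 upd_upd -/(grid_side x r).
eapply bigstep_seq; first exact: bigstep_push_times.
simplify_upd; rewrite levE cats0.
apply: bigstep_eq; first
  by apply: (@bigstep_shift_left _ _ tick B _ _ _ _ _ _ (2 ^ ratio_exp D)) => //;
  rewrite /vacant /=; simplify_upd; rewrite ?rE ?size_map // -expnD.
by simplify_upd; rewrite rE size_map -expnD -/(level_count r) /with_sizes; eq_stacks.
Qed.

(* The approximation algorithm is run with a clock, as it need not halt when there is
   no solution. *)
Definition approximate : prog :=
  copy rSide rTmp2 rTmp1 ;;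
  call_tm_clocked (approximator_embedding D) [:: rInst] rTmp1 rTmp3 rTmp2 ;;
  transfer rTmp3 rCand.

Definition start_word x r : bits :=
  tape_output (cfg_tape (tm_run (grid_side x r) (tm_init (approximator D) [:: x])) ord0).

Lemma size_start_word x r : size (start_word x r) <= size x + grid_side x r + 2.
Proof.
have := size_tape_output (@config_size_computation (approximator D) (grid_side x r) [:: x]).
by rewrite /= addn0 -/(start_word x r); lia.
Qed.

Lemma bigstep_approximate B s x r t : s rInst = map bit_sym x -> s rSide = ticks (grid_side x r) ->
  vacant s [:: rTmp1; rTmp2; rTmp3; rCand] -> machines_empty s -> ample B x r t ->
  bigstep B approximate s s.[rCand <- map bit_sym (start_word x r)].
Proof.
move=> xE sideE [t1E [t2E [t3E [candE _]]]] mE [gridB _ _ _]; have := size_start_word x r => startB.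
run bigstep_copy; rewrite sideE ?size_unary; first by lia.
rewrite t2E cats0; eapply bigstep_seq.
  apply: (bigstep_call_tm_clocked (ws := [:: x]) (n := grid_side x r)) => //=.
  - by move=> a; rewrite inE => /eqP->.
  - by simplify_upd; rewrite xE.
  - by move=> m; simplify_upd; exact: mE.
  - by rewrite addn0; lia.
  - by simplify_upd; rewrite size_unary.
rewrite -/(start_word x r) upd_upd; run_last bigstep_transfer; simplify_upd.
  by rewrite t3E catrevE cats0 size_rev size_map; lia.
by rewrite t3E candE !catrevE !cats0 revK; eq_stacks.
Qed.

Definition evaluate_start : prog :=
  check D ;; clear_stack rVerdict ;; copy rCand rBest rTmp1 ;; clear_stack rCand ;;
  copy rVal rBestVal rTmp1 ;; clear_stack rVal.

Lemma bigstep_evaluate_start B s x w (valid : bool) v t :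
  s rInst = map bit_sym x -> s rCand = map bit_sym w ->
  vacant s [:: rTmp1; rTmp2; rTmp3; rThr; rVerdict; rValid; rVal; rBest; rBestVal] ->
  machines_empty s -> decided_in D t x w valid v -> size x + size w + t + 2 < B ->
  bigstep B evaluate_start s
    s.[rCand <- [::]].[rValid <- [:: bit_sym valid]].[rBest <- map bit_sym w]
     .[rBestVal <- if valid then map bit_sym v else [::]].
Proof.
move=> xE candE [t1E [t2E [t3E [thrE [verdictE [validE [valE [bestE [bestvE _]]]]]]]]] mE dec tB.
eapply bigstep_seq; first by apply: (bigstep_check (th := [::]) xE candE thrE _ mE dec).
have vB : size (if valid then map bit_sym v else [::]) <= B.
  by case: valid dec => // /size_decided_value; rewrite size_map; lia.
rewrite /checked; run bigstep_clear_stack; simplify_upd; first by rewrite /=; lia.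
rewrite upd_upd; run bigstep_copy; simplify_upd; rewrite ?candE ?size_map //; first by lia.
rewrite bestE cats0; run bigstep_clear_stack; simplify_upd; rewrite ?candE ?size_map //;
  first by lia.
run bigstep_copy; simplify_upd => //.
by rewrite bestvE cats0; run_last bigstep_clear_stack; simplify_upd => //; eq_stacks.
Qed.

Definition prepare : prog := compute_sizes ;; approximate ;; evaluate_start.

Definition inputs x r y : stacks :=
  (fun _ => [::]).[rInst <- map bit_sym x].[rPair <- y].[rRatio <- map bit_sym r].

Definition prepared x r y (valid : bool) v : stacks :=
  (with_sizes (inputs x r y) x r).[rValid <- [:: bit_sym valid]]
    .[rBest <- map bit_sym (start_word x r)].[rBestVal <- if valid then map bit_sym v else [::]].

Lemma bigstep_prepare B x r y (valid : bool) v t :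
  decided_in D t x (start_word x r) valid v -> ample B x r t ->
  bigstep B prepare (inputs x r y) (prepared x r y valid v).
Proof.
move=> dec room; have [gridB _ _ _] := room; have startB := size_start_word x r.
eapply bigstep_seq; first by apply: (bigstep_compute_sizes _ _ _ room).
eapply bigstep_seq; first by apply: (bigstep_approximate _ _ _ _ room).
apply: bigstep_eq; first by apply: (bigstep_evaluate_start _ _ _ _ dec) => //; lia.
by rewrite /prepared; eq_stacks.
Qed.

End Prepare.

(** * Row and column data of the inequality system *)

(* [floor ((l + 1) * 2 ^ |v| / 2 ^ |r|)], least significant bit first. *)
Definition threshold (l : nat) (r v : bits) : bits :=
  drop (size r) (nseq (size v) false ++ enc_nat l.+1).

Lemma map_iota_const (T : Type) (f : nat -> T) c m k :
  (forall i, m <= i < m + k -> f i = c) -> [seq f i | i <- iota m k] = nseq k c.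
Proof.
elim: k m => //= k IH m fc; rewrite fc ?IH //; last by rewrite leqnn addnS ltnS leq_addr.
by move=> i /andP[mi ik]; rewrite fc // ltnW //= addnS -addSn.
Qed.

Lemma iota_rcons m n : iota m n.+1 = rcons (iota m n) (m + n).
Proof. by rewrite -cats1 -[[:: m + n]]/(iota (m + n) 1) -iotaD addn1. Qed.

Lemma ohead_rev_take (T : Type) (g : nat -> T) n i : i < n ->
  ohead (rev (take i.+1 [seq g j | j <- iota 0 n])) = Some (g i).
Proof.
move=> i_n; have i_size : i < size [seq g j | j <- iota 0 n] by rewrite size_map size_iota.
by rewrite (take_nth (g 0) i_size) rev_rcons /= (nth_map 0) ?size_iota // nth_iota.
Qed.

Section Rows.
Variable D : algorithms.
Local Notation host_reg := (host_reg D).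
Local Notation host_symbol := (host_symbol D).
Local Notation host_char := (host_char D).
Local Notation prog := (prog host_reg host_char).
Local Notation stacks := (stacks host_reg host_char).
Local Notation "s .[ r <- v ]" := (upd s r v).
Local Notation bit_sym := (@bit_sym host_symbol).
Local Notation ticks := (unary tick).
Implicit Types (s : stacks) (x v th r : bits) (B N n nw l i t : nat).

Definition load_threshold : prog :=
  count_elements rLev' rTmp3 rThr rTmp1 ;;
  copy_map rBestVal rThr rTmp1 (fun _ => bit_sym false) ;;
  for_each rRatio rTmp3 (pop rThr).

Lemma bigstep_load_threshold B s l r v :
  size (s rLev') = l.+1 -> s rBestVal = map bit_sym v -> s rRatio = map bit_sym r ->
  vacant s [:: rThr; rTmp1; rTmp3] -> l < B -> size v <= B -> size r <= B ->
  bigstep B load_threshold s s.[rThr <- map bit_sym (threshold l r v)].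
Proof.
move=> levE vE rE [thrE [t1E [t3E _]]] lB vB rB.
eapply bigstep_seq; first by apply: bigstep_count_elements; rewrite ?levE.
run bigstep_copy_map; simplify_upd; rewrite ?vE ?size_map // upd_upd levE.
have -> : map (fun _ => bit_sym false) (map bit_sym v) = map bit_sym (nseq (size v) false).
  by rewrite map_const size_map map_nseq.
rewrite -map_cat; set u := nseq _ _ ++ _; pose F i := s.[rThr <- map bit_sym (drop i u)].
have -> : s.[rThr <- map bit_sym u] = F 0 by rewrite /F drop0.
have -> : s.[rThr <- map bit_sym (threshold l r v)] = F (size (map bit_sym r))
  by rewrite /F size_map.
apply: bigstep_for_each; rewrite ?size_map // => i ir.
rewrite /split_at /F; run_last bigstep_act_on; simplify_upd.
by rewrite /apply_op behead_map -drop1 drop_drop add1n; eq_stacks.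
Qed.

Definition index_of_top (g : option host_char) : index_info :=
  if g is Some (inr (inl (inl (inl e)))) then e else (false, false, None, None, false).

Definition column_of_top (g : option host_char) : column_info :=
  if g is Some (inr (inl (inl (inr e)))) then e else (false, false, false).

Definition push_index : tops_type host_reg host_char -> host_reg -> op host_char := fun tp q =>
  if q \in [:: rTmp2; rTmp3; rTmp4; rTmp5] then Pop else
  if q == rTime then Push (host_index (tp rTime == None, false, sym_bit (tp rTmp3),
                                       sym_bit (tp rTmp4), tp rTmp5 != None)) else Keep.

(* Only the last position has a true second component. *)
Definition build_indices : prog :=
  copy rSide rTmp2 rTmp1 ;; copy rInst rTmp3 rTmp1 ;; copy rThr rTmp4 rTmp1 ;;
  copy rWord rTmp5 rTmp1 ;;
  While (nonempty rTmp2) (Do push_index) ;;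
  act_on rTime (fun tp => Rep (host_index (let e := index_of_top (tp rTime) in
    (info_first e, true, info_x e, info_th e, info_w e)))) ;;
  transfer rTime rDepth ;; copy rDepth rTime rTmp1.

Definition index_list N nw x th : seq host_char :=
  [seq host_index (depth_info N nw x th i) | i <- iota 0 N.+1].

Lemma size_index_list N nw x th : size (index_list N nw x th) = N.+1.
Proof. by rewrite size_map size_iota. Qed.

Definition open_index nw x th i : host_char :=
  host_index (i == 0, false, onth x i, onth th i, i < nw).

Lemma close_index_list N nw x th :
  host_index (N == 0, true, onth x N, onth th N, N < nw) ::
    behead (rev [seq open_index nw x th i | i <- iota 0 N.+1]) = rev (index_list N nw x th).
Proof.
rewrite /index_list iota_rcons !map_rcons !rev_rcons /= add0n; congr (_ :: _).
  by rewrite /depth_info eqxx.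
congr rev; apply/eq_in_map => i; rewrite mem_iota add0n => /andP[_ iN].
by rewrite /open_index /depth_info (ltn_eqF iN).
Qed.

Lemma map_drop_behead i (u : bits) : map bit_sym (drop i.+1 u) = behead (map bit_sym (drop i u)).
Proof. by rewrite behead_map -drop1 drop_drop add1n. Qed.

Lemma ticks_behead m i : ticks (m - i.+1) = behead (ticks (m - i) : seq host_char).
Proof. by rewrite subnS; case: (m - i). Qed.

Lemma bigstep_push_indices B s n nw x th :
  s rTmp2 = ticks n -> s rTmp3 = map bit_sym x -> s rTmp4 = map bit_sym th -> s rTmp5 = ticks nw ->
  s rTime = [::] -> size x <= n -> size th <= n -> nw <= n -> n <= B ->
  bigstep B (While (nonempty rTmp2) (Do push_index)) s
    s.[rTmp2 <- [::]].[rTmp3 <- [::]].[rTmp4 <- [::]].[rTmp5 <- [::]]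
     .[rTime <- rev [seq open_index nw x th i | i <- iota 0 n]].
Proof.
move=> t2E t3E t4E t5E timeE xn thn nwn nB.
pose F i := s.[rTmp2 <- ticks (n - i)].[rTmp3 <- map bit_sym (drop i x)]
  .[rTmp4 <- map bit_sym (drop i th)].[rTmp5 <- ticks (nw - i)]
  .[rTime <- rev [seq open_index nw x th j | j <- iota 0 i]].
have {1}-> : s = F 0 by rewrite /F !drop0 !subn0; eq_stacks.
set s' := (X in bigstep _ _ _ X).
have -> : s' = F n by rewrite /F !drop_oversize // subnn (eqP nwn).
apply: bigstep_while => // [i i_n|]; last by rewrite nonempty_tops /F; simplify_upd; rewrite subnn.
have sym_bit_drop (u : bits) : sym_bit (ohead (map bit_sym (drop i u))) = onth u i.
  by elim: (u) (i) => [|b u' IH] [|j] //=.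
split; first by rewrite nonempty_tops /F; simplify_upd;
  rewrite -size_eq0 size_unary subn_eq0 -ltnNge.
rewrite /bigstep; apply: funext => q; rewrite /do_ops /push_index !ffunE /F; simplify_upd.
rewrite !sym_bit_drop !map_drop_behead iota_rcons map_rcons rev_rcons !ticks_behead.
have -> : (ohead (ticks (nw - i)) != None) = (i < nw) by rewrite -subn_gt0; case: (nw - i).
have -> : (ohead (rev [seq open_index nw x th j | j <- iota 0 i]) == None) = (i == 0).
  by case: (i) => // j; rewrite iota_rcons map_rcons rev_rcons.
rewrite /upd !inE.
have [->|_] := eqVneq q rTime; first by simplify_eq_reg.
have [_|_] := eqVneq q rTmp5; first by rewrite !orbT.
have [_|_] := eqVneq q rTmp4; first by rewrite !orbT.
have [_|_] := eqVneq q rTmp3; first by rewrite !orbT.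
by have [_|_] := eqVneq q rTmp2.
Qed.

Lemma bigstep_build_indices B s N nw x th :
  s rSide = ticks N.+1 -> s rInst = map bit_sym x -> s rThr = map bit_sym th ->
    s rWord = ticks nw ->
  vacant s [:: rTime; rDepth; rTmp1; rTmp2; rTmp3; rTmp4; rTmp5] ->
  size x <= N.+1 -> size th <= N.+1 -> nw <= N.+1 -> N < B ->
  bigstep B build_indices s s.[rDepth <- index_list N nw x th].[rTime <- index_list N nw x th].
Proof.
move=> sideE xE thE wordE [timeE [depthE [t1E [t2E [t3E [t4E [t5E _]]]]]]] xN thN nwN NB.
run bigstep_copy; rewrite ?sideE ?size_unary // t2E cats0.
run bigstep_copy; simplify_upd; rewrite ?xE ?size_map //; first by lia.
rewrite t3E cats0; run bigstep_copy; simplify_upd; rewrite ?thE ?size_map //; first by lia.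
rewrite t4E cats0; run bigstep_copy; simplify_upd; rewrite ?wordE ?size_unary //; first by lia.
rewrite t5E cats0.
eapply bigstep_seq; first by apply: (@bigstep_push_indices B _ N.+1 nw x th); simplify_upd.
have topE : ohead (rev [seq open_index nw x th i | i <- iota 0 N.+1]) = Some (open_index nw x th N).
  by rewrite iota_rcons map_rcons rev_rcons.
run bigstep_act_on; simplify_upd; rewrite upd_upd ffunE; simplify_upd.
rewrite topE -[apply_op _ _]/(host_index _ :: behead _) close_index_list.
run bigstep_transfer; simplify_upd; first by rewrite size_rev size_index_list.
rewrite depthE catrevE cats0 revK; run_last bigstep_copy; simplify_upd => //.
  by rewrite size_index_list.
by rewrite cats0; eq_stacks.
Qed.

Definition column_other : host_char := host_column (false, false, false).
Definition column_here : host_char := host_column (false, true, false).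
Definition column_next : host_char := host_column (false, false, true).

Definition column_list n t : seq host_char := [seq host_column (column_of t i) | i <- iota 0 n].

Lemma size_column_list n t : size (column_list n t) = n.
Proof. by rewrite size_map size_iota. Qed.

Definition next_columns k : seq host_char :=
  if nseq k column_other is _ :: u then column_next :: u else [::].

Definition close_columns (u : seq host_char) : seq host_char :=
  host_column (let e := column_of_top (ohead u) in (true, e.1.2, e.2)) :: behead u.

Lemma close_columnsE n t : t < n ->
  close_columns (nseq t column_other ++ column_here :: next_columns (n - t.+1)) = column_list n t.
Proof.
move=> tn; pose open_column i : host_char := host_column (false, i == t, i == t.+1).
have -> : nseq t column_other ++ column_here :: next_columns (n - t.+1) =
    [seq open_column i | i <- iota 0 n].
  rewrite -{2}(subnKC tn) iotaD iota_rcons map_cat map_rcons cat_rcons add0n; congr (_ ++ _ :: _).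
  - rewrite (@map_iota_const _ _ column_other) // => i i_t.
    by rewrite /open_column !ltn_eqF //; lia.
  - by rewrite /open_column eqxx ltn_eqF.
  - case: (n - t.+1) => [|k] //=; rewrite (@map_iota_const _ _ column_other) => [|i i_t].
      by rewrite /open_column eqxx gtn_eqF.
    by rewrite /open_column !gtn_eqF //; lia.
case: n tn => // n _; rewrite /close_columns /column_list /= /open_column /column_of /=.
by congr (_ :: _); apply/eq_in_map => i; rewrite mem_iota; case: i.
Qed.

Definition move_top (a b : host_reg) : prog := Do (fun tp q =>
  if q == a then Pop else
  if q == b then (if tp a is Some g then Push g else Keep) else Keep).

Lemma bigstep_move_top B s (a b : host_reg) g u : a != b -> s a = g :: u ->
  bigstep B (move_top a b) s s.[a <- u].[b <- g :: s b].
Proof.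
move=> ab aE; rewrite /bigstep; apply: funext => q; rewrite /do_ops !ffunE aE /upd.
have [->|_] := eqVneq q a; first by rewrite (negbTE ab) aE.
by have [->|] := eqVneq q b.
Qed.

(* Inside a loop with remaining part [a] and processed part [a'], [dst] becomes the
   list of the positions of all list elements relative to the current one. *)
Definition mark_columns (dst a a' t1 t2 : host_reg) : prog :=
  copy_map a dst t1 (fun _ => column_other) ;;
  act_on dst (fun tp => if tp dst is Some _ then Rep column_next else Keep) ;;
  push dst column_here ;;
  move_top a' t2 ;; copy_map a' dst t1 (fun _ => column_other) ;; move_top t2 a' ;;
  act_on dst (fun tp => Rep (host_column (let e := column_of_top (tp dst) in (true, e.1.2, e.2)))).

Lemma bigstep_mark_columns B s (dst a a' t1 t2 : host_reg) (xs : seq host_char) t :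
  uniq [:: dst; a; a'; t1; t2] -> t < size xs ->
  s a = drop t.+1 xs -> s a' = rev (take t.+1 xs) -> vacant s [:: dst; t1; t2] -> size xs <= B ->
  bigstep B (mark_columns dst a a' t1 t2) s s.[dst <- column_list (size xs) t].
Proof.
move=> regs tn aE a'E [dstE [t1E [t2E _]]] xB.
have aB : size (s a) <= B by rewrite aE size_drop; lia.
have a'B : size (rev (take t xs)) <= B by rewrite size_rev size_takel; lia.
distinct regs.
have [g gE] : exists g, rev (take t.+1 xs) = g :: rev (take t xs).
  by case: (xs) tn => // x0 u tn; exists (nth x0 (x0 :: u) t); rewrite (take_nth x0 tn) rev_rcons.
run bigstep_copy_map; rewrite map_const aE size_drop dstE cats0.
run bigstep_act_on; rewrite upd_upd ffunE upd_same.
have -> : apply_op (if ohead (nseq (size xs - t.+1) column_other) is Some _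
    then Rep column_next else Keep) (nseq (size xs - t.+1) column_other) =
    next_columns (size xs - t.+1).
  by rewrite /next_columns; case: (nseq _ _).
run bigstep_act_on; rewrite upd_upd upd_same [apply_op _ _]/=.
eapply bigstep_seq; first by apply: bigstep_move_top; simplify_upd; rewrite ?a'E ?gE.
run bigstep_copy_map; simplify_upd => //.
rewrite map_const size_rev size_takel; last exact: ltnW.
eapply bigstep_seq; first by apply: (@bigstep_move_top _ _ _ _ g (s t2)); simplify_upd.
run_last bigstep_act_on; simplify_upd; rewrite ffunE; simplify_upd.
rewrite -[apply_op _ _]/(close_columns _) close_columnsE //.
rewrite -gE -a'E t2E; eq_stacks.
Qed.

End Rows.

(** * Printing the polytope *)

Definition escape (w : bits) : bits := flatten [seq [:: true; b] | b <- w].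

Lemma delimitE w : delimit w = escape w ++ [:: false].
Proof. by elim: w => //= b w ->. Qed.

Lemma escape_cat u v : escape (u ++ v) = escape u ++ escape v.
Proof. by rewrite /escape map_cat flatten_cat. Qed.

Lemma escape_flatten (ss : seq bits) : escape (flatten ss) = flatten [seq escape u | u <- ss].
Proof. by elim: ss => //= u ss <-; rewrite escape_cat. Qed.

Lemma size_flatten_const (T : Type) (f : T -> bits) l q :
  (forall a, size (f a) = q) -> size (flatten [seq f a | a <- l]) = size l * q.
Proof. by move=> fq; elim: l => //= a l IH; rewrite size_cat fq IH mulSn. Qed.

Definition grid_word (L n : nat) (wd : nat -> nat -> nat -> bits) : bits :=
  flatten [seq flatten [seq flatten [seq wd l t i
    | i <- iota 0 n] | t <- iota 0 n] | l <- iota 0 L].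

Lemma size_grid_word L n wd q : (forall l t i, size (wd l t i) = q) ->
  size (grid_word L n wd) = L * (n * (n * q)).
Proof.
move=> wdq; rewrite (@size_flatten_const _ _ _ (n * (n * q))) ?size_iota // => l.
rewrite (@size_flatten_const _ _ _ (n * q)) ?size_iota // => t.
by rewrite (@size_flatten_const _ _ _ q) ?size_iota.
Qed.

Section PrintEscaped.
Variables (Reg S : finType) (out a a' : Reg).
Local Notation G := ((bool + S)%type : finType).
Local Notation bit_sym := (@bit_sym S).
Hypotheses (aa' : a != a') (a_out : a != out) (a'_out : a' != out).

Definition print_delimited : prog Reg G :=
  for_each a a' (print_word out (fun tp => [:: true; odflt false (sym_bit (tp a'))])) ;;
  print_word out (fun _ => [:: false]).

Lemma prints_delimited B (s : stacks Reg G) u : s a = map bit_sym u -> s a' = [::] ->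
  size u <= B -> prints out B print_delimited s (delimit u).
Proof.
move=> aE a'E uB; rewrite delimitE; apply: prints_seq; last exact: prints_const.
have -> : escape u = flatten [seq [:: true; nth false u i] | i <- iota 0 (size u)].
  by rewrite -{1}(mkseq_nth false u) /escape /mkseq -map_comp.
apply: (prints_for_each aa' a_out a'_out aE); rewrite ?size_map // => i iu.
have {1}-> : nth false u i = odflt false (sym_bit (tops (split_at s a a' (map bit_sym u) i.+1) a')).
  rewrite ffunE split_at_right (take_nth (bit_sym false)) ?size_map // rev_rcons /=.
  by rewrite (nth_map false).
apply: (@prints_word _ _ out B (fun tp => [:: true; odflt false (sym_bit (tp a'))])) => tp tp' tpE.
by rewrite tpE.
Qed.

End PrintEscaped.

Arguments print_delimited {Reg S} out a a'.

Section PrintPolytope.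
Variable D : algorithms.
Local Notation host_reg := (host_reg D).
Local Notation host_symbol := (host_symbol D).
Local Notation host_char := (host_char D).
Local Notation prog := (prog host_reg host_char).
Local Notation stacks := (stacks host_reg host_char).
Local Notation "s .[ r <- v ]" := (upd s r v).
Local Notation bit_sym := (@bit_sym host_symbol).
Local Notation ticks := (unary tick).
Implicit Types (s : stacks) (l t i : nat).

Definition check_interface : interface host_reg host_char :=
  @Interface host_reg host_char rInst rCand rThr rVerdict bit_sym isT isT isT.

Local Notation kind := (kind (check D)).
Local Notation row_kind := (row_kind (check D)).
Local Notation row_entry := (row_entry check_interface).
Implicit Types (ro : row_kind) (k : kind).

Definition forget_data (e : index_info) : index_info :=
  (info_first e, info_last e, None, None, false).

Definition entry_word (z : int) : bits := escape (escape (delimit (enc_rat (z%:~R)%R))).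

Definition entry_at ro k (tp : tops_type host_reg host_char) : bits :=
  entry_word (row_entry ro (forget_data (index_of_top (tp rTime'))) (index_of_top (tp rDepth'))
    (column_of_top (tp rLevCol')) (column_of_top (tp rTimeCol')) (column_of_top (tp rDepthCol')) k).

Definition rhs_at ro (tp : tops_type host_reg host_char) : bits :=
  entry_word (row_rhs ro (forget_data (index_of_top (tp rTime'))) (index_of_top (tp rDepth')))
    ++ [:: true; false].

Definition open_level : prog := load_threshold D ;; build_indices D.
Definition close_level : prog := clear_stack rThr ;; clear_stack rDepth ;; clear_stack rTime.

Definition for_each_cell (body : prog) : prog :=
  for_each rLev rLev'
    (open_level ;; for_each rTime rTime' (for_each rDepth rDepth' body) ;; close_level).

Definition mark_cell : prog :=
  mark_columns rLevCol rLev rLev' rTmp1 rTmp2 ;;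
  mark_columns rTimeCol rTime rTime' rTmp1 rTmp2 ;;
  mark_columns rDepthCol rDepth rDepth' rTmp1 rTmp2.
Definition unmark_cell : prog :=
  clear_stack rLevCol ;; clear_stack rTimeCol ;; clear_stack rDepthCol.

Definition print_row ro : prog :=
  for_each rLevCol rLevCol' (for_each rTimeCol rTimeCol' (for_each rDepthCol rDepthCol'
    (seq_progs (fun k => print_word rIn0 (entry_at ro k)) (enum kind)))).

Definition print_cell_rows : prog :=
  mark_cell ;;
  seq_progs (fun ro => print_row ro ;; print_word rIn0 (fun _ => [:: true; false]))
    (enum row_kind) ;;
  unmark_cell.

Definition print_cell_rhs : prog :=
  seq_progs (fun ro => print_word rIn0 (rhs_at ro)) (enum row_kind).

Definition print_count q : prog :=
  (for_each_cell (print_word rUnary (fun _ => nseq q true)) ;;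
    count_elements rUnary rTmp4 rCount rTmp1) ;;
  print_delimited rIn0 rCount rTmp4 ;;
  (clear_stack rUnary ;; clear_stack rCount).

Definition print_polytope : prog :=
  print_count #|row_kind| ;; print_count #|kind| ;;
  for_each_cell print_cell_rows ;; print_word rIn0 (fun _ => [:: false]) ;;
  for_each_cell print_cell_rhs ;; print_word rIn0 (fun _ => [:: false]).

Section Words.
Variables x r v : bits.
Local Notation n := (grid_side D x r).
Local Notation nw := (word_bound D x r).
Local Notation L := (level_count D r).

Definition cell_time t : index_info := time_info n.-1 t.
Definition cell_depth l i : index_info := depth_info n.-1 nw x (threshold l r v) i.

Definition row_word ro l t i : bits := grid_word L n (fun l' t' i' =>
  flatten [seq entry_word (row_entry ro (cell_time t) (cell_depth l i)
    (column_of l l') (column_of t t') (column_of i i') k) | k <- enum kind]).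

Definition rhs_word ro l t i : bits :=
  entry_word (row_rhs ro (cell_time t) (cell_depth l i)) ++ [:: true; false].

Definition polytope_word : bits :=
  delimit (enc_nat (L * (n * (n * #|row_kind|)))) ++ delimit (enc_nat (L * (n * (n * #|kind|)))) ++
  grid_word L n (fun l t i =>
    flatten [seq row_word ro l t i ++ [:: true; false] | ro <- enum row_kind]) ++ [:: false] ++
  grid_word L n (fun l t i => flatten [seq rhs_word ro l t i | ro <- enum row_kind]) ++ [:: false].

End Words.

Section Grid.
Variables (B : nat) (x r v : bits).
Local Notation n := (grid_side D x r).
Local Notation nw := (word_bound D x r).
Local Notation L := (level_count D r).
Local Notation indices l := (index_list D n.-1 nw x (threshold l r v)).
Hypotheses (n_gt0 : 0 < n) (nB : n <= B) (LB : L <= B) (vB : size v <= B) (rB : size r <= B).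
Hypotheses (xn : size x <= n) (nwn : nw <= n).
Hypothesis threshold_n : forall l, l < L -> size (threshold l r v) <= n.

Definition outputs : seq host_reg := [:: rIn0; rUnary].

Definition ready s := forall q, q \notin outputs -> s q = prepared x r [::] true v q.

Lemma ready_upd s out o : out \in outputs -> ready s -> ready s.[out <- o].
Proof.
move=> out_outputs s_ready q q_outputs; rewrite upd_other ?s_ready //.
by apply: contraNneq q_outputs => ->.
Qed.

Definition at_level s l : stacks := split_at s rLev rLev' (ticks L) l.+1.
Definition in_level s l : stacks :=
  (at_level s l).[rThr <- map bit_sym (threshold l r v)].[rDepth <- indices l].[rTime <- indices l].
Definition at_cell s l t i : stacks :=
  split_at (split_at (in_level s l) rTime rTime' (indices l) t.+1) rDepth rDepth' (indices l) i.+1.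

Lemma side_pred : n.-1.+1 = n. Proof. exact: prednK. Qed.

Lemma size_indices l : size (indices l) = n.
Proof. by rewrite size_index_list side_pred. Qed.

Lemma at_level_other s l q : ready s -> q \notin [:: rLev, rLev' & outputs] ->
  at_level s l q = prepared x r [::] true v q.
Proof.
move=> s_ready; rewrite inE negb_or => /andP[q1]; rewrite inE negb_or => /andP[q2 /s_ready qE].
by rewrite /at_level /split_at !upd_other.
Qed.

Lemma in_level_upd s l out o : out \in outputs ->
  at_level s.[out <- o] l = (at_level s l).[out <- o] /\
  in_level s.[out <- o] l = (in_level s l).[out <- o].
Proof.
by rewrite !inE => /orP[] /eqP ->; split; rewrite /in_level /at_level /split_at; eq_stacks.
Qed.

Lemma bigstep_open_level s l : ready s -> l < L ->
  bigstep B open_level (at_level s l) (in_level s l).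
Proof.
move=> s_ready lL; rewrite /in_level; have levE : size (at_level s l rLev') = l.+1.
  by rewrite /at_level split_at_right size_rev size_takel ?size_unary.
have other q := @at_level_other s l q s_ready; move: (at_level s l) levE other => s1 levE other.
eapply bigstep_seq.
  apply: (@bigstep_load_threshold _ B s1 l r v) => //; rewrite /vacant /= ?other //.
  exact: leq_trans lL LB.
apply: bigstep_eq; first apply: (@bigstep_build_indices _ B _ n.-1 nw x (threshold l r v));
  rewrite ?side_pred /vacant /=; simplify_upd; rewrite ?other //.
exact: threshold_n.
Qed.

Lemma bigstep_close_level s l : ready s -> l < L ->
  bigstep B close_level (in_level s l) (at_level s l).
Proof.
move=> s_ready lL; rewrite /in_level; have other q := @at_level_other s l q s_ready.
move: (at_level s l) other => s1 other.
run bigstep_clear_stack; simplify_upd; first by rewrite size_map (leq_trans (threshold_n lL)).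
run bigstep_clear_stack; simplify_upd; first by rewrite size_indices.
run_last bigstep_clear_stack; simplify_upd; first by rewrite size_indices.
have [thr_nil depth_nil time_nil] : [/\ s1 rThr = [::], s1 rDepth = [::] & s1 rTime = [::]].
  by rewrite !other.
by eq_stacks.
Qed.

Lemma prints_for_each_cell out s body wd : out \in outputs -> ready s ->
  (forall l t i, l < L -> t < n -> i < n -> prints out B body (at_cell s l t i) (wd l t i)) ->
  prints out B (for_each_cell body) s (grid_word L n wd).
Proof.
move=> out_outputs s_ready body_wd.
have out_neq (q : host_reg) : q \notin outputs -> q != out.
  by move=> q_out; apply: contraNneq q_out => ->.
have other l q := @at_level_other s l q s_ready.
apply: (prints_for_each _ _ _ _ _ (size_unary tick L)); rewrite ?out_neq // ?s_ready // => l lL.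
rewrite -/(at_level s l); apply: (prints_let (s1 := in_level s l)) => [o||o].
- have [<- <-] := in_level_upd s l o out_outputs.
  by apply: bigstep_open_level => //; apply: ready_upd.
- apply: (prints_for_each _ _ _ _ _ (size_indices l)); rewrite ?out_neq //;
    try by rewrite /in_level; simplify_upd; rewrite ?other.
  move=> t tn; apply: (prints_for_each _ _ _ _ _ (size_indices l)); rewrite ?out_neq //;
    try by rewrite /split_at /in_level; simplify_upd; rewrite ?other.
  by move=> i i_n; apply: body_wd.
- have [<- <-] := in_level_upd s l o out_outputs.
  by apply: bigstep_close_level => //; apply: ready_upd.
Qed.

Lemma at_cell_other s l t i q : ready s ->
  q \notin [:: rLev, rLev', rThr, rDepth, rTime, rTime', rDepth' & outputs] ->
  at_cell s l t i q = prepared x r [::] true v q.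
Proof.
move=> s_ready; rewrite !(inE, negb_or) => /and5P[q1 q2 q3 q4 /and4P[q5 q6 q7 q_outputs]].
by rewrite /at_cell /split_at /in_level !upd_other // at_level_other // !(inE, negb_or) q1 q2.
Qed.

Lemma at_cell_loops s l t i : let s1 := at_cell s l t i in
  [/\ s1 rLev = drop l.+1 (ticks L) /\ s1 rLev' = rev (take l.+1 (ticks L)),
      s1 rTime = drop t.+1 (indices l) /\ s1 rTime' = rev (take t.+1 (indices l)) &
      s1 rDepth = drop i.+1 (indices l) /\ s1 rDepth' = rev (take i.+1 (indices l))].
Proof. by rewrite /at_cell /in_level /at_level /split_at; simplify_upd. Qed.

Definition marked_cell s l t i : stacks :=
  (at_cell s l t i).[rLevCol <- column_list D L l].[rTimeCol <- column_list D n t]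
    .[rDepthCol <- column_list D n i].

Lemma bigstep_mark_cell s l t i : ready s -> l < L -> t < n -> i < n ->
  bigstep B mark_cell (at_cell s l t i) (marked_cell s l t i).
Proof.
move=> s_ready lL tn i_n; have other q := @at_cell_other s l t i q s_ready.
have markedE : marked_cell s l t i = (at_cell s l t i)
    .[rLevCol <- column_list D (size (ticks L : seq host_char)) l]
    .[rTimeCol <- column_list D (size (indices l)) t]
    .[rDepthCol <- column_list D (size (indices l)) i] by rewrite !size_indices size_unary.
rewrite {}markedE; have [[levE lev'E] [timeE time'E] [depthE depth'E]] := at_cell_loops s l t i.
move: (at_cell s l t i) other levE lev'E timeE time'E depthE depth'E.
move=> s1 other levE lev'E timeE time'E depthE depth'E.
have [colE tcolE dcolE] : [/\ s1 rLevCol = [::], s1 rTimeCol = [::] & s1 rDepthCol = [::]].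
  by rewrite !other.
have [t1E t2E] : s1 rTmp1 = [::] /\ s1 rTmp2 = [::] by rewrite !other.
eapply bigstep_seq.
  by apply: (@bigstep_mark_columns D B _ rLevCol _ _ _ _ (ticks L) l); rewrite ?size_unary.
eapply bigstep_seq.
  by apply: (@bigstep_mark_columns D B _ rTimeCol _ _ _ _ (indices l) t); rewrite ?size_indices.
by apply: bigstep_mark_columns; rewrite ?size_indices.
Qed.

Lemma bigstep_unmark_cell s l t i : ready s ->
  bigstep B unmark_cell (marked_cell s l t i) (at_cell s l t i).
Proof.
move=> s_ready; have other q := @at_cell_other s l t i q s_ready.
rewrite /marked_cell; move: (at_cell s l t i) other => s1 other.
run bigstep_clear_stack; simplify_upd; first by rewrite size_column_list.
run bigstep_clear_stack; simplify_upd; first by rewrite size_column_list.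
run_last bigstep_clear_stack; simplify_upd; first by rewrite size_column_list.
have [lev_nil time_nil depth_nil] : [/\ s1 rLevCol = [::], s1 rTimeCol = [::]
    & s1 rDepthCol = [::]] by rewrite !other.
by eq_stacks.
Qed.

Lemma marked_cell_upd s l t i o :
  marked_cell s.[rIn0 <- o] l t i = (marked_cell s l t i).[rIn0 <- o] /\
  at_cell s.[rIn0 <- o] l t i = (at_cell s l t i).[rIn0 <- o].
Proof.
split; rewrite ?/marked_cell /at_cell /in_level /at_level /split_at; eq_stacks.
Qed.

Lemma cell_tops s l t i : t < n -> i < n ->
  index_of_top (ohead (at_cell s l t i rTime')) = cell_depth x r v l t /\
  index_of_top (ohead (at_cell s l t i rDepth')) = cell_depth x r v l i.
Proof.
by move=> tn i_n; rewrite /at_cell /split_at; simplify_upd; rewrite !ohead_rev_take ?side_pred.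
Qed.

Lemma prints_row s l t i ro : ready s -> l < L -> t < n -> i < n ->
  prints rIn0 B (print_row ro) (marked_cell s l t i) (row_word x r v ro l t i).
Proof.
move=> s_ready lL tn i_n; have other q := @at_cell_other s l t i q s_ready.
have [timeE depthE] := cell_tops s l tn i_n.
rewrite /marked_cell; move: (at_cell s l t i) other timeE depthE => s1 other timeE depthE.
apply: (prints_for_each _ _ _ _ _ (size_column_list D L l)); simplify_upd;
  rewrite ?other // => l' l'L.
apply: (prints_for_each _ _ _ _ _ (size_column_list D n t)) => //;
  try by rewrite /split_at; simplify_upd; rewrite ?other.
move=> t' t'n.
apply: (prints_for_each _ _ _ _ _ (size_column_list D n i)) => //;
  try by rewrite /split_at; simplify_upd; rewrite ?other.
move=> i' i'n.
apply: prints_seq_progs => k; set s2 := split_at _ _ _ _ _.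
have -> : entry_word (row_entry ro (cell_time x r t) (cell_depth x r v l i)
    (column_of l l') (column_of t t') (column_of i i') k) = entry_at ro k (tops s2).
  by rewrite /entry_at !ffunE /s2 /split_at; simplify_upd; rewrite timeE depthE !ohead_rev_take.
apply: prints_word => tp tp' tpE; rewrite /entry_at.
by rewrite (tpE rTime') // (tpE rDepth') // (tpE rLevCol') // (tpE rTimeCol') // (tpE rDepthCol').
Qed.

Lemma prints_cell_rows s l t i : ready s -> l < L -> t < n -> i < n ->
  prints rIn0 B print_cell_rows (at_cell s l t i)
    (flatten [seq row_word x r v ro l t i ++ [:: true; false] | ro <- enum row_kind]).
Proof.
move=> s_ready lL tn i_n; apply: (prints_let (s1 := marked_cell s l t i)) => [o||o].
- have [<- <-] := marked_cell_upd s l t i o.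
  by apply: bigstep_mark_cell => //; apply: ready_upd.
- by apply: prints_seq_progs => ro; apply: prints_seq; [exact: prints_row | exact: prints_const].
- have [<- <-] := marked_cell_upd s l t i o.
  by apply: bigstep_unmark_cell => //; apply: ready_upd.
Qed.

Lemma prints_cell_rhs s l t i : t < n -> i < n ->
  prints rIn0 B print_cell_rhs (at_cell s l t i)
    (flatten [seq rhs_word x r v ro l t i | ro <- enum row_kind]).
Proof.
move=> tn i_n; apply: prints_seq_progs => ro; have [timeE depthE] := cell_tops s l tn i_n.
have -> : rhs_word x r v ro l t i = rhs_at ro (tops (at_cell s l t i)).
  by rewrite /rhs_at !ffunE timeE depthE.
by apply: prints_word => tp tp' tpE; rewrite /rhs_at (tpE rTime') // (tpE rDepth').
Qed.

Lemma prints_print_count s q : ready s -> s rUnary = [::] -> L * (n * (n * q)) <= B ->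
  prints rIn0 B (print_count q) s (delimit (enc_nat (L * (n * (n * q))))).
Proof.
move=> s_ready unaryE; set m := L * _ => mB.
pose W := rev (map bit_sym (grid_word L n (fun _ _ _ => nseq q true))).
have szW : size W = m.
  by rewrite size_rev size_map (@size_grid_word _ _ _ q) // => *; rewrite size_nseq.
have other q' : q' \notin outputs -> s q' = prepared x r [::] true v q' := s_ready q'.
have numB : size (enc_nat m) <= B by rewrite (leq_trans (size_enc_nat m)).
apply: (prints_let (s1 := s.[rUnary <- W].[rCount <- map bit_sym (enc_nat m)])) => [o||o].
- have cells : prints rUnary B (for_each_cell (print_word rUnary (fun _ => nseq q true)))
      s.[rIn0 <- o] (grid_word L n (fun _ _ _ => nseq q true)).
    by apply: prints_for_each_cell => // [|*]; [apply: ready_upd | exact: prints_const].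
  have := cells [::]; rewrite catrevE cats0 -/W upd_id; last by simplify_upd.
  move=> {}cells; apply: (bigstep_seq cells); apply: bigstep_eq.
    by apply: bigstep_count_elements => //; rewrite /vacant /=; simplify_upd; rewrite ?szW ?other.
  by simplify_upd; rewrite szW; eq_stacks.
- by apply: prints_delimited => //; simplify_upd; rewrite ?other.
- run bigstep_clear_stack; simplify_upd; first by rewrite szW.
  run_last bigstep_clear_stack; simplify_upd; first by rewrite size_map.
  have countE : s rCount = [::] by rewrite other.
  by eq_stacks.
Qed.

Lemma prints_polytope s : ready s -> s rUnary = [::] ->
  L * (n * (n * #|row_kind|)) <= B -> L * (n * (n * #|kind|)) <= B ->
  prints rIn0 B print_polytope s (polytope_word x r v).
Proof.
move=> s_ready unaryE rowsB columnsB; apply: prints_seq; first exact: prints_print_count.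
apply: prints_seq; first exact: prints_print_count.
apply: prints_seq; first by apply: prints_for_each_cell => // l t i *; exact: prints_cell_rows.
apply: prints_seq; first exact: prints_const.
apply: prints_seq; first by apply: prints_for_each_cell => // l t i *; exact: prints_cell_rhs.
exact: prints_const.
Qed.

End Grid.
End PrintPolytope.

Section InstanceProg.
Variable D : algorithms.
Local Notation host_reg := (host_reg D).
Local Notation host_symbol := (host_symbol D).
Local Notation host_char := (host_char D).
Local Notation prog := (prog host_reg host_char).
Local Notation stacks := (stacks host_reg host_char).
Local Notation "s .[ r <- v ]" := (upd s r v).
Local Notation bit_sym := (@bit_sym host_symbol).
Local Notation input_stacks := (@input_stacks host_reg host_symbol _ (@host_tape D)).

Lemma input_stacksE (ws : seq bits) : size ws <= 3 ->
  input_stacks ws = (fun _ => [::]).[rIn0 <- map bit_sym (rev (nth [::] ws 0))]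
    .[rIn1 <- map bit_sym (rev (nth [::] ws 1))].[rIn2 <- map bit_sym (rev (nth [::] ws 2))].
Proof.
move=> ws3; apply: funext => q; rewrite /input_stacks.
case: q => [[[|[|[|i]]] i3]|q] //=.
by rewrite nth_default //; apply: leq_trans ws3 _; rewrite leq_addr.
Qed.

(* Without a valid first solution the instance has no solution, and [fallback] is printed. *)
Definition instance_prog (fallback : bits) : prog :=
  transfer rIn0 rInst ;; transfer rIn1 rRatio ;; prepare D ;;
  If (fun tp => tp rValid == Some (bit_sym true))
    (print_polytope D) (print_word rIn0 (fun _ => fallback)).

Lemma bigstep_instance_prog B x r (fallback : bits) (valid : bool) v t :
  decided_in D t x (start_word D x r) valid v -> ample D B x r t ->
  0 < grid_side D x r -> size x <= grid_side D x r -> word_bound D x r <= grid_side D x r ->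
  (valid -> forall l, l < level_count D r -> size (threshold l r v) <= grid_side D x r) ->
  level_count D r * (grid_side D x r * (grid_side D x r * #|row_kind (check D)|)) <= B ->
  level_count D r * (grid_side D x r * (grid_side D x r * #|kind (check D)|)) <= B ->
  exists2 s', bigstep B (instance_prog fallback) (input_stacks [:: x; r]) s' &
    s' rIn0 = map bit_sym (rev (if valid then polytope_word D x r v else fallback)).
Proof.
move=> dec room n_gt0 xn wordn thrn rowsB columnsB; have [gridB sB wB LB] := room.
have [xB rB] : size x <= B /\ size r <= B by move: sB; rewrite /base_size; lia.
set out := if valid then _ else _.
exists (prepared x r [::] valid v).[rIn0 <- catrev (map bit_sym out) [::]]; last first.
  by rewrite upd_same catrevE cats0 map_rev.
rewrite input_stacksE //=.
run bigstep_transfer; simplify_upd; rewrite ?size_map ?size_rev //.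
run bigstep_transfer; simplify_upd; rewrite ?size_map ?size_rev // !map_rev !catrevE !revK !cats0.
set s0 := upd _ _ _; have {s0}-> : s0 = inputs x r [::] by rewrite /s0 /inputs; eq_stacks.
apply: (bigstep_seq (bigstep_prepare [::] dec room)); apply: bigstep_if; rewrite ffunE.
have preparedE := @upd_id host_reg host_symbol (prepared x r [::] valid v) rIn0 [::] erefl.
rewrite -{2}preparedE /out /=; case: valid dec {preparedE out} thrn => dec thrn /=;
  last exact: prints_const.
have vB : size v <= B.
  by have := size_decided_value dec; have := size_start_word D x r; lia.
by apply: prints_polytope => //; [lia | exact: thrn].
Qed.

End InstanceProg.

(** * Recovering a solution from a pair of vertices *)

(* A coordinate [e] of a vertex occurs as [coord_word (enc_rat e)] in the encoding of a pair
   of vertices; the third bit of [enc_rat e] tells whether [e >= 0] is positive. *)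
Definition coord_word (u : bits) : bits := escape (delimit (delimit u)).

Definition coord_bit (b : bool) : bits := [:: true; true; true; true; true; true; true; b].

Definition coord_end : bits := [:: true; true; true; false; true; false].

Lemma coord_wordE u : coord_word u = flatten [seq coord_bit b | b <- u] ++ coord_end.
Proof.
by elim: u => // b u IH; rewrite -[coord_word (b :: u)]/(coord_bit b ++ coord_word u) IH.
Qed.

Section ReadPair.
Variable D : algorithms.
Local Notation host_reg := (host_reg D).
Local Notation host_symbol := (host_symbol D).
Local Notation host_char := (host_char D).
Local Notation prog := (prog host_reg host_char).
Local Notation stacks := (stacks host_reg host_char).
Local Notation "s .[ r <- v ]" := (upd s r v).
Local Notation bit_sym := (@bit_sym host_symbol).
Implicit Types (s : stacks) (B : nat).

Definition pop_times (a : host_reg) k : prog := iter k (Seq (pop a)) nop.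
Arguments pop_times : simpl never.

Lemma bigstep_pop_times B s a k : bigstep B (pop_times a k) s s.[a <- drop k (s a)].
Proof.
elim: k s => [|k IH] s; first by rewrite drop0 upd_id.
apply: (bigstep_seq (bigstep_act_on _ _ _ _)); apply: bigstep_eq (IH _) _.
by rewrite upd_upd upd_same /= -drop1 drop_drop addn1.
Qed.

Definition read_coord : prog :=
  pop_times rPair 3 ;;
  While (fun tp => tp rPair == Some (bit_sym true))
    (pop_times rPair 4 ;; move_top rPair rTmp4 ;; pop_times rPair 3) ;;
  pop_times rPair 3 ;;
  transfer rTmp4 rTmp5 ;; pop_times rTmp5 2 ;;
  act_on rFlags (fun tp => Push (bit_sym (odflt false (sym_bit (tp rTmp5))))) ;;
  clear_stack rTmp5.

Lemma bigstep_read_coord B s u rest :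
  s rPair = map bit_sym (coord_word u ++ rest) -> vacant s [:: rTmp4; rTmp5] -> size u <= B ->
  bigstep B read_coord s
    s.[rPair <- map bit_sym rest].[rFlags <- bit_sym (nth false u 2) :: s rFlags].
Proof.
move=> pairE [t4E [t5E _]] uB; rewrite coord_wordE -catA in pairE.
pose from i := flatten [seq coord_bit b | b <- drop i u] ++ (coord_end ++ rest).
pose F i := s.[rPair <- drop 3 (map bit_sym (from i))].[rTmp4 <- rev (map bit_sym (take i u))].
apply: (bigstep_seq (s1 := F 0)).
  apply: bigstep_eq; first exact: bigstep_pop_times.
  by rewrite pairE /F /from drop0 take0; eq_stacks.
apply: (bigstep_seq (s1 := F (size u))).
  apply: bigstep_while => // [i iu|]; last by rewrite ffunE /F; simplify_upd;
    rewrite /from drop_size.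
  have fromE : from i = coord_bit (nth false u i) ++ from i.+1 by rewrite /from (drop_nth false iu).
  split; first by rewrite ffunE /F; simplify_upd; rewrite fromE /= eqxx.
  eapply bigstep_seq; first exact: bigstep_pop_times.
  rewrite /F; simplify_upd; rewrite upd_comm // upd_upd fromE /= ?drop0.
  eapply bigstep_seq.
    by apply: (@bigstep_move_top _ _ _ _ _ (bit_sym (nth false u i)) (map bit_sym (from i.+1)));
      simplify_upd.
  apply: bigstep_eq; first exact: bigstep_pop_times.
  by simplify_upd; rewrite (take_nth false iu) map_rcons rev_rcons; eq_stacks.
rewrite /F /from drop_size take_size; eapply bigstep_seq; first exact: bigstep_pop_times.
simplify_upd; rewrite cat0s upd_comm // upd_upd.
have -> : drop 3 (drop 3 (map bit_sym (coord_end ++ rest))) = map bit_sym rest by rewrite /= drop0.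
run bigstep_transfer; simplify_upd; first by rewrite size_rev size_map.
rewrite t5E catrevE revK cats0; eapply bigstep_seq; first exact: bigstep_pop_times.
run bigstep_act_on; simplify_upd; rewrite ffunE; simplify_upd; rewrite -map_drop.
apply: bigstep_eq; first by apply: bigstep_clear_stack; simplify_upd;
  rewrite size_map size_drop; lia.
have -> : odflt false (sym_bit (ohead (map bit_sym (drop 2 u)))) = nth false u 2.
  by case: u {pairE from F uB} => [|a [|b [|c u]]].
by eq_stacks.
Qed.

Definition read_vector : prog :=
  While (fun tp => tp rPair == Some (bit_sym true)) read_coord ;; pop rPair.

Definition vector_word (us : seq bits) : bits := flatten [seq coord_word u | u <- us] ++ [:: false].

Lemma bigstep_read_vector B s (us : seq bits) rest :
  s rPair = map bit_sym (vector_word us ++ rest) -> vacant s [:: rTmp4; rTmp5] ->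
  size us <= B -> (forall u, u \in us -> size u <= B) ->
  bigstep B read_vector s
    s.[rPair <- map bit_sym rest]
     .[rFlags <- catrev (map bit_sym [seq nth false u 2 | u <- us]) (s rFlags)].
Proof.
move=> pairE [t4E [t5E _]] usB uB; pose flags vs : bits := [seq nth false u 2 | u <- vs].
pose F i := s.[rPair <- map bit_sym (vector_word (drop i us) ++ rest)]
             .[rFlags <- catrev (map bit_sym (flags (take i us))) (s rFlags)].
apply: (bigstep_seq (s1 := F (size us))).
  have {1}-> : s = F 0 by rewrite /F drop0 take0; eq_stacks.
  apply: bigstep_while => // [i iu|]; last by rewrite ffunE /F; simplify_upd; rewrite drop_size.
  have dropE : drop i us = nth [::] us i :: drop i.+1 us by apply: drop_nth.
  split.
    rewrite ffunE /F; simplify_upd; rewrite dropE /vector_word /= coord_wordE.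
    by case: (nth _ _ _) => [|b v] /=; rewrite eqxx.
  apply: bigstep_eq.
    apply: (@bigstep_read_coord B (F i) (nth [::] us i) (vector_word (drop i.+1 us) ++ rest)).
    - by rewrite /F; simplify_upd; rewrite dropE /vector_word /= !catA.
    - by rewrite /F /vacant /=; simplify_upd.
    - by apply: uB; rewrite mem_nth.
  rewrite /F; simplify_upd; rewrite /flags (take_nth [::] iu) !map_rcons -cats1 catrev_catl /=.
  by eq_stacks.
run_last bigstep_act_on; rewrite /F; simplify_upd; rewrite drop_size take_size /=.
by eq_stacks.
Qed.

Definition read_pair : prog := read_vector ;; read_vector ;; transfer rFlags rQueue.

Lemma bigstep_read_pair B s (us vs : seq bits) :
  s rPair = map bit_sym (vector_word us ++ vector_word vs) ->
  vacant s [:: rTmp4; rTmp5; rFlags; rQueue] ->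
  size us + size vs <= B -> (forall u, u \in us ++ vs -> size u <= B) ->
  bigstep B read_pair s
    s.[rPair <- [::]].[rQueue <- map bit_sym [seq nth false u 2 | u <- us ++ vs]].
Proof.
move=> pairE [t4E [t5E [flagsE [queueE _]]]] usB uB.
eapply bigstep_seq; first apply: (bigstep_read_vector pairE) => //; first by lia.
  by move=> u u_us; apply: uB; rewrite mem_cat u_us.
eapply bigstep_seq; first apply: (@bigstep_read_vector B _ vs [::]); simplify_upd;
  rewrite ?cats0 //.
  - by lia.
  - by move=> u u_vs; apply: uB; rewrite mem_cat u_vs orbT.
run_last bigstep_transfer; simplify_upd; rewrite flagsE !catrevE !cats0.
  by rewrite size_cat !size_rev !size_map addnC.
by rewrite queueE cats0 rev_cat !revK -!map_cat; eq_stacks.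
Qed.

End ReadPair.

Definition ended (a : nat -> option bool -> bool) i := has (fun j => a j None) (iota 0 i).

Definition guess_upto (a : nat -> option bool -> bool) i : bits :=
  [seq a j (Some true) | j <- iota 0 (find (fun j => a j None) (iota 0 i))].

Lemma endedS a i : ended a i.+1 = ended a i || a i None.
Proof. by rewrite /ended iota_rcons has_rcons orbC. Qed.

Lemma guess_uptoS a i : guess_upto a i.+1 =
  if ended a i.+1 then guess_upto a i else rcons (guess_upto a i) (a i (Some true)).
Proof.
rewrite endedS /guess_upto /ended iota_rcons -cats1 find_cat size_iota /=.
have [//|not_ended] := boolP (has _ _).
by rewrite hasNfind // size_iota /=; case: ifP; rewrite ?addn0 // addn1 iota_rcons map_rcons.
Qed.

Section Extract.
Variables (D : algorithms) (T : finType) (end_kind true_kind : T).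
Local Notation host_reg := (host_reg D).
Local Notation host_symbol := (host_symbol D).
Local Notation host_char := (host_char D).
Local Notation prog := (prog host_reg host_char).
Local Notation stacks := (stacks host_reg host_char).
Local Notation "s .[ r <- v ]" := (upd s r v).
Local Notation bit_sym := (@bit_sym host_symbol).
Local Notation ticks := (unary tick).
Implicit Types (s : stacks) (B i : nat) (k : T).

Definition take_flag k : prog := Do (fun tp r =>
  if r == rQueue then Pop else
  if tp rQueue is Some g then
    if (r == rFlagEnd) && (k == end_kind) || (r == rFlagTrue) && (k == true_kind)
    then Push g else Keep
  else Keep).

Definition selected k (ks : seq T) (fl : bits) : bits := rev [seq u.2 | u <- zip ks fl & u.1 == k].

Lemma selected_cons k' k ks b fl :
  selected k' (k :: ks) (b :: fl) = selected k' ks fl ++ nseq (k == k') b.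
Proof.
rewrite /selected /=; case: ifP => _ /=; last by rewrite cats0.
by rewrite rev_cons cats1.
Qed.

Lemma selected_enum k fl : size fl = #|T| ->
  selected k (enum T) fl = [:: nth false fl (index k (enum T))].
Proof.
rewrite cardE /selected; have := mem_enum T k; have := enum_uniq T.
have absent ks f : k \notin ks -> [seq u.2 | u <- zip ks f & u.1 == k] = [::] :> bits.
  elim: ks f => [|a ks IH] [|b f] //=; rewrite inE negb_or eq_sym => /andP[/negbTE ->].
  exact: IH.
elim: (enum T) fl => [|a ks IH] [|b fl] //= /andP[a_ks ks_uniq].
rewrite inE eq_sym; have [ak|_] /= := eqVneq a k => [_ _|k_ks [fl_size]]; last exact: IH.
by rewrite absent // -ak.
Qed.

Lemma bigstep_take_flags B s ks fl rest : size fl = size ks ->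
  s rQueue = map bit_sym (fl ++ rest) ->
  bigstep B (seq_progs take_flag ks) s
    s.[rQueue <- map bit_sym rest].[rFlagEnd <- map bit_sym (selected end_kind ks fl) ++ s rFlagEnd]
     .[rFlagTrue <- map bit_sym (selected true_kind ks fl) ++ s rFlagTrue].
Proof.
elim: ks fl s => [|k ks IH] [|b fl] s //=; first by move=> _ queueE; eq_stacks.
move=> [fl_size] queueE; pose s1 := s.[rQueue <- map bit_sym (fl ++ rest)]
  .[rFlagEnd <- map bit_sym (nseq (k == end_kind) b) ++ s rFlagEnd]
  .[rFlagTrue <- map bit_sym (nseq (k == true_kind) b) ++ s rFlagTrue].
apply: (bigstep_seq (s1 := s1)).
  rewrite /bigstep; apply: funext => q; rewrite /do_ops ffunE queueE /s1 /upd /=.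
  have [->|_] := eqVneq q rFlagTrue; first by case: eqP.
  have [->|_] := eqVneq q rFlagEnd; first by rewrite orbF; case: eqP.
  by have [->|//] := eqVneq q rQueue; rewrite queueE.
apply: (bigstep_eq (IH fl s1 fl_size _)); first by rewrite /s1; simplify_upd.
by rewrite /s1; simplify_upd; rewrite !catA -!map_cat -!selected_cons; eq_stacks.
Qed.

(* [rStop] is nonempty once the end of the guessed word has been met. *)
Definition extend_guess : prog := Do (fun tp r =>
  if (r == rFlagEnd) || (r == rFlagTrue) then Pop else
  if r == rStop then
    (if (tp rStop == None) && (tp rFlagEnd == Some (bit_sym true)) then Push tick else Keep) else
  if r == rTmp5 then
    (if (tp rStop == None) && (tp rFlagEnd != Some (bit_sym true))
     then Push (odflt tick (tp rFlagTrue)) else Keep)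
  else Keep).

Lemma bigstep_extend_guess B s (stopped e b : bool) (u : bits) :
  s rFlagEnd = [:: bit_sym e] -> s rFlagTrue = [:: bit_sym b] -> s rStop = ticks stopped ->
  s rTmp5 = rev (map bit_sym u) ->
  bigstep B extend_guess s s.[rFlagEnd <- [::]].[rFlagTrue <- [::]].[rStop <- ticks (stopped || e)]
    .[rTmp5 <- rev (map bit_sym (if stopped || e then u else rcons u b))].
Proof.
move=> endE trueE stopE wordE; rewrite /bigstep; apply: funext => q.
rewrite /do_ops !ffunE endE trueE stopE /upd.
have [->|_] := eqVneq q rTmp5; first by rewrite wordE; case: stopped e {stopE endE} => [] [];
  rewrite ?map_rcons ?rev_rcons.
have [->|_] := eqVneq q rStop; first by rewrite stopE; case: stopped e {stopE endE} => [] [].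
have [->|_] := eqVneq q rFlagTrue; first by rewrite orbT /= trueE.
by have [->|//] := eqVneq q rFlagEnd; rewrite /= endE.
Qed.

Definition extract_guess : prog :=
  for_each rSide rTmp3 (seq_progs take_flag (enum T) ;; extend_guess).

Definition flag_at (c : bits) i k := nth false c (i * #|T| + index k (enum T)).
Definition guess_flags (c : bits) i (o : option bool) :=
  flag_at c i (if o is Some _ then true_kind else end_kind).

Lemma bigstep_extract_guess B s N c rest : s rSide = ticks N.+1 -> size c = N.+1 * #|T| ->
  s rQueue = map bit_sym (c ++ rest) ->
  vacant s [:: rTmp3; rTmp5; rStop; rFlagEnd; rFlagTrue] -> N < B ->
  bigstep B extract_guess s s.[rQueue <- map bit_sym rest]
    .[rStop <- ticks (ended (guess_flags c) N.+1)]
    .[rTmp5 <- rev (map bit_sym (guess N (guess_flags c)))].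
Proof.
move=> sideE szc queueE [t3E [t5E [stopE [endE [trueE _]]]]] NB; set a := guess_flags c.
pose F i := s.[rQueue <- map bit_sym (drop (i * #|T|) c ++ rest)].[rStop <- ticks (ended a i)]
  .[rTmp5 <- rev (map bit_sym (guess_upto a i))].
have {1}-> : s = F 0 by rewrite /F drop0; eq_stacks.
set s' := (X in bigstep _ _ _ X).
have -> : s' = F (size (ticks N.+1 : seq host_char)) by rewrite /F size_unary drop_oversize ?szc.
apply: bigstep_for_each; rewrite ?size_unary // => i iN.
set f := take #|T| (drop (i * #|T|) c).
have dropE : drop (i * #|T|) c = f ++ drop (i.+1 * #|T|) c.
  by rewrite /f -[LHS](cat_take_drop #|T|) drop_drop mulSn.
have szf : size f = #|T| by rewrite size_takel // size_drop szc -mulnBl leq_pmull // subn_gt0.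
have flagE k : nth false f (index k (enum T)) = flag_at c i k.
  by rewrite /flag_at nth_take ?nth_drop // cardE index_mem mem_enum.
rewrite /split_at /F; eapply bigstep_seq.
  apply: (@bigstep_take_flags B _ (enum T) f (drop (i.+1 * #|T|) c ++ rest));
    first by rewrite szf cardE.
  by simplify_upd; rewrite dropE catA.
rewrite !selected_enum // !flagE; simplify_upd; rewrite endE trueE.
apply: bigstep_eq; first
  by apply: (@bigstep_extend_guess _ _ (ended a i) (a i None) (a i (Some true))
  (guess_upto a i)); simplify_upd.
by rewrite -endedS -guess_uptoS; eq_stacks.
Qed.

End Extract.

Section Recovery.
Variable D : algorithms.
Local Notation host_reg := (host_reg D).
Local Notation host_symbol := (host_symbol D).
Local Notation host_char := (host_char D).
Local Notation prog := (prog host_reg host_char).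
Local Notation stacks := (stacks host_reg host_char).
Local Notation "s .[ r <- v ]" := (upd s r v).
Local Notation bit_sym := (@bit_sym host_symbol).
Local Notation ticks := (unary tick).
Local Notation kind := (kind (check D)).
Local Notation input_stacks := (@input_stacks host_reg host_symbol _ (@host_tape D)).
Implicit Types (s : stacks) (b : bits * bits) (w c : bits).

Definition end_kind : kind := KCell (check D) rCand None.
Definition true_kind : kind := KCell (check D) rCand (Some (bit_sym true)).

Definition extract_candidate : prog := extract_guess D end_kind true_kind.
Definition candidate N c : bits := guess N (guess_flags end_kind true_kind c).

Definition save_candidate : prog :=
  clear_stack rBest ;; clear_stack rBestVal ;; copy rCand rBest rTmp1 ;; copy rVal rBestVal rTmp1.

Definition try_candidate : prog :=
  copy rBestVal rThr rTmp1 ;; check D ;;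
  If (fun tp => tp rVerdict == Some (bit_sym true)) save_candidate nop ;;
  clear_stack rCand ;; clear_stack rThr ;; clear_stack rVal ;;
  clear_stack rVerdict ;; clear_stack rValid.

Definition improve : prog :=
  extract_candidate ;; clear_stack rStop ;; transfer rTmp5 rCand ;; try_candidate.

Definition recovery_prog : prog :=
  transfer rIn0 rInst ;; transfer rIn1 rPair ;; transfer rIn2 rRatio ;; prepare D ;;
  clear_stack rValid ;; read_pair D ;; While (nonempty rQueue) improve ;; transfer rBest rIn0.

Definition with_best s b : stacks := s.[rBest <- map bit_sym b.1].[rBestVal <- map bit_sym b.2].

Section Correct.
Variables (B t : nat) (x : bits) (N : nat) (valid : bits -> bool) (val : bits -> bits).
Hypothesis decided : forall w, size w <= N.+1 -> decided_in D t x w (valid w) (val w).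
Hypothesis tB : size x + N.+1 + t + 2 < B.

Definition best_of b w : bits * bits :=
  if valid w && better (maximizing D) (nat_of_bits (val w)) (nat_of_bits b.2)
  then (w, val w) else b.

Definition small b : Prop := size b.1 <= B /\ size b.2 <= B.

Lemma size_val w : size w <= N.+1 -> valid w -> size (val w) <= B.
Proof.
move=> wN valid_w; have := decided wN; rewrite valid_w => /size_decided_value valB.
by apply: leq_trans valB _; move: tB wN; lia.
Qed.

Lemma small_best_of b w : small b -> size w <= N.+1 -> small (best_of b w).
Proof.
move=> b_small wN; rewrite /best_of; case: ifP => // /andP[/(size_val wN) valB _]; split=> //=.
by move: tB wN; lia.
Qed.

Definition idle s := [/\ s rInst = map bit_sym x, s rSide = ticks N.+1, machines_empty s &
  vacant s [:: rTmp1; rTmp2; rTmp3; rTmp5; rCand; rThr; rVal; rVerdict; rValid; rStop; rFlagEnd;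
    rFlagTrue]].

Lemma bigstep_save_candidate s w v : s rCand = map bit_sym w -> s rVal = map bit_sym v ->
  s rTmp1 = [::] -> size (s rBest) <= B -> size (s rBestVal) <= B -> size w <= B -> size v <= B ->
  bigstep B save_candidate s (with_best s (w, v)).
Proof.
move=> candE valE t1E bestB bestvB wB vB.
run bigstep_clear_stack; run bigstep_clear_stack; simplify_upd => //.
run bigstep_copy; simplify_upd; rewrite ?candE ?size_map // cats0.
run_last bigstep_copy; simplify_upd; rewrite ?valE ?size_map // cats0.
by rewrite /with_best; eq_stacks.
Qed.

Lemma bigstep_try_candidate s b w : idle s -> small b -> size w <= N.+1 ->
  bigstep B try_candidate (with_best s b).[rCand <- map bit_sym w] (with_best s (best_of b w)).
Proof.
move=> [xE _ mE [t1E [t2E [t3E [_ [candE [thrE [valE [verdictE [validE _]]]]]]]]]] [b1 b2] wN.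
have wB : size w <= B by move: tB wN; lia.
have valB : size (if valid w then map bit_sym (val w) else [::]) <= B.
  by case: ifP => // /(size_val wN); rewrite size_map.
run bigstep_copy; rewrite /with_best; simplify_upd; rewrite ?size_map // thrE cats0.
eapply bigstep_seq.
  apply: (bigstep_check (x := x) (w := w) (th := b.2) _ _ _ _ _ (decided wN)); simplify_upd => //.
  by move: tB wN; lia.
rewrite /checked; set better_w := valid w && _.
pose s1 := (with_best s (best_of b w)).[rCand <- map bit_sym w].[rThr <- map bit_sym b.2]
  .[rValid <- [:: bit_sym (valid w)]].[rVal <- if valid w then map bit_sym (val w) else [::]]
  .[rVerdict <- [:: bit_sym better_w]].
apply: (bigstep_seq (s1 := s1)).
  apply: bigstep_if; rewrite ffunE upd_same /s1 /best_of -/better_w.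
  case betterE : better_w => /=; last first.
    by run_last bigstep_nop; rewrite /with_best; eq_stacks.
  have valid_w : valid w by move: betterE; rewrite /better_w => /andP[].
  rewrite valid_w; apply: bigstep_eq.
    by apply: (@bigstep_save_candidate _ w (val w)); simplify_upd; rewrite ?size_map ?size_val.
  by rewrite /with_best; eq_stacks.
rewrite /s1 /with_best.
run bigstep_clear_stack; simplify_upd; rewrite ?size_map //.
run bigstep_clear_stack; simplify_upd; rewrite ?size_map //.
run bigstep_clear_stack; simplify_upd => //.
run bigstep_clear_stack; simplify_upd; first by rewrite /=; move: tB; lia.
run_last bigstep_clear_stack; simplify_upd; first by rewrite /=; move: tB; lia.
by eq_stacks.
Qed.

Lemma bigstep_improve s b c rest : idle s -> small b -> size c = N.+1 * #|kind| ->
  bigstep B improve (with_best s b).[rQueue <- map bit_sym (c ++ rest)]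
    (with_best s (best_of b (candidate N c))).[rQueue <- map bit_sym rest].
Proof.
move=> s_idle b_small szc; have [xE sideE mE] := s_idle.
move=> [t1E [t2E [t3E [t5E [candE [thrE [valE [verdictE [validE [stopE [endE [trueE _]]]]]]]]]]]].
have NB : N < B by move: tB; lia.
have candN : size (candidate N c) <= N.+1 by exact: size_guess.
rewrite /with_best; eapply bigstep_seq.
  by apply: (@bigstep_extract_guess _ _ _ _ B _ N c rest); simplify_upd.
rewrite -/(candidate N c) upd_upd.
run bigstep_clear_stack; simplify_upd;
  first by rewrite size_unary (leq_trans (leq_b1 _)) // (leq_trans _ NB).
run bigstep_transfer; simplify_upd; first by rewrite size_rev size_map (leq_trans candN).
have idle' : idle s.[rQueue <- map bit_sym rest] by split; rewrite /vacant /=; simplify_upd.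
have := bigstep_try_candidate idle' b_small candN; rewrite /with_best; simplify_upd.
rewrite candE catrevE revK cats0; congr bigstep; by eq_stacks.
Qed.

Lemma bigstep_improve_loop s b (cs : seq bits) : idle s -> small b -> s rQueue = [::] ->
  (forall c, c \in cs -> size c = N.+1 * #|kind|) -> size cs <= B ->
  bigstep B (While (nonempty rQueue) improve) (with_best s b).[rQueue <- map bit_sym (flatten cs)]
    (with_best s (foldl best_of b [seq candidate N c | c <- cs])).
Proof.
move=> s_idle b_small queueE szc csB.
pose best i := foldl best_of b [seq candidate N c | c <- take i cs].
pose F i := (with_best s (best i)).[rQueue <- map bit_sym (flatten (drop i cs))].
have kind_gt0 : 0 < #|kind| by apply/card_gt0P; exists end_kind.
have -> : (with_best s b).[rQueue <- map bit_sym (flatten cs)] = F 0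
  by rewrite /F /best take0 drop0.
have -> : with_best s (foldl best_of b [seq candidate N c | c <- cs]) = F (size cs).
  by rewrite /F /best take_size drop_size /with_best; eq_stacks.
have best_small i : small (best i).
  rewrite /best; elim: (take i cs) b b_small {F best} => //= c l IH b' b'_small.
  by apply: IH; apply: small_best_of => //; exact: size_guess.
apply: bigstep_while => // [i ics|]; last by rewrite nonempty_tops /F; simplify_upd;
  rewrite drop_size.
have c_in : nth [::] cs i \in cs by rewrite mem_nth.
have dropE : drop i cs = nth [::] cs i :: drop i.+1 cs by apply: drop_nth.
split.
  by rewrite nonempty_tops /F; simplify_upd; rewrite dropE -size_eq0 size_map size_cat szc //; lia.
rewrite /F dropE; apply: bigstep_eq;
  first exact: bigstep_improve s_idle (best_small i) (szc _ c_in).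
by rewrite /best (take_nth [::] ics) map_rcons foldl_rcons.
Qed.

End Correct.

Lemma bigstep_recovery_prog B x r t (valid : bits -> bool) (val : bits -> bits)
    (us vs cs : seq bits) :
  0 < grid_side D x r ->
  size (start_word D x r) <= grid_side D x r -> valid (start_word D x r) ->
  (forall w, size w <= grid_side D x r -> decided_in D t x w (valid w) (val w)) ->
  ample D B x r t ->
  size (vector_word us ++ vector_word vs) <= B ->
  (forall u, u \in us ++ vs -> size u <= B) -> size us + size vs <= B ->
  [seq nth false u 2 | u <- us ++ vs] = flatten cs -> size cs <= B ->
  (forall c, c \in cs -> size c = grid_side D x r * #|kind|) ->
  exists2 s',
    bigstep B recovery_prog (input_stacks [:: x; vector_word us ++ vector_word vs; r]) s' &
    s' rIn0 = map bit_sym (rev (foldl (best_of valid val) (start_word D x r, val (start_word D x r))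
      [seq candidate (grid_side D x r).-1 c | c <- cs]).1).
Proof.
move=> n_gt0 startn valid_start decided room yB uB usB flagsE csB szc.
have [gridB sB wB LB] := room; set y := vector_word us ++ vector_word vs in yB *.
have [xB rB] : size x <= B /\ size r <= B by move: sB; rewrite /base_size; lia.
have sideE : (grid_side D x r).-1.+1 = grid_side D x r by exact: prednK.
rewrite -sideE in startn decided szc.
set start := start_word D x r in startn valid_start *; set best := foldl _ _ _.
pose s0 := (prepared x r (map bit_sym y) true (val start)).[rValid <- [::]].[rPair <- [::]].
exists (with_best s0 best).[rBest <- [::]].[rIn0 <- rev (map bit_sym best.1)];
  last by rewrite upd_same map_rev.
rewrite input_stacksE //=.
run bigstep_transfer; simplify_upd; rewrite ?size_map ?size_rev //.
run bigstep_transfer; simplify_upd; rewrite ?size_map ?size_rev //.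
run bigstep_transfer; simplify_upd; rewrite ?size_map ?size_rev // !map_rev !catrevE !revK !cats0.
set si := upd _ _ _; have {si}-> : si = inputs x r (map bit_sym y).
  by rewrite /si /inputs; eq_stacks.
have start_dec := decided _ startn; rewrite valid_start in start_dec.
apply: (bigstep_seq (bigstep_prepare _ start_dec room)).
run bigstep_clear_stack; first by rewrite /prepared; simplify_upd; rewrite /=; lia.
eapply bigstep_seq; first by apply: bigstep_read_pair.
rewrite flagsE; have tB : size x + (grid_side D x r).-1.+1 + t + 2 < B by lia.
have s0_idle : idle x (grid_side D x r).-1 s0 by rewrite /idle sideE.
have start_small : small B (start, val start).
  by split; [rewrite (leq_trans startn) //; lia | exact: (size_val decided tB)].
have loop := bigstep_improve_loop decided tB s0_idle start_small erefl szc csB.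
have best_small : small B best.
  rewrite /best; elim: (cs) (start, _) start_small => //= c l IH b b_small.
  by apply: IH; apply: (small_best_of decided tB) => //; exact: size_guess.
apply: (bigstep_seq (s1 := with_best s0 best)).
  by move: loop; congr bigstep; rewrite /with_best /s0 /prepared; eq_stacks.
run_last bigstep_transfer; rewrite /with_best; simplify_upd; first by rewrite size_map;
  case: best_small.
by rewrite catrevE cats0; eq_stacks.
Qed.

End Recovery.

(** * Polynomial bounds *)

Definition poly_dominated (f : nat -> nat) := exists k, forall m, 2 <= m -> f m <= m ^ k.

Lemma poly_dominated_le f g : (forall m, f m <= g m) -> poly_dominated g -> poly_dominated f.
Proof. by move=> fg [k gk]; exists k => m m2; apply: leq_trans (fg m) (gk m m2). Qed.

Lemma poly_dominated_const c : poly_dominated (fun _ => c).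
Proof.
exists c => m m2; apply: leq_trans (ltnW (ltn_expl c (ltnSn 1))) _.
by case: c => // c; rewrite leq_exp2r.
Qed.

Lemma poly_dominated_id : poly_dominated id.
Proof. by exists 1 => m _; rewrite expn1. Qed.

Lemma poly_dominated_mul f g :
  poly_dominated f -> poly_dominated g -> poly_dominated (fun m => f m * g m).
Proof.
by move=> [a fa] [b gb]; exists (a + b) => m m2; rewrite expnD leq_mul ?fa ?gb.
Qed.

Lemma poly_dominated_add f g :
  poly_dominated f -> poly_dominated g -> poly_dominated (fun m => f m + g m).
Proof.
move=> [a fa] [b gb]; exists (a + b).+1 => m m2; have m_gt0 : 0 < m by apply: leq_trans m2.
apply: leq_trans (leq_add (fa m m2) (gb m m2)) _.
apply: (@leq_trans (2 * m ^ (a + b))); last by rewrite expnS leq_mul.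
by rewrite mul2n -addnn leq_add // leq_pexp2l ?leq_addr ?leq_addl.
Qed.

Lemma poly_dominated_exp f k : poly_dominated f -> poly_dominated (fun m => f m ^ k).
Proof.
move=> fP; elim: k => [|k IH]; first exact: (poly_dominated_const 1).
by apply: poly_dominated_le (poly_dominated_mul fP IH) => m; rewrite expnS.
Qed.

Lemma poly_dominated_poly_bound f k :
  poly_dominated f -> poly_dominated (fun m => poly_bound k (f m)).
Proof.
move=> fP; apply: poly_dominated_add; last exact: poly_dominated_const.
by apply: poly_dominated_mul; [exact: poly_dominated_const | exact: poly_dominated_exp].
Qed.

Lemma poly_dominated_cost (Reg G : finType) (p : prog Reg G) f :
  poly_dominated f -> poly_dominated (fun m => cost (f m) p).
Proof.
move=> fP; have [C [h costB]] := cost_poly p.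
apply: (@poly_dominated_le _ (fun m => C * (f m + 1) ^ h)) => [m|]; first by rewrite addn1.
apply: poly_dominated_mul; first exact: poly_dominated_const.
by apply/poly_dominated_exp/poly_dominated_add; last exact: poly_dominated_const.
Qed.

Lemma leq_poly_bound k l a b : k <= l -> a <= b -> poly_bound k a <= poly_bound l b.
Proof.
move=> kl ab; rewrite /poly_bound.
have [->|k_gt0] := posnP k; first by rewrite mul0n.
rewrite leq_add // leq_mul //; apply: (@leq_trans (b ^ k)); first by rewrite leq_exp2r.
by have [->|b_gt0] := posnP b; [rewrite exp0n | rewrite leq_pexp2l].
Qed.

Lemma poly_dominated_bound f : poly_dominated f ->
  exists k, forall n, f (n + 2) <= poly_bound k n.
Proof.
move=> [K fK]; exists (3 ^ K + K) => n; apply: leq_trans (fK _ _) _; first by rewrite addn2.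
have exp2r a b : a <= b -> a ^ K <= b ^ K by case: (K) => // k ab; rewrite leq_exp2r.
rewrite /poly_bound; have [->|n_gt0] := posnP n.
  apply: (@leq_trans (3 ^ K + K)); last exact: leq_addl.
  by rewrite (leq_trans (exp2r 2 3 isT)) // leq_addr.
apply: (@leq_trans ((3 * n) ^ K)); first by apply: exp2r; lia.
rewrite expnMn; apply: leq_trans (leq_addr _ _); rewrite leq_mul ?leq_addr //.
by rewrite leq_pexp2l // leq_addl.
Qed.

(** * Enumerations and encodings *)

Lemma flatten_flatten (T : Type) (sss : seq (seq (seq T))) :
  flatten (flatten sss) = flatten [seq flatten ss | ss <- sss].
Proof. by elim: sss => //= ss sss <-; rewrite flatten_cat. Qed.

Lemma enum_prodE (A B : finType) : enum {: A * B} = [seq (a, b) | a <- enum A, b <- enum B].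
Proof. by rewrite [LHS]enumT [in LHS]unlock. Qed.

Lemma map_enum_prod (A B : finType) (T : Type) (F : A * B -> T) :
  [seq F u | u <- enum {: A * B}] = flatten [seq [seq F (a, b) | b <- enum B] | a <- enum A].
Proof. by rewrite enum_prodE map_allpairs. Qed.

Lemma flatten_enum_prod (A B : finType) (T : Type) (F : A * B -> seq T) :
  flatten [seq F u | u <- enum {: A * B}] =
  flatten [seq flatten [seq F (a, b) | b <- enum B] | a <- enum A].
Proof. by rewrite map_enum_prod flatten_flatten -map_comp. Qed.

Lemma flatten_enum_ord (T : Type) n (F : nat -> seq T) :
  flatten [seq F i | i : 'I_n] = flatten [seq F i | i <- iota 0 n].
Proof. by rewrite /image_mem (map_comp F val) val_enum_ord. Qed.

Lemma flatten_grid (T : finType) L n n' (F : nat -> nat -> nat -> T -> bits) : n = n' ->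
  flatten [seq F u.1 u.2.1 u.2.2.1 u.2.2.2
    | u : 'I_L * ('I_n * ('I_n * T)) <- enum {: 'I_L * ('I_n * ('I_n * T))}] =
  grid_word L n' (fun l t i => flatten [seq F l t i k | k <- enum T]).
Proof.
move=> <-; rewrite flatten_enum_prod /grid_word -flatten_enum_ord; congr flatten;
  apply: eq_map => l.
rewrite flatten_enum_prod -flatten_enum_ord; congr flatten; apply: eq_map => t.
by rewrite flatten_enum_prod -flatten_enum_ord.
Qed.

Lemma map_enum_val (T : finType) (U : Type) (F : T -> U) :
  [seq F (enum_val i) | i <- enum 'I_#|T|] = [seq F a | a <- enum T].
Proof.
case: (pickP T) => [x0 _|T0]; last first.
  by rewrite (eq_enum T0) enum0; apply: size0nil; rewrite size_map -cardE card_ord (eq_card0 T0).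
transitivity [seq F (nth x0 (enum T) (val i)) | i <- enum 'I_#|T|].
  by apply: eq_map => i; rewrite (enum_val_nth x0).
rewrite (map_comp (fun k => F (nth x0 (enum T) k)) val) val_enum_ord.
by rewrite (map_comp F (nth x0 (enum T))) cardE -/(mkseq _ _) mkseq_nth.
Qed.

Lemma enc_mx_fin (T U : finType) (G : T -> U -> rat) :
  enc_mx (\matrix_(i < #|T|, j < #|U|) G (enum_val i) (enum_val j))%R =
  flatten [seq delimit (flatten [seq delimit (enc_rat (G a b)) | b <- enum U]) | a <- enum T].
Proof.
rewrite /enc_mx /enc_seq -map_comp; congr flatten.
rewrite -(map_enum_val (fun a => delimit (flatten [seq delimit (enc_rat (G a b)) | b <- enum U]))).
apply: eq_map => i /=; congr delimit; congr flatten; rewrite -map_comp.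
rewrite -(map_enum_val (fun b => delimit (enc_rat (G (enum_val i) b)))).
by apply: eq_map => j /=; rewrite mxE.
Qed.

Lemma enc_mx_col d (u : 'cV[rat]_d) :
  enc_mx u = flatten [seq delimit (delimit (enc_rat (u i 0%R))) | i <- enum 'I_d].
Proof.
have enum_ord1 : enum 'I_1 = [:: ord0] by apply: (inj_map val_inj); rewrite val_enum_ord.
rewrite /enc_mx /enc_seq -map_comp; congr flatten; apply: eq_map => i /=.
by rewrite enum_ord1 /= cats0.
Qed.

Lemma delimit_flatten (ss : seq bits) :
  delimit (flatten ss) = flatten [seq escape u | u <- ss] ++ [:: false].
Proof. by rewrite delimitE escape_flatten. Qed.

Lemma escape_delimit_flatten (ss : seq bits) :
  escape (delimit (flatten ss)) = flatten [seq escape (escape u) | u <- ss] ++ [:: true; false].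
Proof. by rewrite delimitE escape_cat !escape_flatten -map_comp. Qed.

Lemma enc_polytopeE (R : realType) (P : polytope R) : enc_polytope P =
  delimit (enc_nat (pt_ineqs P)) ++ delimit (enc_nat (pt_dim P)) ++
  delimit (enc_mx (pt_A P)) ++ delimit (enc_mx (pt_b P)).
Proof. by rewrite /enc_polytope /enc_seq /= cats0. Qed.

(* Prevents the unfolding of the large finite types indexed by [check]. *)
Local Opaque check.

Section EncodeSystem.
Variables (D : algorithms) (x r v : bits) (R : realType).
Local Notation n := (grid_side D x r).
Local Notation nw := (word_bound D x r).
Local Notation L := (level_count D r).

Definition tableau_polytope : polytope R :=
  system_polytope (check D) (check_interface D) n.-1 nw x (fun l : 'I_L => threshold l r v) R.

Lemma enc_tableau_matrix : 0 < n ->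
  delimit (enc_mx (pt_A tableau_polytope)) = grid_word L n (fun l t i =>
    flatten [seq row_word x r v ro l t i ++ [:: true; false] | ro <- enum (row_kind (check D))])
  ++ [:: false].
Proof.
move=> n_gt0; pose th (l : 'I_L) := threshold l r v.
have -> : enc_mx (pt_A tableau_polytope) = _ :=
  enc_mx_fin (fun (a : system_row (check D) n.-1 L) (b : system_column (check D) n.-1 L) =>
    (system_entry (p := check D) (check_interface D) nw x th a b)%:~R%R).
rewrite delimit_flatten -map_comp; congr (_ ++ _).
rewrite -(flatten_grid _ _ (prednK n_gt0)); congr (flatten _); apply: eq_map => a.
rewrite -[LHS]/(escape (delimit (flatten _))) escape_delimit_flatten -map_comp; congr (_ ++ _).
by rewrite /row_word -(flatten_grid _ _ (prednK n_gt0)).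
Qed.

Lemma enc_tableau_col : 0 < n ->
  delimit (enc_mx (pt_b tableau_polytope)) = grid_word L n (fun l t i =>
    flatten [seq rhs_word x r v ro l t i | ro <- enum (row_kind (check D))]) ++ [:: false].
Proof.
move=> n_gt0; rewrite enc_mx_col delimit_flatten -map_comp; congr (_ ++ _).
rewrite -(flatten_grid _ _ (prednK n_gt0)); congr (flatten _); rewrite -[RHS]map_enum_val.
apply: eq_map => i.
rewrite -[LHS]/(escape (delimit (delimit (enc_rat (pt_b tableau_polytope i 0%R))))) mxE.
by rewrite [delimit (delimit _)]delimitE escape_cat.
Qed.

Lemma enc_tableau_polytope : 0 < n -> enc_polytope tableau_polytope = polytope_word D x r v.
Proof.
move=> n_gt0; rewrite enc_polytopeE enc_tableau_matrix // enc_tableau_col // /polytope_word -!catA.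
congr (delimit (enc_nat _) ++ delimit (enc_nat _) ++ _).
  by rewrite -[LHS]/#|system_row (check D) n.-1 L| !card_prod !card_ord prednK.
by rewrite -[LHS]/#|system_column (check D) n.-1 L| !card_prod !card_ord prednK.
Qed.

End EncodeSystem.

Definition coord_words d (u : 'cV[rat]_d) : seq bits := [seq enc_rat (u i 0%R) | i <- enum 'I_d].

Lemma enc_vertex_pairE (R : realType) (P : polytope R) (y : vertex_pair P) :
  enc_vertex_pair y = vector_word (coord_words (vp_fst y)) ++ vector_word (coord_words (vp_snd y)).
Proof.
by rewrite /enc_vertex_pair /enc_seq /= cats0 !enc_mx_col !delimit_flatten /vector_word -!map_comp.
Qed.

Lemma enc_rat_pos (e : rat) : (0 <= e)%R -> nth false (enc_rat e) 2 = (0 < e)%R.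
Proof.
move=> e_ge0; rewrite /enc_rat /enc_seq /= -numq_gt0; have : (0 <= numq e)%R by rewrite numq_ge0.
case: (numq e) => [[|k]|//] _ //=.
by case E : (enc_nat k.+1) => [|b u] //; have := nat_of_bits_enc_nat k.+1; rewrite E.
Qed.

Section EmptyPolytope.
Variable R : realType.

Lemma empty_polyhedron (u : 'cV[R]_0) :
  ~ rat_polyhedron R (0 : 'M[rat]_(1, 0))%R (const_mx (-1) : 'cV[rat]_1)%R u.
Proof.
by move=> /(_ 0%R); rewrite map_mx0 mul0mx !mxE rmorphN rmorph1; lra.
Qed.

Lemma empty_bounded :
  bounded (rat_polyhedron R (0 : 'M[rat]_(1, 0))%R (const_mx (-1) : 'cV[rat]_1)%R).
Proof. by exists 0%R => u /empty_polyhedron. Qed.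

Definition empty_polytope : polytope R := Polytope empty_bounded.

Lemma empty_polytope_no_vertex (y : vertex_pair empty_polytope) : False.
Proof. exact: empty_polyhedron (vertex_in (vp_fstP y)). Qed.

End EmptyPolytope.

(** * Performance ratios *)

Lemma better_trans mx a b c : better mx a b -> ~~ better mx a c -> better mx c b.
Proof. by rewrite /better; case: mx; lia. Qed.

Lemma nat_of_bits_threshold l r v :
  nat_of_bits (threshold l r v) = l.+1 * 2 ^ size v %/ 2 ^ size r.
Proof. by rewrite /threshold nat_of_bits_drop nat_of_bits_nseq0 nat_of_bits_enc_nat mulnC. Qed.

(* An interval [[p, q)] contains about [(q - p) / E] multiples of [E]. *)
Lemma leq_count_multiples E p q L : q <= L.+1 * E ->
  q <= p + E + E * \sum_(l < L) ((p <= l.+1 * E) && (l.+1 * E < q)).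
Proof.
move=> qL; suff minn_le k :
    minn q (k.+1 * E) <= p + E + E * \sum_(l < k) ((p <= l.+1 * E) && (l.+1 * E < q)).
  by have := minn_le L; rewrite (minn_idPl qL).
elim: k => [|k IH]; first by rewrite big_ord0 muln0; lia.
rewrite big_ord_recr /=; set S := \sum_(_ < _) _ in IH *.
rewrite [k.+2 * E]mulSn addnC mulnDr; move: (k.+1 * E) IH => m IH.
by case: (leqP p m) => ?; case: (ltnP m q) => ?; rewrite ?muln1 ?muln0; lia.
Qed.

Lemma leq_missed_thresholds (mx : bool) (o v E Q L : nat) :
  let hi := if mx then o else v in let lo := if mx then v else o in
  0 < Q -> hi.+1 * Q <= L.+1 * E ->
  hi * Q <= lo * Q + E +
    E * \sum_(l < L) (better mx o (l.+1 * E %/ Q) && ~~ better mx v (l.+1 * E %/ Q)).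
Proof.
move=> hi lo Q_gt0 hiL; rewrite /better; case: mx @hi @lo hiL => hi lo hiL.
  have oQ : o * Q <= L.+1 * E by apply: leq_trans hiL; rewrite leq_mul2r leqnSn orbT.
  apply: leq_trans (leq_count_multiples (v * Q) oQ) _; rewrite leq_add2l leq_mul2l;
    apply/orP; right.
  by apply: leq_sum => l _; rewrite -leqNgt leq_divRL // ltn_divLR // andbC.
have -> : \sum_(l < L) ((o < l.+1 * E %/ Q) && ~~ (v < l.+1 * E %/ Q)) =
    \sum_(l < L) ((o.+1 * Q <= l.+1 * E) && (l.+1 * E < v.+1 * Q)).
  by apply: eq_bigr => l _; rewrite -leqNgt leq_divRL // -ltn_divLR.
have := leq_count_multiples (o.+1 * Q) hiL; move: (\sum_(l < L) _) => c.
by rewrite -/hi -/lo !mulSn; lia.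
Qed.

Lemma ler_missed_count (L : nat) (p q : 'I_L -> bool) (r : rat) : (1 < r)%R ->
  (forall l, q l -> p l) ->
  ((\sum_l (2 + 2 * p l))%:R <= r * (\sum_l (2 + 2 * q l))%:R)%R ->
  ((\sum_l (p l && ~~ q l))%:R <= 2 * L%:R * (r - 1))%R.
Proof.
move=> r1 qp; set c := \sum_l (p l && _); set Sq := \sum_l (2 + 2 * q l).
have -> : \sum_l (2 + 2 * p l) = Sq + 2 * c.
  rewrite /c big_distrr -big_split /=; apply: eq_bigr => l _.
  by case pE : (p l); case qE : (q l) => //; rewrite (qp l qE) in pE.
have : Sq <= 4 * L.
  rewrite -[X in _ <= 4 * X]card_ord mulnC -sum_nat_const; apply: leq_sum => l _.
  by case: (q l).
rewrite -(ler_nat rat) natrM natrD natrM => SqL gap.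
have r1Sq : ((r - 1) * Sq%:R <= (r - 1) * (4 * L%:R))%R by apply: ler_wpM2l => //; lra.
by lra.
Qed.

Lemma enc_rat_gap (r : rat) : (1 < r)%R -> (1 <= (2 ^ size (enc_rat r))%:R * (r - 1))%R.
Proof.
move=> r1; have den_num : (denq r < numq r)%R.
  by rewrite -(ltr_int rat) numqE -[ltLHS]mul1r ltr_pM2r // ltr0z denq_gt0.
have [d dE] : exists d : nat, denq r = d by case: (denq r) (denq_gt0 r) => // d _; exists d.
have d_le : d <= 2 ^ size (enc_rat r).
  apply: ltnW; apply: leq_trans (ltn_expn_size_enc_nat d) _; rewrite leq_exp2l //.
  rewrite /enc_rat /enc_seq /= dE !size_cat !delimitE !size_cat /escape /=.
  by elim: (enc_nat d) => //=; lia.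
have num_ge : ((d%:R + 1 : rat) <= r * d%:R)%R.
  have <- : ((numq r)%:~R = r * d%:R :> rat)%R by rewrite numqE dE.
  by rewrite -[(d%:R)%R]/((d%:Z)%:~R)%R -(rmorphD (intr : int -> rat) _ 1%R) ler_int -dE lezD1.
have gap : ((1 : rat) <= d%:R * (r - 1))%R by lra.
by apply: le_trans gap _; apply: ler_wpM2r; [lra | rewrite ler_nat].
Qed.

Definition ratio_const (rho : nat) : rat := (2 * rho * (1 + 2 * rho))%:R%R.

Lemma ratio_const_ge0 rho : (0 <= ratio_const rho)%R.
Proof. exact: ler0n. Qed.

Lemma ler_performance_ratio (rho Q E c lo hi v0 : nat) (t : rat) :
  0 < Q -> (1 <= Q%:R * t)%R -> (0 <= t)%R -> (c%:R <= 2 * (rho * Q)%:R * t)%R ->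
  hi * Q <= lo * Q + E + E * c -> hi <= rho * v0 -> v0 <= rho * lo ->
  (0 < v0 -> E <= 2 * v0) ->
  (hi%:R <= (1 + ratio_const rho * t) * lo%:R)%R.
Proof.
move=> Q_gt0 Qt t_ge0 ct hiQ hi_v0 v0_lo Ev0; have [v00|v0_gt0] := posnP v0.
  have -> : hi = 0 by move: hi_v0; rewrite v00 muln0; lia.
  by rewrite mulr_ge0 ?ler0n // addr_ge0 // mulr_ge0 ?ratio_const_ge0.
have Elo : (E%:R <= 2 * (rho%:R * lo%:R) :> rat)%R.
  by rewrite -!natrM ler_nat; have := Ev0 v0_gt0; lia.
have one_c : ((1 + c%:R : rat) <= Q%:R * (t * (1 + 2 * rho%:R)))%R.
  by move: ct; rewrite natrM; nra.
have hi_E : (hi%:R <= lo%:R + E%:R * (t * (1 + 2 * rho%:R)) :> rat)%R.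
  have Q_gt0' : (0 < Q%:R :> rat)%R by rewrite ltr0n.
  rewrite -(ler_pM2r Q_gt0'); move: hiQ; rewrite -(ler_nat rat) !natrD !natrM => hiQ.
  by have := ler_wpM2l (ler0n rat E) one_c; lra.
have t_rho : (0 <= t * (1 + 2 * rho%:R) :> rat)%R
  by rewrite mulr_ge0 // addr_ge0 // mulr_ge0 ?ler0n.
have := ler_wpM2r t_rho Elo; rewrite /ratio_const !(natrM, natrD); lra.
Qed.

Section Best.
Variables (D : algorithms) (valid : bits -> bool) (val : bits -> bits).
Local Notation best_of := (best_of D valid val).

Lemma foldl_best_of (b : bits * bits) ws : valid b.1 -> b.2 = val b.1 ->
  let b' := foldl best_of b ws in
  [/\ valid b'.1, b'.2 = val b'.1,
      ~~ better (maximizing D) (nat_of_bits b.2) (nat_of_bits b'.2) &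
      {in ws, forall w, valid w ->
        ~~ better (maximizing D) (nat_of_bits (val w)) (nat_of_bits b'.2)}].
Proof.
elim: ws b => [|w ws IH] b b_valid b_val /=; first by split=> //; rewrite /better ltnn if_same.
have [c_valid c_val] : valid (best_of b w).1 /\ (best_of b w).2 = val (best_of b w).1.
  by rewrite /best_of; case: ifP => // /andP[].
have [best_valid best_val c_le_best ws_le_best] := IH _ c_valid c_val.
have via_c a : ~~ better (maximizing D) a (nat_of_bits (best_of b w).2) ->
    ~~ better (maximizing D) a (nat_of_bits (foldl best_of (best_of b w) ws).2).
  by move: c_le_best; rewrite /better; case: (maximizing D); lia.
split=> // [|w']; first apply: via_c.
  rewrite /best_of; case: ifP => [/andP[_]|_] /=; rewrite /better; case: (maximizing D); lia.
rewrite inE => /predU1P[->|/ws_le_best //] w_valid; apply: via_c.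
rewrite /best_of w_valid /=; case: ifP => [_|/negbT //] /=.
by rewrite /better ltnn if_same.
Qed.

End Best.

(** * The reduction *)

Lemma nth_flatten_grid (T1 T2 : Type) (F : T1 -> T2 -> bool) (s : seq T1) (t : seq T2) a0 b0 i j :
  i < size s -> j < size t ->
  nth false (flatten [seq [seq F a b | b <- t] | a <- s]) (i * size t + j) =
  F (nth a0 s i) (nth b0 t j).
Proof.
elim: s i => //= a s IH [|i] i_s j_t; rewrite nth_cat size_map.
  by rewrite mul0n add0n j_t (nth_map b0).
have -> : (i.+1 * size t + j < size t) = false.
  by apply/negbTE; rewrite -leqNgt mulSn -addnA leq_addr.
by rewrite mulSn -addnA addKn IH.
Qed.

Lemma size_flatten_grid (T1 T2 T : Type) (F : T1 -> T2 -> T) (s : seq T1) (t : seq T2) :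
  size (flatten [seq [seq F a b | b <- t] | a <- s]) = size s * size t.
Proof. by elim: s => //= a s IH; rewrite size_cat size_map IH. Qed.

Section ReductionTime.
Variables (D : algorithms) (k : nat).
Local Notation bit_sym := (@bit_sym (host_symbol D)).
Local Notation input_stacks := (@input_stacks (host_reg D) (host_symbol D) _ (@host_tape D)).

Definition host_tm (p : prog (host_reg D) (host_char D)) : tm :=
  compile (@host_tape D) (@tape_host D) p.

Lemma tape_host0 : tape_host ord0 = rIn0 :> host_reg D.
Proof. by rewrite -[RHS]host_tapeK; congr tape_host; apply: val_inj. Qed.

Lemma host_tm_computes p B (ws : seq bits) s' out t :
  size ws <= 3 -> bigstep B p (input_stacks ws) s' -> s' rIn0 = map bit_sym (rev out) ->
  3 * cost B p + 2 * sumn [seq size w | w <- ws] + 3 <= t ->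
  tm_computes_in (host_tm p) t ws out.
Proof.
move=> ws3 p_run out_eq t_ge.
set S := sumn _ in t_ge *; have out_le : size out <= S + cost B p.
  have := size_bigstep rIn0 p_run; rewrite out_eq size_map size_rev => /leq_trans; apply.
  by rewrite leq_add2r size_map size_rev; exact: size_nth_sumn.
rewrite -tape_host0 in out_eq.
apply: tm_computes_mono (compile_correct (@host_tapeK D) (@tape_hostK D) p_run out_eq) _.
apply: (@leq_trans (2 * cost B p + S + (S + cost B p) + 3)); first by rewrite leq_add2r leq_add2l.
by apply: leq_trans t_ge; lia.
Qed.

Definition word_total m := m + (m + m ^ time_exp D + 2).

Definition host_bound l m :=
  2 * m + m ^ time_exp D + poly_bound k (word_total m) + 5 + m ^ word_exp D + l +
  2 * (l * m ^ time_exp D) +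
  l * (m ^ time_exp D * (m ^ time_exp D * (#|row_kind (check D)| + #|kind (check D)|))).

Lemma ample_host_bound m x r : base_size x r <= m ->
  ample D (host_bound (level_count D r) m) x r (poly_bound k (word_total m)).
Proof.
move=> xm; have exp_le e : base_size x r ^ e <= m ^ e by case: e => // e; rewrite leq_exp2r.
have := exp_le (time_exp D); have := exp_le (word_exp D);
  rewrite -/(grid_side D x r) -/(word_bound D x r).
have x_le : size x <= m by apply: leq_trans xm; rewrite /base_size -addnA leq_addr.
by rewrite /ample /host_bound => wordm gridm; split; lia.
Qed.

Lemma poly_dominated_host_bound l : poly_dominated (host_bound l).
Proof.
have pow e : poly_dominated (fun m => m ^ e) := poly_dominated_exp e poly_dominated_id.
have const c : poly_dominated (fun _ => c) := poly_dominated_const c.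
have total : poly_dominated word_total.
  by do !apply: poly_dominated_add; do ?[exact: poly_dominated_id | exact: pow | exact: const].
by rewrite /host_bound; do ![exact: poly_dominated_id | exact: pow | exact: const
  | exact: (poly_dominated_poly_bound k total) | apply: poly_dominated_add
  | apply: poly_dominated_mul].
Qed.

Lemma host_time (p : prog (host_reg D) (host_char D)) l : exists k', forall n,
  3 * cost (host_bound l (n + 2)) p + 2 * n + 3 <= poly_bound k' n.
Proof.
have [|k' bound_k'] := @poly_dominated_bound (fun m => 3 * cost (host_bound l m) p + 2 * m + 3).
  apply: poly_dominated_add; last exact: poly_dominated_const.
  apply: poly_dominated_add; apply: poly_dominated_mul; try exact: poly_dominated_const.
    by apply: poly_dominated_cost; exact: poly_dominated_host_bound.
  exact: poly_dominated_id.
by exists k' => n; apply: leq_trans (bound_k' n); lia.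
Qed.

End ReductionTime.

Arguments host_time {D} k p l.
Arguments ample_host_bound {D} k {m x r}.
Arguments host_tm {D} p.

Section Reduction.
Variables (R : realType) (A : opt_problem) (D : algorithms) (k : nat) (r0 : rat).
Hypothesis maximizingE : maximizing D = (if opt_goal A is Maximize then true else false).
Hypothesis verifierP : forall (x : inst A) (w : bits),
  tm_computes_poly (verifier D) k [:: enc_inst x; w] [:: `[< exists y : sol x, w = enc_sol y >]].
Hypothesis evaluatorP : forall (x : inst A) (y : sol x),
  tm_computes_poly (evaluator D) k [:: enc_inst x; enc_sol y] (enc_nat (value y)).
Hypothesis approximatorP : forall x : inst A, inhabited (sol x) ->
  exists2 y : sol x, ratio_le r0 y &
    tm_computes_poly (approximator D) k [:: enc_inst x] (enc_sol y).
Hypothesis size_sol : forall (x : inst A) (y : sol x),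
  size (enc_sol y) <= poly_bound k (size (enc_inst x)).

Local Notation rho := (2 ^ ratio_exp D).
Local Notation kind := (kind (check D)).
Local Notation io := (check_interface D).
Local Notation bit_sym := (@bit_sym (host_symbol D)).
Local Notation improves := (better (maximizing D)).

Definition input_bound m := m + m ^ word_exp D.
Definition threshold_bound m :=
  input_bound m + poly_bound k (input_bound m) + 2 + (ratio_exp D + m).+1.
Definition side_bound m :=
  (cost (threshold_bound m) (check D)).+1 + m ^ word_exp D + m + poly_bound k m + threshold_bound m.

Hypothesis ratio_exp_ge : (r0 <= rho%:R)%R.
Hypothesis word_exp_ge : forall m, 2 <= m -> poly_bound k m <= m ^ word_exp D.
Hypothesis time_exp_ge : forall m, 2 <= m -> side_bound m <= m ^ time_exp D.

Section Instance.
Variables (x : inst A) (r : rat).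
Local Notation xb := (enc_inst x).
Local Notation rb := (enc_rat r).
Local Notation m := (base_size xb rb).
Local Notation n := (grid_side D xb rb).
Local Notation N := n.-1.
Local Notation nw := (word_bound D xb rb).
Local Notation L := (level_count D rb).
Local Notation start := (start_word D xb rb).

Definition is_sol_word (w : bits) : bool := `[< exists y : sol x, w = enc_sol y >].
Definition value_word (w : bits) : bits :=
  match pselect (exists y : sol x, w = enc_sol y) with
  | left h => enc_nat (value (projT1 (cid h)))
  | right _ => [::]
  end.
Local Notation th l := (threshold l rb (value_word start)).

Lemma value_word_sol (y : sol x) : value_word (enc_sol y) = enc_nat (value y).
Proof.
rewrite /value_word; case: pselect => [h|[]]; last by exists y.
by case: (cid h) => y' /= /enc_sol_inj ->.
Qed.

Lemma is_sol_word_sol (y : sol x) : is_sol_word (enc_sol y).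
Proof. by apply/asboolP; exists y. Qed.

Lemma decided_sol w t : size xb + size w <= t ->
  decided_in D (poly_bound k t) xb w (is_sol_word w) (value_word w).
Proof.
move=> wt; split=> [|/asboolP[y wE]].
  by apply: tm_computes_mono (verifierP x w) _; apply: leq_poly_bound; rewrite //= addn0.
rewrite wE value_word_sol; apply: tm_computes_mono (evaluatorP y) _.
by apply: leq_poly_bound; rewrite //= addn0 -wE.
Qed.

Lemma base_ge2 : 2 <= m. Proof. by rewrite /base_size addn2. Qed.

Lemma size_inst_base : size xb <= m. Proof. by rewrite /base_size -addnA leq_addr. Qed.

Lemma side_bound_le : side_bound m <= n. Proof. exact: time_exp_ge base_ge2. Qed.

Lemma grid_side_gt0 : 0 < n. Proof. by rewrite expn_gt0 /base_size addn2. Qed.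

Lemma sideE : N.+1 = n. Proof. by rewrite prednK ?grid_side_gt0. Qed.

Lemma word_bound_side : nw <= N.
Proof.
rewrite -ltnS sideE; apply: leq_trans side_bound_le.
by rewrite /side_bound -/(word_bound D xb rb); lia.
Qed.

Lemma size_sol_word_bound (y : sol x) : size (enc_sol y) <= nw.
Proof.
apply: leq_trans (size_sol y) _; apply: leq_trans (word_exp_ge base_ge2).
exact: leq_poly_bound size_inst_base.
Qed.

Lemma configuration_verdict w t : size w <= nw -> size t <= threshold_bound m ->
  (configuration (check D) io xb t w N).2 rVerdict =
  [:: bit_sym (is_sol_word w && improves (nat_of_bits (value_word w)) (nat_of_bits t))].
Proof.
move=> w_nw t_le; have wt : size xb + size w <= input_bound m.
  by rewrite leq_add // size_inst_base.
have run : bigstep (threshold_bound m) (check D) (input io xb t w)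
    (checked (input io xb t w) (is_sol_word w) (value_word w) t).
  apply: (bigstep_check _ _ _ _ _ (decided_sol wt)) => //.
  by move: wt; rewrite /threshold_bound; lia.
have [j j_cost runE] := bigstep_halts run.
have jN : j <= N.
  rewrite -ltnS sideE; apply: leq_trans side_bound_le; rewrite /side_bound -!addnA.
  by rewrite ltnS (leq_trans j_cost) // leq_addr.
by rewrite /configuration -(subnKC jN) prog_runD runE prog_run_halted.
Qed.

Section Inhabited.
Variable y0 : sol x.
Hypothesis y0_computed : tm_computes_poly (approximator D) k [:: xb] (enc_sol y0).

Lemma startE : start = enc_sol y0.
Proof.
have [|_ //] := @tm_computes_mono _ _ n _ _ y0_computed.
rewrite /= addn0; apply: leq_trans side_bound_le;
  apply: leq_trans (leq_poly_bound _ size_inst_base) _.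
  exact: leqnn.
by rewrite /side_bound; lia.
Qed.

Lemma value_word_start : value_word start = enc_nat (value y0).
Proof. by rewrite startE value_word_sol. Qed.

Lemma is_sol_word_start : is_sol_word start.
Proof. by rewrite startE is_sol_word_sol. Qed.

Lemma size_threshold l : l < L -> size (th l) <= threshold_bound m.
Proof.
move=> lL; rewrite /threshold size_drop size_cat size_nseq.
have wt : size xb + size start <= input_bound m.
  by rewrite leq_add ?size_inst_base // startE size_sol_word_bound.
have := decided_sol wt; rewrite is_sol_word_start => /size_decided_value.
have : size (enc_nat l.+1) <= (ratio_exp D + size rb).+1.
  rewrite -(leq_exp2l _ _ (ltnSn 1)); apply: leq_trans (@expn_size_enc_nat_le l.+1 isT) _.
  by rewrite expnS mul2n leq_double.
by move: wt; rewrite /threshold_bound /base_size; lia.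
Qed.

Lemma size_threshold_side l : l < L -> size (th l) <= n.
Proof.
move=> /size_threshold thB; apply: leq_trans thB _; apply: leq_trans side_bound_le.
by rewrite /side_bound leq_addl.
Qed.

Local Notation P := (tableau_polytope D xb rb (value_word start) R).
Local Notation system_column := (system_column (check D) N L).
Local Notation var := (var (check D) N).
Local Notation F := (tableau_frame (check D) N).
Local Notation phi := (fun l : 'I_L => tableau_cnf (check D) io N nw xb (th l)).
Local Notation P_product := (@systemP _ _ (check D) io N nw L xb (fun l => th l) R).
Local Notation rat_vec := ('cV[rat]_#|system_column|).
Local Notation real_block U := (block (R := R) (I := 'I_L) (W := var) (map_mx ratr U)).
Implicit Types (U : rat_vec).

Definition positive_at U (c : system_column) : bool := nth false (enc_rat (U (enum_rank c) 0%R)) 2.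

(* Candidates are read off at every time, although only time 0 is needed. *)
Definition chunk U (u : 'I_L * 'I_N.+1) : bits :=
  flatten [seq [seq positive_at U (u.1, (u.2, (i, c))) | c <- enum kind] | i <- enum 'I_N.+1].

Lemma size_chunk U u : size (chunk U u) = n * #|kind|.
Proof. by rewrite /chunk size_flatten_grid size_enum_ord -cardE sideE. Qed.

Lemma positive_chunks U :
  [seq nth false u 2 | u <- coord_words U] = flatten [seq chunk U u | u <- enum {: 'I_L * 'I_N.+1}].
Proof.
rewrite -map_comp; transitivity [seq positive_at U c | c <- enum system_column].
  by rewrite -map_enum_val; apply: eq_map => j; rewrite /positive_at enum_valK.
rewrite map_enum_prod flatten_enum_prod; congr flatten; apply: eq_map => l.
by rewrite map_enum_prod; congr flatten; apply: eq_map => t; rewrite map_enum_prod.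
Qed.

Lemma flag_at_chunk U l (t : 'I_N.+1) i c : is_vertex (pt_set P) (map_mx ratr U) ->
  i <= N -> c != KLam (check D) -> c != KZ (check D) ->
  flag_at (chunk U (l, t)) i c = (0 < real_block U l (t, (inord i, c)))%R.
Proof.
move=> U_vertex iN c_lam c_z; rewrite /flag_at /chunk cardE.
rewrite (nth_flatten_grid (fun i c => positive_at U (l, (t, (i, c)))) ord0 c) ?size_enum_ord //;
  last by rewrite index_mem mem_enum.
have -> : nth ord0 (enum 'I_N.+1) i = inord i by apply: val_inj; rewrite /= nth_enum_ord // inordK.
rewrite nth_index ?mem_enum // /positive_at.
have blockE : real_block U l (t, (inord i, c)) =
    ratr (U (enum_rank (l, (t, (inord i, c)) : var)) 0%R).
  by rewrite /block /slice /coords mxE.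
have U_ge0 : (0 <= real_block U l (t, (inord i, c)))%R.
  have U_in : polyhedron
      (map_mx ratr (system_mx (check D) io N nw xb (fun l : 'I_L => th l)))
      (map_mx ratr (system_col (check D) N nw xb (fun l : 'I_L => th l)))
      (@vec R system_column (coords (map_mx ratr U))).
    by rewrite coordsK; exact: vertex_in.
  have [box _ _ _] := iffLR (P_product _) U_in l.
  have not_origin c' : c != c' -> (t, (inord i, c)) != (ord0, (ord0, c')) :> var.
    by apply: contraNneq => -[_ _ ->].
  by have /andP[] := box _ (not_origin _ c_lam) (not_origin _ c_z).
by rewrite blockE ler0q in U_ge0; rewrite blockE ltr0q enc_rat_pos.
Qed.

Lemma candidate_chunk U l : is_vertex (pt_set P) (map_mx ratr U) ->
  candidate D N (chunk U (l, ord0)) = guess N (guess_var io (fun v => 0 < real_block U l v)%R).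
Proof.
move=> U_vertex; apply: eq_guess => i iN.
by rewrite /guess_flags /guess_var !flag_at_chunk.
Qed.

Lemma good_chunk U (l : 'I_L) : is_vertex (pt_set P) (map_mx ratr U) ->
  good (phi l) (real_block U l) ->
  let w := candidate D N (chunk U (l, ord0)) in
  is_sol_word w && improves (nat_of_bits (value_word w)) (nat_of_bits (th l)).
Proof.
move=> U_vertex U_good /=; have extr := iffLR (vertex_blocks P_product _) U_vertex l.
have := tableau_sound (good_satisfies extr U_good); rewrite -candidate_chunk //.
set w := candidate _ _ _ => /andP[w_nw]; rewrite configuration_verdict ?size_threshold //.
by case: (_ && _).
Qed.

Definition chunks U : seq bits := [seq chunk U u | u <- enum {: 'I_L * 'I_N.+1}].
Definition pair_chunks (y : vertex_pair P) : seq bits := chunks (vp_fst y) ++ chunks (vp_snd y).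

Lemma vp_dist_le_chunks (y : vertex_pair P) : vp_dist y <= \sum_(l < L) (2 + 2 *
  has (fun c => let w := candidate D N c in
         is_sol_word w && improves (nat_of_bits (value_word w)) (nat_of_bits (th l)))
           (pair_chunks y)).
Proof.
apply: leq_trans (dist_le_good P_product (vp_fstP y) (vp_sndP y)) _.
apply: leq_sum => l _; rewrite leq_add2l leq_mul2l; apply/orP; right.
have chunk_in U : chunk U (l, ord0) \in chunks U by apply: map_f; rewrite mem_enum.
case: asboolP => [good_l|_] //; rewrite lt0b has_cat; apply/orP.
case: good_l => good_l; [left | right]; apply/hasP; eexists; try exact: chunk_in.
  exact: good_chunk (vp_fstP y) good_l.
exact: good_chunk (vp_sndP y) good_l.
Qed.

Section Witness.
Variables (y1 : sol x) (reached : 'I_L -> bool).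
Hypothesis reachedP : forall l, reached l -> improves (value y1) (nat_of_bits (th l)).

(* Two assignments which differ on the dummy variables, and which satisfy the clauses of the
   thresholds reached by [y1]. *)
Definition witness (dv : bool) (l : 'I_L) : var -> bool :=
  if reached l then tableau io xb (th l) (enc_sol y1) dv else fun _ => dv.

Definition witness_vec dv : rat_vec := (\col_j let lv := enum_val j in
  if lv.2 == frame_z F then 0 else if lv.2 == frame_lam F then 1 else (witness dv lv.1 lv.2)%:R)%R.

Lemma map_witness_vec dv : map_mx ratr (witness_vec dv) = assign_vec R F (witness dv).
Proof.
apply/matrixP => i j; rewrite !mxE /assign.
by case: (_ == _); [rewrite rmorph0 | case: (_ == _); rewrite ?rmorph1 // ratr_nat].
Qed.

Lemma witness_vertex dv : is_vertex (pt_set P) (map_mx ratr (witness_vec dv)).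
Proof. by rewrite map_witness_vec; exact: (vertex_assign_vec P_product). Qed.

Lemma good_witness dv l : reached l -> good (phi l) (assign R F (witness dv l)).
Proof.
move=> reached_l; apply: good_assign => c c_phi; rewrite /witness reached_l.
apply: (@tableau_complete _ _ (check D) io N nw xb (th l) (enc_sol y1) dv) c_phi.
  exact: size_sol_word_bound.
rewrite configuration_verdict ?size_sol_word_bound ?size_threshold //.
by rewrite is_sol_word_sol value_word_sol nat_of_bits_enc_nat reachedP.
Qed.

Lemma witness_dist : exists y : vertex_pair P, \sum_l (2 + 2 * reached l) <= vp_dist y.
Proof.
exists (VertexPair (witness_vertex false) (witness_vertex true)).
rewrite -[vp_dist _]/(skeleton_dist (pt_set P) (map_mx ratr (witness_vec false))
  (map_mx ratr (witness_vec true))) !map_witness_vec.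
have dummy dv l j : witness dv l (frame_dummy F j) = dv by rewrite /witness; case: (reached l).
apply: leq_trans (dist_ge_assign P_product (dummy false) (dummy true)).
apply: leq_sum => l _; rewrite leq_add2l leq_mul2l /=.
case reached_l : (reached l); rewrite ?leq0n // lt0b; apply/asboolP.
by split; apply: good_witness.
Qed.

End Witness.

Definition recovered (cs : seq bits) : bits :=
  (foldl (best_of D is_sol_word value_word) (start, value_word start)
    [seq candidate D N c | c <- cs]).1.

Section Recovered.
Variables (y : vertex_pair P) (s : sol x) (o : nat).
Hypothesis r_gt1 : (1 < r)%R.
Hypothesis y_ratio : @ratio_le (polytope_diameter R) r P y.
Hypothesis s_recovered : enc_sol s = recovered (pair_chunks y).
Hypothesis o_opt : is_opt x o.
Hypotheses (o_le : (o%:R <= r0 * (value y0)%:R)%R) (le_o : ((value y0)%:R <= r0 * o%:R)%R).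

Lemma recovered_best : ~~ improves (value y0) (value s) /\
  forall c, c \in pair_chunks y -> is_sol_word (candidate D N c) ->
    ~~ improves (nat_of_bits (value_word (candidate D N c))) (value s).
Proof.
have [_ best_val start_le cand_le] :=
  @foldl_best_of D is_sol_word value_word (start, value_word start)
  [seq candidate D N c | c <- pair_chunks y] is_sol_word_start erefl.
rewrite best_val -/(recovered _) -s_recovered value_word_sol /= ?value_word_start
  !nat_of_bits_enc_nat
  in start_le cand_le.
by split=> // c c_in; apply: cand_le; exact: map_f.
Qed.

Lemma improves_opt n' : improves (value s) n' -> improves o n'.
Proof.
have [_ /(_ s)] := o_opt; rewrite maximizingE /better.
by case: (opt_goal A) => s_o; [exact: leq_ltn_trans | move=> /leq_trans; apply].
Qed.

Lemma missed_thresholds :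
  ((\sum_(l < L) (improves o (nat_of_bits (th l)) && ~~ improves (value s) (nat_of_bits (th l))))%:R
    <= 2 * L%:R * (r - 1) :> rat)%R.
Proof.
have [_ cand_le] := recovered_best; have [[yo yo_o] _] := o_opt.
have [nB [_ y_opt] [y_le _]] := y_ratio.
apply: ler_missed_count => // [l|]; first exact: improves_opt.
have [l|y1 y1_dist] := @witness_dist yo (fun l : 'I_L => improves o (nat_of_bits (th l))).
  by rewrite yo_o.
apply: (@le_trans _ _ nB%:R)%R; first by rewrite ler_nat (leq_trans y1_dist) //; exact: y_opt.
apply: le_trans y_le _; apply: ler_wpM2l; first by move: r_gt1; lra.
rewrite ler_nat; apply: leq_trans (vp_dist_le_chunks y) _.
apply: leq_sum => l _; rewrite leq_add2l leq_mul2l; apply/orP; right.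
case E : (has _ _) => //; have /hasP[c c_in /andP[c_valid c_better]] := E.
by rewrite (better_trans c_better) // cand_le.
Qed.

Lemma ler_rho (a b : nat) : (a%:R <= r0 * b%:R)%R -> a <= rho * b.
Proof.
move=> ab; rewrite -(ler_nat rat) natrM; apply: le_trans ab _.
by apply: ler_wpM2r; first exact: ler0n.
Qed.

Definition larger := if maximizing D then o else value s.
Definition smaller := if maximizing D then value s else o.

Lemma larger_smaller : [/\ smaller <= larger, larger <= rho * value y0 & value y0 <= rho * smaller].
Proof.
have [not_worse _] := recovered_best; have [_ /(_ s) s_o] := o_opt.
have rho_gt0 : 0 < rho by rewrite expn_gt0.
have := ler_rho o_le; have := ler_rho le_o.
move: not_worse s_o; rewrite /larger /smaller /better maximizingE.
by case: (opt_goal A); rewrite -leqNgt => ? ? ? ?; split=> //; nia.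
Qed.

Lemma larger_le : (larger%:R <= (1 + ratio_const rho * (r - 1)) * smaller%:R :> rat)%R.
Proof.
have [_ larger_v0 v0_smaller] := larger_smaller; have r1 : (0 <= r - 1)%R by move: r_gt1; lra.
set c := \sum_(l < L)
  (improves o (nat_of_bits (th l)) && ~~ improves (value s) (nat_of_bits (th l))).
apply: (@ler_performance_ratio _ (2 ^ size rb) (2 ^ size (value_word start)) c
  _ _ (value y0)) => //.
- by rewrite expn_gt0.
- exact: enc_rat_gap.
- by have := missed_thresholds; rewrite -/c /level_count expnD.
- rewrite /c; under eq_bigr do rewrite nat_of_bits_threshold.
  apply: leq_missed_thresholds; first by rewrite expn_gt0.
  have v0_lt : value y0 < 2 ^ size (value_word start)
    by rewrite value_word_start ltn_expn_size_enc_nat.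
  rewrite -/larger (leq_trans _ (leq_mul (leqnSn L) (leqnn _))) // /level_count expnD -mulnA
    mulnCA mulnC.
  rewrite leq_mul2l; apply/orP; right; apply: leq_trans (leq_mul (leqnn rho) v0_lt).
  by apply: leq_ltn_trans larger_v0 _; rewrite mulnS -addn1 addnC leq_add2r expn_gt0.
- by move=> v0_gt0; rewrite mul2n value_word_start expn_size_enc_nat_le.
Qed.

Lemma recovered_ratio : @ratio_le A (1 + ratio_const rho * (r - 1))%R x s.
Proof.
exists o => //; have [le_larger _ _] := larger_smaller; have larger_le := larger_le.
have smaller_le : (smaller%:R <= (1 + ratio_const rho * (r - 1)) * larger%:R :> rat)%R.
  apply: (@le_trans _ _ larger%:R%R); first by rewrite ler_nat.
  rewrite mulrDl mul1r lerDl mulr_ge0 ?ler0n // mulr_ge0 ?ratio_const_ge0 //.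
  by move: r_gt1; lra.
by move: larger_le smaller_le; rewrite /larger /smaller; case: (maximizing D).
Qed.

End Recovered.
End Inhabited.
End Instance.

Local Notation L r := (level_count D (enc_rat r)).
Local Notation n x r := (grid_side D (enc_inst x) (enc_rat r)).
Local Notation start x r := (start_word D (enc_inst x) (enc_rat r)).

Definition reduced_polytope (r : rat) (x : inst A) : polytope R :=
  if `[< inhabited (sol x) >]
  then tableau_polytope D (enc_inst x) (enc_rat r) (value_word x (start x r)) R
  else empty_polytope R.

Definition positive_coords (P : polytope R) (y : vertex_pair P) : bits :=
  [seq nth false u 2 | u <- coord_words (vp_fst y) ++ coord_words (vp_snd y)].

Definition coord_chunks (x : inst A) r (P : polytope R) (y : vertex_pair P) : seq bits :=
  reshape (nseq (L r * n x r + L r * n x r) (n x r * #|kind|)) (positive_coords y).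

Section TableauPair.
Variables (r : rat) (x : inst A).
Variable y : vertex_pair (tableau_polytope D (enc_inst x) (enc_rat r) (value_word x (start x r)) R).

Lemma positive_coordsE : positive_coords y = flatten (pair_chunks y).
Proof. by rewrite /positive_coords map_cat flatten_cat -!positive_chunks. Qed.

Lemma shape_chunks U : shape (@chunks x r U) = nseq (L r * n x r) (n x r * #|kind|).
Proof.
rewrite /shape -map_comp (eq_map (size_chunk U)) map_const.
by rewrite -cardE card_prod !card_ord sideE.
Qed.

Lemma coord_chunksE : coord_chunks x r y = pair_chunks y.
Proof.
rewrite /coord_chunks positive_coordsE nseqD -{1}(shape_chunks (vp_fst y))
  -(shape_chunks (vp_snd y)).
by rewrite /shape -map_cat flattenK.
Qed.

End TableauPair.

Lemma is_sol_word_startE x r : is_sol_word x (start x r) = `[< inhabited (sol x) >].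
Proof.
apply/idP/idP => [/asboolP[y _]|/asboolP/approximatorP[y0 _ y0_computed]].
  by apply/asboolP; exists.
exact: is_sol_word_start y0_computed.
Qed.

Lemma inhabited_of_pair r x (y : vertex_pair (reduced_polytope r x)) : inhabited (sol x).
Proof.
by move: y; rewrite /reduced_polytope; case: asboolP => // _ /empty_polytope_no_vertex.
Qed.

Lemma recovered_sol x r cs : inhabited (sol x) -> exists s : sol x, enc_sol s = recovered x r cs.
Proof.
move=> /asboolP; rewrite -(is_sol_word_startE x r) => start_valid.
have [/asboolP[s sE] _ _ _] :=
  @foldl_best_of D (is_sol_word x) (value_word x) (start x r, value_word x (start x r))
  [seq candidate D (n x r).-1 c | c <- cs] start_valid erefl.
by exists s; rewrite /recovered sE.
Qed.

Definition recovered_solution (r : rat) (x : inst A) (y : vertex_pair (reduced_polytope r x)) :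
  sol x :=
  projT1 (cid (recovered_sol r (coord_chunks x r y) (inhabited_of_pair y))).

Lemma enc_recovered_solution r x (y : vertex_pair (reduced_polytope r x)) :
  enc_sol (recovered_solution y) = recovered x r (coord_chunks x r y).
Proof. exact: projT2 (cid (recovered_sol r (coord_chunks x r y) (inhabited_of_pair y))). Qed.

Lemma reduction_ratio r x (y : vertex_pair (reduced_polytope r x)) : (1 < r)%R ->
  @ratio_le (polytope_diameter R) r (reduced_polytope r x) y ->
  @ratio_le A (1 + ratio_const rho * (r - 1))%R x (recovered_solution y).
Proof.
move=> r1; move: (enc_recovered_solution y); move: (recovered_solution y) => s.
move: y; rewrite /reduced_polytope; case: asboolP => [inh|_] y;
  last by case: (empty_polytope_no_vertex y).
have [y0 [o o_opt [o_le le_o]] y0_computed] := approximatorP inh.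
by rewrite coord_chunksE => sE y_ratio; apply: (recovered_ratio y0_computed r1 y_ratio sE o_opt).
Qed.

Lemma reduction_inhabited r x : inhabited (sol x) -> inhabited (vertex_pair (reduced_polytope r x)).
Proof.
move=> inh; rewrite /reduced_polytope; case: asboolP => // _.
have [y0 _ y0_computed] := approximatorP inh.
by have [//|y _] := @witness_dist x r y0 y0_computed y0 (fun _ => false); exists.
Qed.

Lemma reduced_polytope_time r : exists k', forall x : inst A,
  tm_computes_poly (host_tm (instance_prog D (enc_polytope (empty_polytope R)))) k'
    [:: enc_inst x; enc_rat r] (enc_polytope (reduced_polytope r x)).
Proof.
have [k' time] := host_time k (instance_prog D (enc_polytope (empty_polytope R))) (L r).
exists k' => x; rewrite /tm_computes_poly; set S := sumn _; pose m := S + 2.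
have baseE : base_size (enc_inst x) (enc_rat r) = m by rewrite /m /S /base_size /= addn0.
have start_le : size (enc_inst x) + size (start x r) <= word_total D m.
  have := size_start_word D (enc_inst x) (enc_rat r); rewrite /grid_side baseE.
  by have := size_inst_base x r; rewrite baseE /word_total; lia.
have nE : n x r = m ^ time_exp D by rewrite /grid_side baseE.
have grid_le c : c <= #|row_kind (check D)| + #|kind| ->
    L r * (n x r * (n x r * c)) <= host_bound D k (L r) m.
  move=> c_le; apply: leq_trans (leq_addl _ _); rewrite nE.
  by rewrite leq_mul // leq_mul // leq_mul.
have [//||||||s' run out] :=
  bigstep_instance_prog (enc_polytope (empty_polytope R)) (decided_sol start_le)
  (ample_host_bound k (eq_leq baseE)).
- exact: grid_side_gt0.
- by apply: leq_trans (side_bound_le x r); rewrite /side_bound; have := size_inst_base x r; lia.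
- exact: leq_trans (word_bound_side x r) (leq_pred _).
- rewrite is_sol_word_startE => /asboolP/approximatorP[y0 _ y0_computed] l lL.
  exact: (size_threshold_side y0_computed lL).
- by rewrite grid_le ?leq_addr.
- by rewrite grid_le ?leq_addl.
apply: (host_tm_computes _ run _ (time S)) => //; rewrite out; congr (map _ (rev _)).
rewrite is_sol_word_startE /reduced_polytope; case: ifP => // _.
by rewrite enc_tableau_polytope ?grid_side_gt0.
Qed.

Lemma size_coord_word u : size u < size (coord_word u).
Proof. by rewrite coord_wordE size_cat /=; elim: u => //= b u IH; lia. Qed.

Lemma size_vector_word us : size us <= size (vector_word us) /\
  (forall u, u \in us -> size u <= size (vector_word us)).
Proof.
rewrite /vector_word size_cat /= addn1; elim: us => //= u us [IHs IHu].
have u_lt := size_coord_word u; rewrite size_cat; split; first by lia.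
by move=> u'; rewrite inE => /predU1P[->|/IHu]; lia.
Qed.

Lemma recovered_solution_time r :
  exists k', forall (x : inst A) (y : vertex_pair (reduced_polytope r x)),
  tm_computes_poly (host_tm (recovery_prog D)) k'
    [:: enc_inst x; enc_vertex_pair y; enc_rat r] (enc_sol (recovered_solution y)).
Proof.
have [k' time] := host_time k (recovery_prog D) (L r).
exists k' => x y; rewrite /tm_computes_poly enc_recovered_solution; have inh := inhabited_of_pair y.
move: y; rewrite /reduced_polytope asboolT // => y.
have [y0 _ y0_computed] := approximatorP inh.
set S := sumn _; pose m := S + 2; pose B := host_bound D k (L r) m.
have SE : S = size (enc_inst x) + (size (enc_vertex_pair y) + size (enc_rat r))
  by rewrite /S /= addn0.
have mB : 2 * m <= B by rewrite /B /host_bound; lia.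
have base_le : base_size (enc_inst x) (enc_rat r) <= m by rewrite /m SE /base_size; lia.
have n_le : n x r <= m ^ time_exp D.
  by rewrite /grid_side; case: (time_exp D) => // e; rewrite leq_exp2r.
have decided w : size w <= n x r ->
  decided_in D (poly_bound k (word_total D m)) (enc_inst x) w (is_sol_word x w) (value_word x w).
  move=> w_n; apply: decided_sol; rewrite /word_total leq_add //; last by lia.
  exact: leq_trans (size_inst_base x r) base_le.
have yE := enc_vertex_pairE y; set us := coord_words (vp_fst y) in yE;
  set vs := coord_words (vp_snd y) in yE.
have yB : size (vector_word us ++ vector_word vs) <= B.
  by rewrite -yE; apply: leq_trans mB; rewrite /m SE; lia.
have [us_size us_in] := size_vector_word us; have [vs_size vs_in] := size_vector_word vs.
have in_le u : u \in us ++ vs -> size u <= B.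
  by rewrite mem_cat => /orP[/us_in|/vs_in]; move: yB; rewrite size_cat; lia.
have us_vs_le : size us + size vs <= B by move: yB; rewrite size_cat; lia.
have chunks_le : size (pair_chunks y) <= B.
  rewrite -coord_chunksE size_reshape size_nseq addnn -mul2n.
  by apply: (@leq_trans (2 * (L r * m ^ time_exp D)));
    [rewrite !leq_mul | rewrite /B /host_bound; lia].
have chunk_size c : c \in pair_chunks y -> size c = n x r * #|kind|.
  by rewrite mem_cat => /orP[] /mapP[u _ ->]; exact: size_chunk.
have start_le : size (start x r) <= n x r.
  rewrite (startE r y0_computed) (leq_trans (size_sol_word_bound r y0)) //.
  by rewrite (leq_trans (word_bound_side x r)) // leq_pred.
have [s' run out] :=
  bigstep_recovery_prog (grid_side_gt0 x r) start_le (is_sol_word_start r y0_computed)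
  decided (ample_host_bound k base_le) yB in_le us_vs_le (positive_coordsE y) chunks_le chunk_size.
rewrite -yE in run; rewrite coord_chunksE.
by apply: (host_tm_computes _ run _ (time S)).
Qed.

Lemma AP_reducible_polytope_diameter : AP_reducible A (polytope_diameter R).
Proof.
exists (ratio_const rho), reduced_polytope, recovered_solution; split.
- by rewrite /ratio_const ler1n muln_gt0 /= muln_gt0 expn_gt0.
- exists (host_tm (instance_prog D (enc_polytope (empty_polytope R)))) => r _.
  exact: reduced_polytope_time.
- exists (host_tm (recovery_prog D)) => r _; exact: recovered_solution_time.
- by move=> r x _; exact: reduction_inhabited.
- by move=> r x y r1; exact: reduction_ratio.
Qed.

End Reduction.

Lemma exists_ratio_exp (r : rat) : (1 < r)%R -> exists e, (r <= (2 ^ e)%:R)%R.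
Proof.
move=> r1; exists `|numq r|%N; apply: (@le_trans _ _ (`|numq r|%N%:R)%R).
  rewrite -[X in (_ <= X)%R]/((`|numq r|%N%:Z)%:~R)%R gez0_abs; last by rewrite numq_ge0; lra.
  rewrite numqE ler_peMr //; first by lra.
  by rewrite -[1%R]/(1%:~R)%R ler_int -gtz0_ge1 denq_gt0.
by rewrite ler_nat ltnW // ltn_expl.
Qed.

Lemma poly_dominated_side_bound D k : poly_dominated (side_bound D k).
Proof.
have pow e : poly_dominated (fun m => m ^ e) := poly_dominated_exp e poly_dominated_id.
have const c : poly_dominated (fun _ => c) := poly_dominated_const c.
have input : poly_dominated (input_bound D) := poly_dominated_add poly_dominated_id (pow _).
have thr : poly_dominated (threshold_bound D k).
  apply: (@poly_dominated_le _ (fun m => input_bound D m + poly_bound k (input_bound D m) + 2 +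
    (ratio_exp D + m + 1))) => [m|]; first by rewrite addn1.
  by do ![exact: input | exact: (poly_dominated_poly_bound k input) | exact: const
    | exact: poly_dominated_id | apply: poly_dominated_add].
apply: (@poly_dominated_le _
  (fun m => cost (threshold_bound D k m) (check D) + 1 + m ^ word_exp D + m +
  poly_bound k m + threshold_bound D k m)) => [m|]; first by rewrite addn1.
by do ![exact: thr | exact: (poly_dominated_cost (check D) thr) | exact: const | exact: pow
  | exact: (poly_dominated_poly_bound k poly_dominated_id) | exact: poly_dominated_id
  | apply: poly_dominated_add].
Qed.

Lemma tm_computes_poly_mono (M : tm) k k' ws out :
  k <= k' -> tm_computes_poly M k ws out -> tm_computes_poly M k' ws out.
Proof. by move=> kk' /tm_computes_mono; apply; exact: leq_poly_bound. Qed.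

Theorem theorem3 (R : realType) : APX_hard (polytope_diameter R).
Proof.
move=> A [[_ [ks sizeP] [ver [kv verP]] [eval [ke evalP]]] [r0 [approx [ka [r0_gt1 approxP]]]]].
have [e r0_le] := exists_ratio_exp r0_gt1.
pose k := ks + (kv + (ke + ka)).
have [w word_le] := poly_dominated_poly_bound k poly_dominated_id.
pose mx := if opt_goal A is Maximize then true else false.
(* [check] depends on the machines only, so that its cost determines the time exponent. *)
have [t side_le] := poly_dominated_side_bound (Algorithms ver eval approx mx e w 0) k.
apply: (@AP_reducible_polytope_diameter R A (Algorithms ver eval approx mx e w t) k r0) => //=.
- by move=> x u; apply: tm_computes_poly_mono (verP x u); rewrite /k; lia.
- by move=> x y; apply: tm_computes_poly_mono (evalP x y); rewrite /k; lia.
- move=> x /approxP[y y_ratio y_computed]; exists y => //.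
  by apply: tm_computes_poly_mono y_computed; rewrite /k; lia.
- by move=> x y; apply: leq_trans (sizeP x y) _; apply: leq_poly_bound; rewrite // /k; lia.
Qed.
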